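(* Suppose a sequence of bounded domains $D_j\subset\mathbb C^n$ converges in $\mathcal H^n$ to a bounded domain $D\subset\mathbb C^n$, and a ball $B(p,r+a)$, with $r,a>0$, is contained in all $D_j$. Suppose that for each $j$, $g_j(z,t)$ is a non-trivial one-parameter group action on $D_j$ generating the holomorphic vector field $X_j$, and that $\|X_j\|_B=1$ for all $j$, where $B=B(p,r)$. Then there is a subsequence $g_{j_k}(z,t)$ that converges to a non-trivial one-parameter group action $g(z,t)$ on $D$ uniformly on compacta in $D\times\mathbb R$, and $$\lim_{k\to\infty}X_{j_k}(w)=X(w)$$ uniformly on compacta in $D$, where $X$ is the holomorphic vector field generated by $g$.
   Context: A domain is a nonempty connected open set. $\mathcal H^n$ is the metric space of all bounded domains in $\mathbb C^n$, where the distance between $D_1$ and $D_2$ is the Hausdorff distance (for the Euclidean metric) between $\partial D_1$ and $\partial D_2$. $\operatorname{Aut}(D)$ is the Lie group of biholomorphic self-maps of $D$ (compact-open topology). A one-parameter group action on a domain $D$ is a one-parameter subgroup $g(\cdot,t)$, $t\in\mathbb R$, of $\operatorname{Aut}(D)$, so $g(z,0)=z$ and $g(z,t+s)=g(g(z,t),s)$; it is non-trivial if it is not identically the identity. It generates the holomorphic vector field $X(z)=\frac{\partial g}{\partial t}(z,0)$, $X:D\to\mathbb C^n$. $B(p,r)$ is the open Euclidean ball with center $p$ and radius $r$, and $\|X\|_E=\sup_{z\in E}|X(z)|$ with $|\cdot|$ the Euclidean norm.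
   Formalization: The formal theorem adds the hypothesis that the centre p lies in the limit domain D. Without it the claim fails: slit discs {|z|<2} minus arcs growing to the unit circle, with D={1<|z|<2} and B(p,r+a)=B(0,1/2), have only trivial limit actions. *)

(* Defs.v *)
From HB Require Import structures.
From mathcomp Require Import all_boot all_order all_algebra.
From mathcomp Require Import complex.
From mathcomp Require Import all_classical all_reals all_analysis.

Set Implicit Arguments.
Unset Strict Implicit.
Unset Printing Implicit Defensive.

Import Order.TTheory GRing.Theory Num.Theory.
Import numFieldNormedType.Exports.

Local Open Scope classical_set_scope.
Local Open Scope ring_scope.
Local Open Scope complex_scope.

(* [R[i]] carries no topology of its own; it receives that of the one-dimensional
   normed space over itself, i.e. of the modulus. *)
HB.instance Definition _ (R : rcfType) := NormedModule.copy R[i] R[i]^o.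

(* The library norm on row vectors is the max norm: it is used only through
   the topology and the notions of boundedness and differentiability it
   defines. All metric quantities go through [enorm]. *)
Notation Cn R n := 'rV[R[i]]_n (only parsing).

Section ComplexSpace.
Context {R : realType} {n : nat}.
Implicit Types (D E K : set (Cn R n)) (X f : Cn R n -> Cn R n)
  (g : Cn R n -> R -> Cn R n).

Definition enorm (z : Cn R n) : R :=
  Num.sqrt (\sum_(k < n) (complex.Re (z ord0 k) ^+ 2
                          + complex.Im (z ord0 k) ^+ 2)).

Definition eball (p : Cn R n) (r : R) : set (Cn R n) :=
  [set z | enorm (z - p) < r].

Definition sup_norm (E : set (Cn R n)) X : \bar R :=
  ereal_sup [set (enorm (X z))%:E | z in E].

Definition boundary D : set (Cn R n) := closure D `\` D°.

Definition edist_to_set (x : Cn R n) E : \bar R :=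
  ereal_inf [set (enorm (x - y))%:E | y in E].

Definition hausdorff_dist D E : \bar R :=
  maxe (ereal_sup [set edist_to_set x E | x in D])
       (ereal_sup [set edist_to_set y D | y in E]).

Definition is_domain D : Prop := [/\ D !=set0, open D & connected D].

Definition bounded_domain D : Prop := is_domain D /\ bounded_set D.

(* The distance on bounded domains only sees boundaries. Hence it does not
   separate distinct domains with a common boundary, and a ball contained in
   every term of a convergent sequence need not meet the limit domain. *)
Definition domain_dist D E : \bar R :=
  hausdorff_dist (boundary D) (boundary E).

(* [differentiable] is over the scalar field [R[i]], i.e. complex Frechet
   differentiability. *)
Definition holomorphic_on D f : Prop := forall z, D z -> differentiable f z.

Definition Aut D : set (Cn R n -> Cn R n) :=
  [set f | exists h : Cn R n -> Cn R n,
    [/\ holomorphic_on D f, holomorphic_on D h,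
        (forall z, D z -> D (f z)), (forall z, D z -> D (h z)) &
        (forall z, D z -> h (f z) = z) /\ (forall z, D z -> f (h z) = z)]].

(* Continuity of [t |-> g(., t)] into the compact-open topology on maps from
   D to D, tested on the subbasic sets {f | f(K) in U}. *)
Definition compact_open_continuous D g : Prop :=
  forall (t0 : R) (K U : set (Cn R n)),
    compact K -> K `<=` D -> open U -> (forall z, K z -> U (g z t0)) ->
    \forall t \near t0, forall z, K z -> U (g z t).

(* Actions are total functions whose values outside D are irrelevant. *)
Definition one_parameter_action D g : Prop :=
  [/\ forall t, Aut D (g^~ t),
      compact_open_continuous D g,
      forall z, D z -> g z 0 = z &
      forall z t s, D z -> g z (t + s) = g (g z t) s].

Definition nontrivial_action D g : Prop := exists z t, D z /\ g z t <> z.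

(* X is holomorphic on D and X(z) = dg/dt (z, 0). The derivative is written as
   the limit of the difference quotients, t being real while the values of g
   lie in a vector space over [R[i]]. *)
Definition generates D g X : Prop :=
  holomorphic_on D X /\
  forall z, D z ->
    (fun t : R => (t^-1)%:C *: (g z t - g z 0)) @ 0^' --> X z.

(* Uniform convergence on compact subsets of E of maps f_k defined on sets
   E_k: part of the assertion is that a compact subset of E lies in E_k for
   all large k, so that f_k is defined on it. *)
Definition cvg_on_compacta {T : topologicalType}
    (Ek : nat -> set T) (fk : nat -> T -> Cn R n)
    (E : set T) (f : T -> Cn R n) : Prop :=
  forall K : set T, compact K -> K `<=` E -> forall e : R, 0 < e ->
    \forall k \near \oo,
      K `<=` Ek k /\ forall x, K x -> enorm (fk k x - f x) < e.

End ComplexSpace.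

(* Main.v *)
(* The fields [X_j] are bounded by 1 on a ball about [p], so there the maps
   [g_j(., t)] tend to the identity as [t -> 0], uniformly in [j]. As they are
   uniformly bounded, Taylor expansion and a connectedness argument carry this
   over to a neighbourhood of every point of [D]; averaging along orbits turns
   it into locally uniform bounds for [X_j] (Cartan's argument), hence into
   equicontinuity of [g_j] in [(z, t)] and a quadratic estimate of
   [g_j(z, t) - z - t X_j(z)]. Limits are taken along a non-principal
   ultrafilter. For small [t] the limit map [g(., t)] is invertible near [p],
   hence everywhere by Hurwitz' theorem for the Jacobian determinant; so near
   each point the images of [g_j(., t)] contain balls of a fixed radius and
   [g(z, t)] avoids the boundary of [D]. Therefore [g(D, t)] is contained in
   [D] by connectedness, first for small [t] and then for all [t] by the group
   law. The limit is not trivial because [|X_j| = 1] in the supremum norm over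
   a ball that is relatively compact in [D]. *)

Require Import Defs.
From HB Require Import structures.
From mathcomp Require Import all_boot all_order all_algebra.
From mathcomp Require Import complex.
From mathcomp Require Import all_classical all_reals all_analysis.
From mathcomp Require Import ring lra.

Set Implicit Arguments.
Unset Strict Implicit.
Unset Printing Implicit Defensive.

Import Order.TTheory GRing.Theory Num.Theory.
Import numFieldNormedType.Exports.

Local Open Scope classical_set_scope.
Local Open Scope ring_scope.

(** * Real-valued norms on normed spaces over the complex numbers *)

Lemma subrBB (W : zmodType) (x y z t : W) : x - y - (z - t) = x - z - (y - t).
Proof. by rewrite !opprB addrACA [RHS]addrACA [- y - z]addrC. Qed.

Definition rnorm {R : realType} {V : normedModType R[i]} (v : V) : R :=
  complex.Re `|v|.

Section RealNorm.
Context {R : realType}.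
Local Notation C := R[i].
Implicit Types (V W : normedModType R[i]) (z : C) (x : R).

Lemma rnormE V (v : V) : `|v| = (rnorm v)%:C%C.
Proof. by rewrite /rnorm RRe_real // ger0_real. Qed.

Lemma rnorm_ge0 V (v : V) : 0 <= rnorm v.
Proof. by rewrite -lecR -rnormE; exact: normr_ge0. Qed.

Lemma rnorm0 V : rnorm (0 : V) = 0.
Proof. by apply: complexI; rewrite -rnormE normr0. Qed.

Lemma rnorm_eq0 V (v : V) : (rnorm v == 0) = (v == 0).
Proof.
by rewrite -(inj_eq (@complexI R)) -rnormE normr_eq0.
Qed.

Lemma rnorm_gt0 V (v : V) : (0 < rnorm v) = (v != 0).
Proof. by rewrite lt0r rnorm_ge0 rnorm_eq0 andbT. Qed.

Lemma rnormD V (v w : V) : rnorm (v + w) <= rnorm v + rnorm w.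
Proof. by rewrite -lecR raddfD /= -!rnormE ler_normD. Qed.

Lemma rnormN V (v : V) : rnorm (- v) = rnorm v.
Proof. by rewrite /rnorm normrN. Qed.

Lemma rnormB V (v w : V) : rnorm (v - w) <= rnorm v + rnorm w.
Proof. by rewrite -(rnormN w) rnormD. Qed.

Lemma rnormC V (v w : V) : rnorm (v - w) = rnorm (w - v).
Proof. by rewrite -rnormN opprB. Qed.

Lemma rnorm_tri V (u v w : V) : rnorm (v - w) <= rnorm (v - u) + rnorm (u - w).
Proof. by rewrite (le_trans _ (rnormD _ _)) // addrA subrK. Qed.

Lemma rnormZ V z (v : V) : rnorm (z *: v) = rnorm z * rnorm v.
Proof. by apply: complexI; rewrite rmorphM /= -!rnormE normrZ. Qed.

Lemma rnormM z (w : C) : rnorm (z * w) = rnorm z * rnorm w.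
Proof. exact: (rnormZ z (w : C^o)). Qed.

Lemma rnormX z k : rnorm (z ^+ k) = rnorm z ^+ k.
Proof. by apply: complexI; rewrite rmorphXn /= -!rnormE normrX. Qed.

Lemma rnormV z : rnorm z^-1 = (rnorm z)^-1.
Proof. by apply: complexI; rewrite fmorphV /= -!rnormE normfV. Qed.

Lemma rnorm_real x : rnorm (x%:C%C : C) = `|x|.
Proof.
by rewrite /rnorm normc_def /= expr0n addr0 sqrtr_sqr.
Qed.

Lemma rnorm1 : rnorm (1 : C) = 1.
Proof. by apply: complexI; rewrite -rnormE normr1. Qed.

Lemma rnorm_i : rnorm ('i%C : C) = 1.
Proof. by rewrite /rnorm normc_def /= expr0n expr1n add0r sqrtr1. Qed.

Lemma rnorm_Re z : `|complex.Re z| <= rnorm z.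
Proof. by rewrite -lecR -rnormE normc_ge_Re. Qed.

Lemma rnorm_Im z : `|complex.Im z| <= rnorm z.
Proof.
by rewrite -normrN -ReiNIm (le_trans (rnorm_Re _))// rnormM rnorm_i mulr1.
Qed.

Lemma rnorm_le_ReIm z : rnorm z <= `|complex.Re z| + `|complex.Im z|.
Proof.
by rewrite {1}[z]complexE (le_trans (rnormD _ _))// rnormM rnorm_i mul1r !rnorm_real.
Qed.

Lemma rnorm_sum V (I : Type) (s : seq I) (P : pred I) (F : I -> V) :
  rnorm (\sum_(i <- s | P i) F i) <= \sum_(i <- s | P i) rnorm (F i).
Proof.
elim/big_ind2 : _ => [|u a v b ua vb|//]; first by rewrite rnorm0.
by rewrite (le_trans (rnormD _ _))// lerD.
Qed.

Lemma ReD z (w : C) : complex.Re (z + w) = complex.Re z + complex.Re w.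
Proof. by case: z w => [? ?] []. Qed.

Lemma ImD z (w : C) : complex.Im (z + w) = complex.Im z + complex.Im w.
Proof. by case: z w => [? ?] []. Qed.

Lemma ReB z (w : C) : complex.Re (z - w) = complex.Re z - complex.Re w.
Proof. by case: z w => [? ?] []. Qed.

Lemma ImB z (w : C) : complex.Im (z - w) = complex.Im z - complex.Im w.
Proof. by case: z w => [? ?] []. Qed.

Lemma rballE V (v w : V) (e : R) : 0 < e ->
  ball v (e%:C%C : C) w <-> rnorm (w - v) < e.
Proof. by move=> e0; rewrite -ball_normE /= rnormE ltcR rnormC. Qed.

Lemma gt0C (e : C) : 0 < e -> e = (complex.Re e)%:C%C /\ 0 < complex.Re e.
Proof.
move=> e0; have ee : e = (complex.Re e)%:C%C by rewrite RRe_real // gtr0_real.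
by split=> //; rewrite -ltcR -ee.
Qed.

Lemma nbhs_rnormP V (v : V) (A : set V) :
  nbhs v A <-> exists2 e : R, 0 < e & forall w, rnorm (w - v) < e -> A w.
Proof.
split=> [/nbhs_ballP[e /= e0 eA]|[e e0 eA]].
  have [ee e'0] := gt0C e0; exists (complex.Re e) => // w wv.
  by apply: eA; rewrite ee; apply/rballE.
apply/nbhs_ballP; exists (e%:C%C) => /=; first by rewrite ltcR.
by move=> w /rballE-/(_ e0); exact: eA.
Qed.

Lemma near_rnorm V (v : V) (e : R) : 0 < e ->
  \forall w \near v, rnorm (w - v) < e.
Proof. by move=> e0; apply/nbhs_rnormP; exists e. Qed.

Lemma cvg_rnormP {T} {F : set_system T} {FF : Filter F} V (f : T -> V) (l : V) :
  f @ F --> l <-> forall e : R, 0 < e -> \forall x \near F, rnorm (f x - l) < e.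
Proof.
split=> [fl e e0|fl]; first by have := fl _ (near_rnorm l e0).
move=> A /nbhs_rnormP[e e0 eA].
by rewrite nbhs_simpl /=; near do apply: eA; exact: fl.
Unshelve. all: by end_near. Qed.

Lemma continuous_rnorm_le V (f : V -> R) (v : V) :
  (forall w, `|f w - f v| <= rnorm (w - v)) -> {for v, continuous f}.
Proof.
move=> H; apply/cvgrPdist_lt => e e0; have := near_rnorm v e0.
by apply: filterS => w; apply: le_lt_trans; rewrite distrC.
Qed.

Lemma continuous_rnorm V (v : V) : {for v, continuous (@rnorm R V)}.
Proof.
apply: continuous_rnorm_le => w; rewrite ler_norml; apply/andP; split.
  by rewrite lerNl opprB lerBlDr rnormC (le_trans _ (rnormD _ _))// subrK.
by rewrite lerBlDr (le_trans _ (rnormD _ _))// subrK.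
Qed.

Lemma continuous_rnormP V W (f : V -> W) (v : V) :
  {for v, continuous f} <-> forall e : R, 0 < e -> exists2 d : R, 0 < d &
    forall w, rnorm (w - v) < d -> rnorm (f w - f v) < e.
Proof.
split=> [/cvg_rnormP fc e /fc/nbhs_rnormP//|fc].
by apply/cvg_rnormP => e /fc ?; apply/nbhs_rnormP.
Qed.

Lemma continuous_comp_contraction V W (F : V -> W) (g : R -> V) (t : R) :
  (forall s, rnorm (g s - g t) <= `|s - t|) -> {for g t, continuous F} ->
  {for t, continuous (fun s => F (g s))}.
Proof.
move=> gt /cvg_rnormP Fc; apply/cvg_rnormP => e /Fc/nbhs_rnormP[d d0 dP].
apply/nbhs_ballP; exists d => //= s; rewrite /ball /= distrC => st.
by apply: dP; exact: le_lt_trans (gt s) st.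
Qed.

Lemma differentiable_rnorm V W (f : V -> W) (v : V) : differentiable f v ->
  forall e : R, 0 < e -> exists2 d : R, 0 < d &
    forall h, rnorm h < d -> rnorm (f (v + h) - f v - 'd f v h) <= e * rnorm h.
Proof.
move=> /diff_locally /eqaddoP fv e e0.
have /fv/nbhs_rnormP[d d0 dP] : 0 < (e%:C%C : C) by rewrite ltcR.
exists d => // h hd; have := dP h.
rewrite subr0 => /(_ hd).
by rewrite !rnormE -rmorphM lecR !fctE /= opprD addrA (addrC h).
Qed.

Lemma rnorm_differentiable V W (f : V -> W) (v : V) (df : {linear V -> W}) :
  continuous df ->
  (forall e : R, 0 < e -> exists2 d : R, 0 < d &
    forall h, rnorm h < d -> rnorm (f (v + h) - f v - df h) <= e * rnorm h) ->
  differentiable f v /\ 'd f v = df :> (V -> W).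
Proof.
move=> dfc H.
have E : f \o shift v = cst (f v) + df +o_ 0 id.
  apply/eqaddoP => e e0; have [-> e'0] := gt0C e0.
  have [d d0 dP] := H _ e'0; apply/nbhs_rnormP; exists d => // h.
  rewrite subr0 => hd; rewrite !rnormE -rmorphM lecR !fctE /=.
  by rewrite opprD addrA (addrC h); exact: dP.
have d := diff_unique dfc E; split=> //.
by apply/diff_locallyP; split; rewrite d.
Qed.

End RealNorm.

Section RowVectorNorm.
Context {R : realType} {n : nat}.
Implicit Types v w : 'rV[R[i]]_n.

Lemma rnorm_rV_le v (e : R) : 0 <= e ->
  (forall k, rnorm (v ord0 k) <= e) -> rnorm v <= e.
Proof.
move=> e0 H; have e0' : 0 <= (e%:C%C : R[i]) by rewrite ler0c.
rewrite -lecR -rnormE [`|v|]mx_normE -[e%:C%C]/((NngNum e0')%:num) num_le.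
apply/bigmax_leP; split => [|[i k] _ /=].
  by rewrite -num_le /=.
by rewrite -num_le /= (ord1 i) rnormE lecR.
Qed.

Lemma rnorm_coord v k : rnorm (v ord0 k) <= rnorm v.
Proof.
rewrite -lecR -!rnormE [`|v|]mx_normE -[`|v ord0 k|]nngE num_le.
exact: (@le_bigmax _ _ _ _ (fun ik : 'I_1 * 'I_n => `|v ik.1 ik.2|%:nng) (ord0, k)).
Qed.

End RowVectorNorm.
(** * Integrals of continuous complex functions over segments *)

Section Compactness.
Context {R : realType} {n : nat}.
Local Notation C := R[i].

Lemma continuous_pair_complex :
  continuous ((fun xy : R * R => xy.1 +i* xy.2)%C : R * R -> C).
Proof.
move=> [x y]; apply/cvg_rnormP => e e0.
have e2 : 0 < e / 2 by rewrite divr_gt0.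
have : \forall p \near (x, y), `|x - p.1| < e / 2 /\ `|y - p.2| < e / 2.
  exists (ball x (e / 2), ball y (e / 2)); first by split; exact: nbhsx_ballx.
  by move=> [a b] [].
apply: filterS => -[a b] /= [ax ay]; rewrite (le_lt_trans (rnorm_le_ReIm _))//=.
by rewrite (splitr e) ltrD// distrC.
Qed.

Lemma compact_rball (M : R) : compact [set v : 'rV[C]_n | rnorm v <= M].
Proof.
pose S : set C := (fun xy : R * R => xy.1 +i* xy.2)%C @` (`[- M, M] `*` `[- M, M]).
have cS : compact S.
  apply: continuous_compact; last by apply: compact_setX; exact: segment_compact.
  exact/continuous_subspaceT/continuous_pair_complex.
apply: (@subclosed_compact _ _ [set v : 'rV[C]_n | forall i, S (v ord0 i)]).
- by apply: (@preimage_closed _ _ (@rnorm R _) [set x | x <= M]);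
     [move=> ? _; exact: continuous_rnorm|exact: closed_le].
- exact: (rV_compact (fun=> cS)).
move=> v /= vM i; have vi := le_trans (rnorm_coord v i) vM.
exists (complex.Re (v ord0 i), complex.Im (v ord0 i)); last by case: (v _ _).
by split; rewrite /= in_itv /= -ler_norml (le_trans _ vi)// ?rnorm_Re// rnorm_Im.
Qed.

End Compactness.

Definition cint {R : realType} (a b : R) (u : R -> R[i]) : R[i] :=
  ((\int[lebesgue_measure]_(x in `[a, b]) complex.Re (u x))
   +i* (\int[lebesgue_measure]_(x in `[a, b]) complex.Im (u x)))%C.

Section ComplexIntegral.
Context {R : realType}.
Local Notation C := R[i].
Local Notation mu := (@lebesgue_measure R).
Implicit Types (a b c K : R) (u v : R -> C) (f : R -> R).

Definition continuous_itv a b u :=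
  forall x, a <= x <= b -> {for x, continuous u}.

Lemma continuous_Re : continuous (@complex.Re R : C -> R).
Proof. by move=> z; apply: continuous_rnorm_le => w; rewrite -ReB; exact: rnorm_Re. Qed.

Lemma continuous_Im : continuous (@complex.Im R : C -> R).
Proof. by move=> z; apply: continuous_rnorm_le => w; rewrite -ImB; exact: rnorm_Im. Qed.

Lemma integrable_continuous_itv a b f :
  (forall x, a <= x <= b -> {for x, continuous f}) ->
  mu.-integrable `[a, b] (EFin \o f).
Proof.
move=> fc; apply: continuous_compact_integrable; first exact: segment_compact.
by apply: continuous_in_subspaceT => x; rewrite inE /= in_itv /=; exact: fc.
Qed.

Lemma integrable_Re a b u : continuous_itv a b u ->
  mu.-integrable `[a, b] (EFin \o (fun x => complex.Re (u x))).
Proof.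
move=> uc; apply: integrable_continuous_itv => x /uc xc.
by apply: continuous_comp => //; exact: continuous_Re.
Qed.

Lemma integrable_Im a b u : continuous_itv a b u ->
  mu.-integrable `[a, b] (EFin \o (fun x => complex.Im (u x))).
Proof.
move=> uc; apply: integrable_continuous_itv => x /uc xc.
by apply: continuous_comp => //; exact: continuous_Im.
Qed.

Lemma eq_cint a b u v : (forall x, a <= x <= b -> u x = v x) ->
  cint a b u = cint a b v.
Proof.
move=> uv; congr Complex; apply: eq_Rintegral => x;
  by rewrite inE /= in_itv /= => /uv ->.
Qed.

Lemma cintD a b u v : continuous_itv a b u -> continuous_itv a b v ->
  cint a b (fun x => u x + v x) = cint a b u + cint a b v.
Proof.
move=> uc vc; rewrite /cint /= {3}/GRing.add /=; congr Complex.
  rewrite -RintegralD//; [|exact: integrable_Re..].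
  by apply: eq_Rintegral => x _; rewrite ReD.
rewrite -RintegralD//; [|exact: integrable_Im..].
by apply: eq_Rintegral => x _; rewrite ImD.
Qed.

Lemma continuous_itvZ a b u (z : C) : continuous_itv a b u ->
  continuous_itv a b (fun x => z * u x).
Proof.
move=> uc x xab; apply/cvg_rnormP => e e0.
have k0 : 0 < rnorm z + 1 by rewrite ltr_wpDl// rnorm_ge0.
have /cvg_rnormP/(_ (e / (rnorm z + 1))) := uc _ xab.
rewrite divr_gt0// => /(_ isT); apply: filterS => y.
rewrite -mulrBr rnormM ltr_pdivlMr// => ue; apply: le_lt_trans ue.
by rewrite mulrC ler_wpM2l ?rnorm_ge0// lerDl.
Qed.

Lemma cintZ a b u (z : C) : continuous_itv a b u ->
  cint a b (fun x => z * u x) = z * cint a b u.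
Proof.
move=> uc; have [uR uI] := (integrable_Re uc, integrable_Im uc).
case: z => [x y]; rewrite /cint /= {3}/GRing.mul /=; congr Complex.
  rewrite -!RintegralZl// -RintegralB//; last 2 first.
  - exact: (integrableZl _ _ uR).
  - exact: (integrableZl _ _ uI).
  by apply: eq_Rintegral => t _; case: (u t) => p q /=.
rewrite -!RintegralZl// -RintegralD//; last 2 first.
- exact: (integrableZl _ _ uI).
- exact: (integrableZl _ _ uR).
by apply: eq_Rintegral => t _; case: (u t) => p q /=; rewrite addrC.
Qed.

Lemma continuous_itv_cst a b (z : C) : continuous_itv a b (fun=> z).
Proof. by move=> ? _; exact: cst_continuous. Qed.

Lemma continuous_itvB a b u v : continuous_itv a b u -> continuous_itv a b v ->
  continuous_itv a b (fun x => u x - v x).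
Proof. by move=> uc vc x xab; apply: cvgB; [exact: uc|exact: vc]. Qed.

Lemma cintB a b u v : continuous_itv a b u -> continuous_itv a b v ->
  cint a b (fun x => u x - v x) = cint a b u - cint a b v.
Proof.
move=> uc vc.
have vc' := @continuous_itvZ _ _ _ (-1) vc.
rewrite -[- cint _ _ v]mulN1r -cintZ// -cintD//.
by apply: eq_cint => x _; rewrite mulN1r.
Qed.

Lemma Rintegral_cst_itv a b K : a <= b ->
  \int[mu]_(x in `[a, b]) K = K * (b - a).
Proof.
move=> ab; rewrite Rintegral_cst//; congr (_ * _).
transitivity (fine (lebesgue_measure (`[a, b]%classic : set R))) => //.
rewrite lebesgue_measure_itv /= lte_fin.
by move: ab; rewrite le_eqVlt => /predU1P[->|->]//; rewrite ltxx subrr.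
Qed.

Lemma cint_cst a b (z : C) : a <= b -> cint a b (fun=> z) = (b - a)%:C%C * z.
Proof.
move=> ab; rewrite /cint !Rintegral_cst_itv//.
by case: z => x y; rewrite /= {3}/GRing.mul /= !mul0r subr0 addr0 !(mulrC (b - a)).
Qed.

Lemma norm_Rintegral_le a b f K : a <= b ->
  mu.-integrable `[a, b] (EFin \o f) ->
  (forall x, a <= x <= b -> `|f x| <= K) ->
  `|\int[mu]_(x in `[a, b]) f x| <= K * (b - a).
Proof.
move=> ab fi fK; rewrite (le_trans (le_normr_Rintegral _ fi))//.
have -> : K * (b - a) = \int[mu]_(x in `[a, b]) K.
  by rewrite Rintegral_cst_itv.
apply: le_Rintegral => //; first exact: integrable_norm.
by apply: (@integrable_continuous_itv a b (cst K)) => x _; exact: cst_continuous.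
Qed.

(* The factor 2 is lost by bounding real and imaginary parts separately. *)
Lemma rnorm_cint a b u K : a <= b -> continuous_itv a b u ->
  (forall x, a <= x <= b -> rnorm (u x) <= K) ->
  rnorm (cint a b u) <= 2 * K * (b - a).
Proof.
move=> ab uc uK; rewrite (le_trans (rnorm_le_ReIm _))//= mulr2n mulrDl mul1r mulrDl.
apply: lerD; apply: norm_Rintegral_le => //.
- exact: integrable_Re.
- by move=> x /uK; apply: le_trans; exact: rnorm_Re.
- exact: integrable_Im.
- by move=> x /uK; apply: le_trans; exact: rnorm_Im.
Qed.

Lemma Rintegral_itv_cat a b c f : a <= b -> b <= c ->
  mu.-integrable `[a, c] (EFin \o f) ->
  \int[mu]_(x in `[a, c]) f x =
    \int[mu]_(x in `[a, b]) f x + \int[mu]_(x in `[b, c]) f x.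
Proof.
move=> ab bc fi; apply/eqP; rewrite addrC -subr_eq; apply/eqP.
rewrite Rintegral_itvB ?bnd_simp//.
rewrite Rintegral_itv_obnd_cbnd//.
apply: integrableS fi => //; apply: subset_itv; rewrite bnd_simp//.
Qed.

Lemma cint_cat a b c u : a <= b -> b <= c -> continuous_itv a c u ->
  cint a c u = cint a b u + cint b c u.
Proof.
move=> ab bc uc; rewrite /cint [RHS]/GRing.add /=; congr Complex.
  by apply: Rintegral_itv_cat => //; exact: integrable_Re.
by apply: Rintegral_itv_cat => //; exact: integrable_Im.
Qed.

End ComplexIntegral.
(** * The Cauchy-Goursat theorem on rectangles *)

Section Goursat.
Context {R : realType}.
Local Notation C := R[i].
Implicit Types (F : C -> C) (x y a b : R).

Lemma rnorm_pair (x y x' y' : R) :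
  rnorm ((x +i* y)%C - (x' +i* y')%C : C) <= `|x - x'| + `|y - y'|.
Proof. exact: (le_trans (rnorm_le_ReIm _)). Qed.

Lemma continuous_vertical F x y : {for (x +i* y)%C, continuous F} ->
  {for y, continuous (fun t => F (x +i* t)%C)}.
Proof.
apply: continuous_comp_contraction => s.
by rewrite (le_trans (rnorm_pair _ _ _ _))// subrr normr0 add0r.
Qed.

Lemma continuous_horizontal F x y : {for (x +i* y)%C, continuous F} ->
  {for x, continuous (fun t => F (t +i* y)%C)}.
Proof.
apply: (@continuous_comp_contraction _ _ _ F (fun t => t +i* y)%C) => s.
by rewrite (le_trans (rnorm_pair _ _ _ _))// subrr normr0 addr0.
Qed.

(* The integral of [F] along the boundary of [x, x + a] x [y, y + b]. *)
Definition rect_int F x y a b : C :=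
  'i%C * (cint y (y + b) (fun t => F ((x + a) +i* t)%C) -
          cint y (y + b) (fun t => F (x +i* t)%C)) -
  (cint x (x + a) (fun t => F (t +i* (y + b))%C) -
   cint x (x + a) (fun t => F (t +i* y)%C)).

Definition on_rect x y a b (P : C -> Prop) :=
  forall s t, x <= s <= x + a -> y <= t <= y + b -> P (s +i* t)%C.

Lemma rect_int_affine F x y a b (u v : C) (K : R) : 0 <= a -> 0 <= b ->
  on_rect x y a b (fun z => {for z, continuous F}) ->
  on_rect x y a b (fun z => rnorm (F z - (u + v * z)) <= K) ->
  rnorm (rect_int F x y a b) <= 4 * K * (a + b).
Proof.
move=> a0 b0 Fc FK.
have xa : x <= x <= x + a by rewrite lexx lerDl a0.
have xa' : x <= x + a <= x + a by rewrite lexx lerDl a0.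
have yb : y <= y <= y + b by rewrite lexx lerDl b0.
have yb' : y <= y + b <= y + b by rewrite lexx lerDl b0.
have cv s : x <= s <= x + a ->
    continuous_itv y (y + b) (fun t => F (s +i* t)%C).
  by move=> sx t ty; apply: continuous_vertical; exact: Fc.
have ch t : y <= t <= y + b ->
    continuous_itv x (x + a) (fun s => F (s +i* t)%C).
  by move=> ty s sx; apply: continuous_horizontal; exact: Fc.
pose E1 := cint y (y + b) (fun t => F ((x + a) +i* t)%C - F (x +i* t)%C - a%:C%C * v).
pose E2 := cint x (x + a) (fun s => F (s +i* (y + b))%C - F (s +i* y)%C - 'i%C * b%:C%C * v).
have -> : rect_int F x y a b = 'i%C * E1 - E2.
  have [c1 c2] := (cv _ xa', cv _ xa); have [c3 c4] := (ch _ yb', ch _ yb).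
  rewrite /E1 (cintB (continuous_itvB c1 c2) (@continuous_itv_cst _ _ _ _)) (cintB c1 c2).
  rewrite /E2 (cintB (continuous_itvB c3 c4) (@continuous_itv_cst _ _ _ _)) (cintB c3 c4).
  rewrite !cint_cst ?lerDl// /rect_int.
  rewrite (addrC y b) (addrC x a) !addrK.
  ring.
have E1K : rnorm E1 <= 2 * (K + K) * b.
  have -> : b = (y + b) - y by rewrite addrC addKr.
  apply: rnorm_cint; first by rewrite lerDl.
    by apply: continuous_itvB (@continuous_itv_cst _ _ _ _); apply: continuous_itvB; exact: cv.
  move=> t ty.
  have -> : F ((x + a) +i* t)%C - F (x +i* t)%C - a%:C%C * v =
    (F ((x + a) +i* t)%C - (u + v * ((x + a) +i* t)%C)) - (F (x +i* t)%C - (u + v * (x +i* t)%C)).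
    have -> : ((x + a) +i* t)%C = (x +i* t)%C + a%:C%C :> C by apply/eqP; rewrite eq_complex/= addr0 !eqxx.
    ring.
  by rewrite (le_trans (rnormB _ _))// lerD// FK.
have E2K : rnorm E2 <= 2 * (K + K) * a.
  have -> : a = (x + a) - x by rewrite addrC addKr.
  apply: rnorm_cint; first by rewrite lerDl.
    by apply: continuous_itvB (@continuous_itv_cst _ _ _ _); apply: continuous_itvB; exact: ch.
  move=> s sx.
  have -> : F (s +i* (y + b))%C - F (s +i* y)%C - 'i%C * b%:C%C * v =
    (F (s +i* (y + b))%C - (u + v * (s +i* (y + b))%C)) - (F (s +i* y)%C - (u + v * (s +i* y)%C)).
    have -> : (s +i* (y + b))%C = (s +i* y)%C + 'i%C * b%:C%C :> C.
      by apply/eqP; rewrite eq_complex/= !mul0r !mulr0 !mul1r !(addr0, subr0, add0r) !eqxx.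
    ring.
  by rewrite (le_trans (rnormB _ _))// lerD// FK.
rewrite (le_trans (rnormB _ _))// rnormM rnorm_i mul1r.
by rewrite (le_trans (lerD E1K E2K))//; lra.
Qed.

Lemma rect_int_split F x y a b : 0 <= a -> 0 <= b ->
  on_rect x y (a + a) (b + b) (fun z => {for z, continuous F}) ->
  rect_int F x y (a + a) (b + b) =
    rect_int F x y a b + rect_int F (x + a) y a b +
    rect_int F x (y + b) a b + rect_int F (x + a) (y + b) a b.
Proof.
move=> a0 b0 Fc.
have xa : x <= x <= x + (a + a) by lra.
have xa' : x <= x + a <= x + (a + a) by lra.
have xa'' : x <= x + (a + a) <= x + (a + a) by lra.
have yb : y <= y <= y + (b + b) by lra.
have yb' : y <= y + b <= y + (b + b) by lra.
have yb'' : y <= y + (b + b) <= y + (b + b) by lra.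
have cv s : x <= s <= x + (a + a) ->
    cint y (y + (b + b)) (fun t => F (s +i* t)%C) =
    cint y (y + b) (fun t => F (s +i* t)%C) +
    cint (y + b) (y + b + b) (fun t => F (s +i* t)%C).
  move=> sx; rewrite -(addrA y); apply: cint_cat; try lra.
  by move=> t ty; apply: continuous_vertical; exact: Fc.
have ch t : y <= t <= y + (b + b) ->
    cint x (x + (a + a)) (fun s => F (s +i* t)%C) =
    cint x (x + a) (fun s => F (s +i* t)%C) +
    cint (x + a) (x + a + a) (fun s => F (s +i* t)%C).
  move=> ty; rewrite -(addrA x); apply: cint_cat; try lra.
  by move=> s sx; apply: continuous_horizontal; exact: Fc.
rewrite /rect_int !cv// !ch// !addrA; ring.
Qed.

Let four_quarters (p q r s t : R) : p <= q + r + s + t ->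
  4 * q < p -> 4 * r < p -> 4 * s < p -> p <= 4 * t.
Proof. lra. Qed.

Lemma goursat_rect F x y a b : 0 <= a -> 0 <= b ->
  on_rect x y a b (fun z => differentiable F z) ->
  rect_int F x y a b = 0.
Proof.
move=> a0 b0 dF.
have cF : on_rect x y a b (fun z => {for z, continuous F}).
  by move=> s t sx ty; apply: differentiable_continuous; exact: dF.
apply/eqP; rewrite -rnorm_eq0; apply/negPn/negP => I0.
have {}I0 : 0 < rnorm (rect_int F x y a b) by rewrite lt0r I0 rnorm_ge0.
set d := rnorm _ in I0.
pose h k : R := 2^-1 ^+ k.
have h0 k : 0 < h k by rewrite exprn_gt0// invr_gt0.
have hS k : h k = h k.+1 + h k.+1.
  rewrite /h exprS; set q := _ ^+ k; lra.
pose J k (p : R * R) := rnorm (rect_int F p.1 p.2 (a * h k) (b * h k)).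
pose step k (p : R * R) : R * R :=
  if J k p <= 4 * J k.+1 p then p else
  if J k p <= 4 * J k.+1 (p.1 + a * h k.+1, p.2) then (p.1 + a * h k.+1, p.2) else
  if J k p <= 4 * J k.+1 (p.1, p.2 + b * h k.+1) then (p.1, p.2 + b * h k.+1) else
  (p.1 + a * h k.+1, p.2 + b * h k.+1).
pose P := fix P k := if k is k'.+1 then step k' (P k') else (x, y).
have ah k : 0 <= a * h k by rewrite mulr_ge0// ltW.
have bh k : 0 <= b * h k by rewrite mulr_ge0// ltW.
have ahS k : a * h k = a * h k.+1 + a * h k.+1 by rewrite -mulrDr -hS.
have bhS k : b * h k = b * h k.+1 + b * h k.+1 by rewrite -mulrDr -hS.
have step1 k : (P k).1 <= (P k.+1).1 /\ (P k.+1).1 + a * h k.+1 <= (P k).1 + a * h k.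
  rewrite /= /step; have := ah k.+1; have := ahS k.
  by case: ifPn => _; [|case: ifPn => _; [|case: ifPn => _]] => /= ? ?; split; lra.
have step2 k : (P k).2 <= (P k.+1).2 /\ (P k.+1).2 + b * h k.+1 <= (P k).2 + b * h k.
  rewrite /= /step; have := bh k.+1; have := bhS k.
  by case: ifPn => _; [|case: ifPn => _; [|case: ifPn => _]] => /= ? ?; split; lra.
have mono (u l : nat -> R) : (forall k, u k <= u k.+1 /\ u k.+1 + l k.+1 <= u k + l k) ->
    (forall k, 0 <= l k) ->
    exists c, forall k, u k <= c <= u k + l k.
  move=> ul l0.
  have um j k : u j <= u (j + k)%N.
    by elim: k => [|k IH]; rewrite ?addn0// addnS (le_trans IH)//; have [] := ul (j + k)%N.
  have lm j k : u (j + k)%N + l (j + k)%N <= u j + l j.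
    elim: k => [|k IH]; rewrite ?addn0// addnS (le_trans _ IH)//; by have [] := ul (j + k)%N.
  have ub k j : u j <= u k + l k.
    have [jk|/ltnW kj] := leqP j k.
      by rewrite -(subnKC jk) (le_trans (um j (k - j)%N))// lerDl.
    by have := lm k (j - k)%N; rewrite subnKC// => /(le_trans _); apply; rewrite lerDl.
  have sU : has_sup (range u).
    by split; [exists (u 0%N), 0%N|exists (u 0%N + l 0%N) => _ [j _ <-]].
  exists (sup (range u)) => k; apply/andP; split; first by apply: ub_le_sup; [case: sU|exists k].
  by apply: ge_sup => [|_ [j _ <-]//]; case: sU.
have [p1 p1P] := mono _ (fun k => a * h k) step1 ah.
have [p2 p2P] := mono _ (fun k => b * h k) step2 bh.
have in1 k : x <= (P k).1 /\ (P k).1 + a * h k <= x + a.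
  elim: k => [|k [IH1 IH2]]; first by rewrite /= /h expr0 mulr1.
  by have [s1 s2] := step1 k; split; [exact: le_trans s1|exact: le_trans IH2].
have in2 k : y <= (P k).2 /\ (P k).2 + b * h k <= y + b.
  elim: k => [|k [IH1 IH2]]; first by rewrite /= /h expr0 mulr1.
  by have [s1 s2] := step2 k; split; [exact: le_trans s1|exact: le_trans IH2].
have on k Q : on_rect x y a b Q -> on_rect (P k).1 (P k).2 (a * h k) (b * h k) Q.
  move=> HQ s t sP tP; have [? ?] := in1 k; have [? ?] := in2 k; apply: HQ; lra.
have Jd k : d <= 4 ^+ k * J k (P k).
  elim: k => [|k IH]; first by rewrite /J /= /h !expr0 !mulr1 mul1r.
  rewrite (le_trans IH)// exprSr -mulrA ler_wpM2l ?exprn_ge0//.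
  have := on k _ cF; rewrite ahS bhS => /(rect_int_split (ah _) (bh _)).
  rewrite -ahS -bhS => E.
  have : J k (P k) <= J k.+1 (P k) + J k.+1 ((P k).1 + a * h k.+1, (P k).2) +
      J k.+1 ((P k).1, (P k).2 + b * h k.+1) +
      J k.+1 ((P k).1 + a * h k.+1, (P k).2 + b * h k.+1).
    rewrite /J /= E; do 3 (rewrite (le_trans (rnormD _ _))// lerD2r).
  move=> JS; rewrite [P k.+1]/= /step.
  by case: ifPn => [//|]; rewrite -ltNge => N1; case: ifPn => [//|]; rewrite -ltNge => N2; case: ifPn => [//|]; rewrite -ltNge => N3; exact: four_quarters JS N1 N2 N3.
have dp : differentiable F (p1 +i* p2)%C.
  apply: dF; have := p1P 0%N; have := p2P 0%N; rewrite /= /h expr0; lra.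
pose e := d / (8 * ((a + b) ^+ 2 + 1)).
have ab1 : 0 < (a + b) ^+ 2 + 1 by rewrite ltr_wpDl// sqr_ge0.
have e0 : 0 < e by rewrite divr_gt0// mulr_gt0.
have [dl dl0 dlP] := differentiable_rnorm dp e0.
have [k kdl] : exists k, (a + b) * h k < dl.
  have h1 : `|2^-1 : R| < 1 by rewrite ger0_norm ?invr_ge0// invf_lt1// ltr1n.
  have /cvgrPdist_lt/(_ _ dl0)[k _ kP] := cvg_geometric (a + b) h1; exists k.
  by have /= := kP k (leqnn _); rewrite sub0r normrN; apply: le_lt_trans; exact: ler_norm.
pose c : C := (p1 +i* p2)%C.
pose df := 'd F c 1.
have aff : on_rect (P k).1 (P k).2 (a * h k) (b * h k)
    (fun z => rnorm (F z - ((F c - df * c) + df * z)) <= e * ((a + b) * h k)).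
  move=> s t sP tP.
  have zc : rnorm ((s +i* t)%C - c : C) <= (a + b) * h k.
    rewrite (le_trans (rnorm_pair _ _ _ _))// mulrDl lerD// ler_norml.
      by have := p1P k; lra.
    by have := p2P k; lra.
  have := dlP _ (le_lt_trans zc kdl); rewrite addrCA subrr addr0 => H.
  have -> : F (s +i* t)%C - ((F c - df * c) + df * (s +i* t)%C) =
      F (s +i* t)%C - F c - 'd F c ((s +i* t)%C - c).
    have -> : 'd F c ((s +i* t)%C - c) = ((s +i* t)%C - c) * df.
      by rewrite -[in LHS](mulr1 (_ - c)) -[_ * 1]/(_ *: (1 : C^o)) linearZ.
    ring.
  by rewrite (le_trans H)// ler_wpM2l// ltW.
have := rect_int_affine (ah k) (bh k) (on k _ cF) aff.
rewrite -/(J k (P k)) => JK; have := le_trans (Jd k) (ler_wpM2l _ JK).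
rewrite exprn_ge0// => /(_ isT).
have -> : 4 ^+ k * (4 * (e * ((a + b) * h k)) * (a * h k + b * h k)) =
   4 * e * (a + b) ^+ 2 * (4 * (2^-1) ^+ 2) ^+ k.
  by rewrite -mulrDl [in RHS]exprMn [in RHS]exprAC /h; ring.
have -> : 4 * (2^-1) ^+ 2 = 1 :> R by field.
rewrite expr1n mulr1 leNgt => /negP; apply.
rewrite /e -(ltr_pM2r (ltr0n _ 2)).
have -> : 4 * (d / (8 * ((a + b) ^+ 2 + 1))) * (a + b) ^+ 2 * 2%:R = d * ((a + b) ^+ 2 / ((a + b) ^+ 2 + 1)).
  by field; rewrite gt_eqF.
rewrite ltr_pM2l// (@lt_trans _ _ 1)// ?ltr1n// ltr_pdivrMr// mul1r ltrDl//.
Qed.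

End Goursat.
(** * Circle integrals and the Taylor formula *)

Definition cexp {R : realType} (w : R[i]) : R[i] :=
  (expR (complex.Re w))%:C%C * (cos (complex.Im w) +i* sin (complex.Im w))%C.

Definition cpt {R : realType} (r t : R) : R[i] := r%:C%C * (cos t +i* sin t)%C.

Section ComplexExponential.
Context {R : realType}.
Local Notation C := R[i].

Lemma derive_littleo (f : R -> R) (x d : R) : is_derive x 1 f d ->
  forall e : R, 0 < e -> exists2 dl : R, 0 < dl &
    forall h, `|h| < dl -> `|f (x + h) - f x - d * h| <= e * `|h|.
Proof.
move=> fd e e0; have df : differentiable f x by apply/derivable1_diffP.
have /eqaddoP/(_ _ e0)/nbhs_ballP[dl /= dl0 dlP] := diff_locally df.
exists dl => // h hd; have := dlP h; rewrite /ball /= sub0r normrN => /(_ hd).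
rewrite diff1E// derive1E derive_val !fctE /= opprD addrA (addrC h) [_ *: _]mulrC.
exact.
Qed.

Lemma rnorm_cossin (t : R) : rnorm ((cos t +i* sin t)%C : C) = 1.
Proof. by rewrite /rnorm normc_def /= cos2Dsin2 sqrtr1. Qed.

Lemma rnorm_cpt (r t : R) : 0 <= r -> rnorm (cpt r t) = r.
Proof. by move=> r0; rewrite rnormM rnorm_cossin mulr1 rnorm_real ger0_norm. Qed.

Lemma cexp_cpt (s t : R) : cexp (s +i* t)%C = cpt (expR s) t.
Proof. by []. Qed.

Lemma cexpD (w h : C) : cexp (w + h) = cexp w * cexp h.
Proof.
case: w h => [s t] [s' t']; rewrite /cexp /= expRD cosD sinD.
by apply/eqP; rewrite eq_complex /=; apply/andP; split; apply/eqP; ring.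
Qed.

Lemma cexp_small (e : R) : 0 < e -> exists2 d : R, 0 < d &
  forall h : C, rnorm h < d -> rnorm (cexp h - 1 - h) <= e * rnorm h.
Proof.
move=> e0; have [e' [e'0 e'1 e'e]] : exists e' : R, [/\ 0 < e', e' <= 1 & 16 * e' <= e].
  exists (Num.min 1 (e / 16)); split.
  - by rewrite lt_min ltr01 divr_gt0.
  - by rewrite ge_min lexx.
  - by have : Num.min 1 (e / 16) <= e / 16; [rewrite ge_min lexx orbT|lra].
have [d1 d10 H1] := derive_littleo (is_derive_expR 0) e'0.
have [d2 d20 H2] := derive_littleo (is_derive_cos 0) e'0.
have [d3 d30 H3] := derive_littleo (is_derive_sin 0) e'0.
exists (Num.min (Num.min d1 d2) (Num.min d3 e')); first by rewrite !lt_min d10 d20 d30.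
move=> h; rewrite !lt_min => /andP[/andP[h1 h2] /andP[h3 h4]].
have hR := rnorm_Re h; have hI := rnorm_Im h.
move: h1 h2 h3 h4 hR hI; set N := rnorm h; case: h @N => s t N /= h1 h2 h3 h4 hR hI.
have := H1 s (le_lt_trans hR h1); have := H2 t (le_lt_trans hI h2).
have := H3 t (le_lt_trans hI h3).
rewrite !add0r expR0 cos0 sin0 !mul1r subr0 oppr0 mul0r !subr0 => S Co E.
have N0 : 0 <= N := rnorm_ge0 _.
have N1 : N <= 1 by rewrite (le_trans (ltW h4)).
have eN : e' * N <= 1 by rewrite mulr_ile1// ltW.
have A1 : `|expR s - 1 - s| <= e' * N by rewrite (le_trans E)// ler_pM2l.
have A2 : `|cos t - 1| <= e' * N by rewrite (le_trans Co)// ler_pM2l.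
have A3 : `|sin t - t| <= e' * N by rewrite (le_trans S)// ler_pM2l.
have A4 : `|expR s| <= 3.
  have -> : expR s = (expR s - 1 - s) + 1 + s by ring.
  rewrite (le_trans (ler_normD _ _))// (le_trans (lerD (ler_normD _ _) (lexx _)))// normr1; lra.
have A5 : `|expR s - 1| <= 2 * e'.
  have -> : expR s - 1 = (expR s - 1 - s) + s by ring.
  have eN' : e' * N <= e' by rewrite ler_piMr// ltW.
  rewrite (le_trans (ler_normD _ _))//; lra.
rewrite (le_trans (rnorm_le_ReIm _))//= !(mul0r, subr0, addr0, add0r).
have -> : expR s * cos t - 1 - s = expR s * (cos t - 1) + (expR s - 1 - s) by ring.
have -> : expR s * sin t - t = expR s * (sin t - t) + t * (expR s - 1) by ring.
have B1 : `|expR s * (cos t - 1)| <= 3 * (e' * N) by rewrite normrM ler_pM.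
have B2 : `|expR s * (sin t - t)| <= 3 * (e' * N) by rewrite normrM ler_pM.
have B3 : `|t * (expR s - 1)| <= N * (2 * e') by rewrite normrM ler_pM.
have B4 := ler_normD (expR s * (cos t - 1)) (expR s - 1 - s).
have B5 := ler_normD (expR s * (sin t - t)) (t * (expR s - 1)).
have B6 : 16 * e' * N <= e * N by rewrite ler_wpM2r.
have B7 : 0 <= e' * N by rewrite mulr_ge0// ltW.
rewrite (le_trans (lerD B4 B5))//; lra.
Qed.

Lemma differentiable_cexp (w : C) : differentiable (cexp : C -> C) w.
Proof.
have sl : linear (fun h : C => h *: (cexp w : C^o)).
  by move=> a u v; rewrite scalerDl scalerA.
pose scM := GRing.isLinear.Build _ _ _ _ _ sl.
pose sc : {linear C -> C} := HB.pack (fun h : C => h *: (cexp w : C^o)) scM.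
have [//|e e0|//] := @rnorm_differentiable R C C cexp w sc.
  exact: scalel_continuous.
have k0 : 0 < rnorm (cexp w) + 1 by rewrite ltr_wpDl// rnorm_ge0.
have [d d0 dP] := cexp_small (divr_gt0 e0 k0); exists d => // h /dP hP.
have -> : cexp (w + h) - cexp w - sc h = cexp w * (cexp h - 1 - h).
  by rewrite cexpD /= -[h *: _]/(h * cexp w); ring.
rewrite rnormM (le_trans (ler_wpM2l (rnorm_ge0 _) hP))//.
rewrite mulrA ler_wpM2r ?rnorm_ge0// mulrCA ler_piMr ?ltW//.
by rewrite ltr_pdivrMr// mul1r ltrDl.
Qed.

End ComplexExponential.

Definition circle_int {R : realType} (r : R) (u : R[i] -> R[i]) : R[i] :=
  cint 0 (2 * pi) (fun t => u (cpt r t)).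

Lemma differentiable_exp {K : numFieldType} {V : normedModType K} (f : V -> K) k x :
  differentiable f x -> differentiable (fun w => f w ^+ k) x.
Proof.
move=> df; elim: k => [|k IH]; first exact: differentiable_cst.
have -> : (fun w => f w ^+ k.+1) = f \* (fun w => f w ^+ k).
  by apply/funext => w; rewrite exprS.
exact: differentiableM.
Qed.

Section CircleIntegral.
Context {R : realType}.
Local Notation C := R[i].
Implicit Types (u v f : C -> C) (r : R).

Let twopi_gt0 : 0 < 2 * pi :> R.
Proof. by rewrite mulr_gt0// pi_gt0. Qed.

Lemma continuous_cpt : continuous (fun p : R * R => cpt p.1 p.2).
Proof.
have -> : (fun p : R * R => cpt p.1 p.2 : C) =
    (fun xy : R * R => (xy.1 +i* xy.2)%C) \o
    (fun p : R * R => (p.1 * cos p.2, p.1 * sin p.2)).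
  by apply/funext => p; apply/eqP; rewrite eq_complex /= !mul0r subr0 addr0 !eqxx.
move=> [r t]; apply: continuous_comp; last exact: continuous_pair_complex.
have c1 : p.1 @[p --> (r, t)] --> r by exact: cvg_fst.
have c2 : p.2 @[p --> (r, t)] --> t by exact: cvg_snd.
have c3 : cos p.2 @[p --> (r, t)] --> cos t by apply: cvg_comp c2 _; exact: continuous_cos.
have c4 : sin p.2 @[p --> (r, t)] --> sin t by apply: cvg_comp c2 _; exact: continuous_sin.
exact: (cvg_pair (cvgM c1 c3) (cvgM c1 c4)).
Qed.

Lemma near_cpt r t (A : set C) : nbhs (cpt r t) A ->
  \forall s \near t & q \near r, A (cpt q s).
Proof.
move=> /(@continuous_cpt (r, t))[[U V]/= [rU tV] UVA].
exists (V, U) => //= -[s q] [/= Vs Uq]; exact: (UVA (q, s)).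
Qed.

Definition continuous_circle r u := forall t, {for cpt r t, continuous u}.

Lemma continuous_circle_itv r u (a b : R) : continuous_circle r u ->
  continuous_itv a b (fun t => u (cpt r t)).
Proof.
move=> uc t _ A /(uc t)/near_cpt[[U V] /= [tU rV] UVA].
apply: filterS tU => s Us; apply: (UVA (s, r)); split => //=; exact: nbhs_singleton rV.
Qed.

Lemma circle_int_norm r u (K : R) : continuous_circle r u ->
  (forall t, rnorm (u (cpt r t)) <= K) ->
  rnorm (circle_int r u) <= 2 * K * (2 * pi).
Proof.
move=> uc uK; rewrite -[X in _ <= _ * X]subr0; apply: rnorm_cint => //.
- exact: ltW.
- exact: continuous_circle_itv.
Qed.

Lemma circle_intB r u v : continuous_circle r u -> continuous_circle r v ->
  circle_int r (fun z => u z - v z) = circle_int r u - circle_int r v.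
Proof. by move=> uc vc; apply: cintB; exact: continuous_circle_itv. Qed.

Lemma circle_intZ r u (a : C) : continuous_circle r u ->
  circle_int r (fun z => a * u z) = a * circle_int r u.
Proof. by move=> uc; apply: cintZ; exact: continuous_circle_itv. Qed.

Lemma circle_int_cst r (a : C) : circle_int r (fun=> a) = (2 * pi)%:C%C * a.
Proof. by rewrite /circle_int cint_cst ?subr0// ltW. Qed.

Lemma eq_circle_int r u v : 0 <= r -> (forall z, rnorm z = r -> u z = v z) ->
  circle_int r u = circle_int r v.
Proof. by move=> r0 uv; apply: eq_cint => t _; apply: uv; rewrite rnorm_cpt. Qed.

Let mulI_eq (x y d : C) : 'i%C * (x - y) - (d - d) = 0 -> x = y.
Proof.
have i0 : 'i%C != 0 :> C by rewrite -rnorm_gt0 rnorm_i.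
by rewrite subrr subr0 => /eqP; rewrite mulf_eq0 (negbTE i0) subr_eq0 => /eqP.
Qed.

Lemma circle_int_const (a b r r' : R) u : 0 <= a -> a < r -> r <= r' -> r' < b ->
  (forall z, a < rnorm z < b -> differentiable u z) ->
  circle_int r u = circle_int r' u.
Proof.
move=> a0 ar rr' r'b du.
have r0 : 0 < r by exact: le_lt_trans ar.
have r'0 : 0 < r' by exact: lt_le_trans rr'.
pose G w := u (cexp w).
have dG : on_rect (ln r) 0 (ln r' - ln r) (2 * pi) (fun z => differentiable G z).
  move=> s t /andP[rs sr'] _; apply: differentiable_comp.
    exact: differentiable_cexp.
  apply: du; rewrite cexp_cpt rnorm_cpt ?expR_ge0//; apply/andP; split.
    by rewrite (lt_le_trans ar)// -[leLHS]lnK ?posrE// ler_expR.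
  by rewrite (le_lt_trans _ r'b)// -[leRHS]lnK ?posrE// ler_expR (le_trans sr')// addrC subrK.
have lnrr' : 0 <= ln r' - ln r by rewrite subr_ge0 ler_ln.
have := goursat_rect lnrr' (ltW twopi_gt0) dG.
have per s : G (s +i* (0 + 2 * pi))%C = G (s +i* 0)%C.
  rewrite /G !cexp_cpt /cpt add0r (_ : 2 * pi = 0 + pi *+ 2); last by rewrite add0r mulr_natl.
  by rewrite cosD2pi sinD2pi.
rewrite /rect_int (_ : ln r + (ln r' - ln r) = ln r'); last by rewrite addrC subrK.
have -> : cint (ln r) (ln r') (fun t => G (t +i* (0 + 2 * pi))%C) =
    cint (ln r) (ln r') (fun t => G (t +i* 0)%C).
  by apply: eq_cint => t _; exact: per.
rewrite add0r => /mulI_eq E; apply/esym; move: E.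
by rewrite /G /circle_int; under eq_cint do rewrite cexp_cpt lnK//;
  under [in RHS]eq_cint do rewrite cexp_cpt lnK//.
Qed.

Lemma circle_int_expV r k : 0 < r -> circle_int r (fun z => z^-1 ^+ k.+1) = 0 :> C.
Proof.
move=> r0; pose q : C := (2^-1 : R)%:C%C.
have r2 : r <= 2 * r by lra.
have r3 : 2 * r < 3 * r by lra.
have dV (z : C) : 0 < rnorm z < 3 * r -> differentiable (fun w : C => w^-1 ^+ k.+1) z.
  rewrite rnorm_gt0 => /andP[z0 _].
  by apply: differentiable_exp; exact: differentiable_Rinv.
have cV : continuous_circle r (fun z => z^-1 ^+ k.+1).
  move=> t; apply: differentiable_continuous; apply: dV; rewrite rnorm_cpt ?ltW//; lra.
have /esym := circle_int_const (lexx 0) r0 r2 r3 dV.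
have -> : circle_int (2 * r) (fun z => z^-1 ^+ k.+1) = circle_int r (fun z => q ^+ k.+1 * z^-1 ^+ k.+1).
  apply: eq_cint => t _ /=; rewrite -exprMn; congr (_ ^+ _).
  by rewrite /cpt rmorphM -mulrA invfM /q fmorphV.
rewrite circle_intZ// => /eqP; rewrite -subr_eq0 -{2}(mul1r (circle_int _ _)) -mulrBl mulf_eq0.
case/orP => [/eqP/subr0_eq H|/eqP//]; exfalso.
have : rnorm (q ^+ k.+1) = 1 by rewrite H rnorm1.
rewrite rnormX rnorm_real ger0_norm ?invr_ge0//; apply/eqP; rewrite lt_eqF//.
by rewrite exprn_ilt1// ?invr_ge0// invf_lt1// ltr1n.
Qed.

Lemma near_circle r u : continuous_circle r u -> forall e : R, 0 < e ->
  \forall q \near r, forall t, 0 <= t <= 2 * pi -> rnorm (u (cpt q t) - u (cpt r t)) < e.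
Proof.
move=> uc e e0.
have := (@segment_compact R 0 (2 * pi)); rewrite compact_near_coveringP.
move=> /(_ _ (nbhs r) (fun q t => rnorm (u (cpt q t) - u (cpt r t)) < e) _).
have H t : `[0, 2 * pi]%classic t ->
    \forall s \near t & q \near r, rnorm (u (cpt q s) - u (cpt r s)) < e.
  move=> _; have e2 : 0 < e / 2 by lra.
  have /cvg_rnormP/(_ _ e2)/near_cpt[[U V] /= [tU rV] UVA] := uc t.
  exists (U, V) => //= -[s q] [/= Us Vq].
  rewrite (le_lt_trans (rnorm_tri (u (cpt r t)) _ _))// (splitr e) ltrD//.
    exact: (UVA (s, q)).
  by rewrite rnormC; apply: (UVA (s, r)); split=> //=; exact: nbhs_singleton rV.
move=> /(_ H); apply: filterS => q Hq t tpi; apply: Hq.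
by rewrite /= in_itv.
Qed.

End CircleIntegral.

Section DifferenceQuotient.
Context {R : realType}.
Local Notation C := R[i].

Lemma differentiable_near_eq (V W : normedModType C) (f g : V -> W) (x : V) :
  (\forall y \near x, f y = g y) -> differentiable f x -> differentiable g x.
Proof.
move=> /nbhs_rnormP[d d0 dP] df; have fgx : f x = g x by apply: dP; rewrite subrr rnorm0.
have [//|e e0|//] := @rnorm_differentiable R V W g x ('d f x).
  exact: diff_continuous.
have [d' d'0 d'P] := differentiable_rnorm df e0.
exists (Num.min d d') => [|h]; first by rewrite lt_min d0.
rewrite lt_min => /andP[hd hd']; rewrite -fgx -dP; first exact: d'P.
by rewrite addrAC subrr add0r.
Qed.

Definition dquot (f : C -> C) (a z : C) : C :=
  if z == a then 'd f a 1 else (f z - f a) / (z - a).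

Lemma differentiable_dquot f a z : z != a -> differentiable f z ->
  differentiable (dquot f a) z.
Proof.
move=> za df; apply: (@differentiable_near_eq C C (fun w => (f w - f a) * (w - a)^-1)).
  apply/nbhs_rnormP; exists (rnorm (z - a)); first by rewrite rnorm_gt0 subr_eq0.
  move=> w wz; rewrite /dquot; case: eqP => // wa; move: wz.
  by rewrite wa rnormC ltxx.
have dB : differentiable (fun w : C => w - a) z.
  by apply: differentiableB => //; exact: differentiable_cst.
apply: differentiableM; last by apply: differentiableV => //; rewrite subr_eq0.
by apply: differentiableB => //; exact: differentiable_cst.
Qed.

Lemma continuous_dquot f a z : differentiable f z ->
  {for z, continuous (dquot f a)}.
Proof.
move=> df; have [za|za] := eqVneq z a; last first.
  by apply: differentiable_continuous; exact: differentiable_dquot.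
rewrite za in df *; apply/continuous_rnormP => e e0; have e2 : 0 < e / 2 by lra.
have [d d0 dP] := differentiable_rnorm df e2; exists d => // w /dP.
rewrite addrCA subrr addr0 /dquot eqxx; case: eqP => [_ _|/eqP wa].
  by rewrite subrr rnorm0.
have wa0 : w - a != 0 by rewrite subr_eq0.
have -> : 'd f a (w - a) = (w - a) * 'd f a 1.
  by rewrite -[in LHS](mulr1 (w - a)) -[_ * 1]/(_ *: (1 : C^o)) linearZ.
have -> : f w - f a - (w - a) * 'd f a 1 = ((f w - f a) / (w - a) - 'd f a 1) * (w - a).
  have H (A h l : C) : h != 0 -> A - h * l = (A / h - l) * h by move=> ?; field.
  exact: H.
by rewrite rnormM ler_pM2r ?rnorm_gt0// => /le_lt_trans; apply; lra.
Qed.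

End DifferenceQuotient.

Section CauchyTaylor.
Context {R : realType}.
Local Notation C := R[i].

Lemma circle_int_dquot (f : C -> C) (b r : R) (a : C) :
  (forall z, rnorm z < b -> differentiable f z) -> rnorm a < b -> 0 < r < b ->
  circle_int r (fun z => dquot f a z * z) = 0.
Proof.
move=> df ab /andP[r0 rb]; set u := fun z => _.
have uc (s : R) : 0 <= s -> s < b -> continuous_circle s u.
  move=> s0 sb t.
  have dc : {for cpt s t, continuous (dquot f a)}.
    by apply: continuous_dquot; apply: df; rewrite rnorm_cpt.
  exact: (@continuousM C C (dquot f a) id _ dc cvg_id).
have du (z : C) : rnorm z < b -> z != a -> differentiable u z.
  move=> zb za; apply: differentiableM => //.
  by apply: differentiable_dquot => //; exact: df.
pose c := rnorm a.
have [K [d [d0 db dK]]] : exists K d : R, [/\ 0 < d, d <= b & forall z, rnorm z < d -> rnorm (dquot f a z) <= K].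
  have b0 : rnorm (0 : C) < b by rewrite rnorm0 (lt_trans r0).
  have /continuous_rnormP/(_ 1 ltr01)[d d0 dP] := continuous_dquot (a := a) (df _ b0).
  exists (rnorm (dquot f a 0) + 1), (Num.min d b); split.
  - by rewrite lt_min d0 (lt_trans r0).
  - by rewrite ge_min lexx orbT.
  move=> z; rewrite lt_min => /andP[zd _].
  rewrite -(subrK (dquot f a 0) (dquot f a z)) addrC (le_trans (rnormD _ _))// lerD2l.
  by rewrite ltW// dP// subr0.
have K0 : 0 <= K by rewrite (le_trans (rnorm_ge0 (dquot f a 0)))// dK// rnorm0.
have in0 s : 0 < s < b -> (s < c \/ c = 0) -> circle_int s u = 0.
  move=> /andP[s0 sb] sc; apply/eqP; rewrite -rnorm_eq0 eq_le rnorm_ge0 andbT.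
  apply/ler_addgt0Pl => e e0; rewrite addr0.
  pose q := Num.min (Num.min s (d / 2)) (e / (4 * pi * (K + 1))).
  have pi0 := pi_gt0 R.
  have kk0 : 0 < 4 * pi * (K + 1) by rewrite !mulr_gt0// ltr_wpDl.
  have q0 : 0 < q by rewrite !lt_min s0 !divr_gt0.
  have qs : q <= s by rewrite !ge_min lexx.
  have qd : q < d by rewrite (@le_lt_trans _ _ (d / 2)) ?ltr_pdivrMr ?ltr_pMr ?ltr1n// !ge_min lexx orbT.
  have qe : q * (4 * pi * (K + 1)) <= e.
    by rewrite -ler_pdivlMr// !ge_min lexx !orbT.
  have <- : circle_int q u = circle_int s u.
    have [a1 [b1 [a10 a1q sb1 H]]] : exists a1 b1 : R, [/\ 0 <= a1, a1 < q, s < b1 &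
        forall z : C, a1 < rnorm z < b1 -> rnorm z < b /\ z != a].
      case: sc => [sc|c0].
        exists 0, c; split => // z /andP[_ zc]; split; first exact: lt_trans zc ab.
        by apply: contraTneq zc => ->; rewrite ltxx.
      exists 0, b; split => // z /andP[z0 zb]; split => //.
      by apply: contraTneq z0 => ->; rewrite -/c c0 ltxx.
    by apply: (circle_int_const a10 a1q qs sb1) => z /H[]; exact: du.
  have qb : q < b by apply: le_lt_trans qs sb.
  have := @circle_int_norm R q u (K * q) (uc _ (ltW q0) qb).
  have H t : rnorm (u (cpt q t)) <= K * q.
    have -> : rnorm (u (cpt q t)) = rnorm (dquot f a (cpt q t)) * q.
      by rewrite /u rnormM rnorm_cpt// ltW.
    apply: ler_wpM2r; first exact: ltW.
    by apply: dK; rewrite rnorm_cpt// ltW.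
  move=> /(_ H)/le_trans; apply; apply: le_trans qe.
  have : 0 <= 4 * pi * q by rewrite !mulr_ge0// ltW.
  lra.
have cnt s e : 0 < s < b -> 0 < e ->
    \forall q \near s, rnorm (circle_int q u - circle_int s u) <= e.
  move=> /andP[s0 sb] e0; have pi0 := pi_gt0 R.
  have e'0 : 0 < e / (4 * pi) by rewrite divr_gt0// mulr_gt0.
  have near1 := near_circle (uc _ (ltW s0) sb) e'0.
  have near2 : \forall q \near s, 0 < q < b.
    by apply: filterS2 (lt_nbhsr s0) (lt_nbhsl sb) => q -> ->.
  apply: filterS2 near1 near2 => q Hq /andP[q0 qb].
  have uq := continuous_circle_itv (a := 0) (b := 2 * pi) (uc _ (ltW q0) qb).
  have us := continuous_circle_itv (a := 0) (b := 2 * pi) (uc _ (ltW s0) sb).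
  rewrite /circle_int -cintB//.
  have pi2 : 0 <= 2 * pi :> R by lra.
  have := rnorm_cint pi2 (continuous_itvB uq us) (fun t tp => ltW (Hq t tp)).
  move=> /le_trans; apply; rewrite subr0.
  have pin0 : pi != 0 :> R by rewrite gt_eqF.
  have H (x y : R) : y != 0 -> 2 * (x / (4 * y)) * (2 * y) = x by move=> ?; field.
  by rewrite H.
have Ic : 0 < c -> circle_int c u = 0.
  move=> c0; apply/eqP; rewrite -rnorm_eq0 eq_le rnorm_ge0 andbT.
  apply/ler_addgt0Pl => e e0; rewrite addr0.
  have cb : 0 < c < b by rewrite c0.
  have /nbhs_ballP[dl /= dl0 dlP] := cnt c e cb e0.
  pose q := Num.max (c / 2) (c - dl / 2).
  have qc : q < c by rewrite gt_max; apply/andP; split; lra.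
  have q0 : 0 < q by rewrite lt_max divr_gt0.
  have /dlP : ball c dl q.
    rewrite /ball /= ger0_norm ?subr_ge0 ?ltW// ltrBlDr -ltrBlDl lt_max; apply/orP; right; lra.
  rewrite (in0 q) ?sub0r ?rnormN//; last by left.
  by rewrite q0 (lt_trans qc).
have [rc|cr|rc] := ltgtP r c; last by rewrite rc; apply: Ic; rewrite -rc.
  by apply: in0; [rewrite r0|left].
have [c0|c0] := leP c 0.
  apply: in0; first by rewrite r0.
  by right; apply/eqP; rewrite eq_le c0 rnorm_ge0.
apply/eqP; rewrite -rnorm_eq0 eq_le rnorm_ge0 andbT.
apply/ler_addgt0Pl => e e0; rewrite addr0.
have cb : 0 < c < b by rewrite c0.
have /nbhs_ballP[dl /= dl0 dlP] := cnt c e cb e0.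
pose q := Num.min r (c + dl / 2).
have cq : c < q by rewrite lt_min cr; lra.
have qr : q <= r by rewrite ge_min lexx.
have /dlP : ball c dl q.
  rewrite /ball /= distrC ger0_norm ?subr_ge0 ?ltW// ltrBlDr gt_min; apply/orP; right; lra.
rewrite Ic// subr0 (_ : circle_int q u = circle_int r u)//.
apply: (circle_int_const (ltW c0) cq qr rb) => z /andP[cz zb]; apply: du => //.
by apply: contraTneq cz => ->; rewrite ltxx.
Qed.

End CauchyTaylor.

Section Taylor.
Context {R : realType}.
Local Notation C := R[i].

Lemma continuous_circle_differentiable (u : C -> C) (r : R) : 0 <= r ->
  (forall z, rnorm z = r -> differentiable u z) -> continuous_circle r u.
Proof.
move=> r0 du t; apply: differentiable_continuous; apply: du.
by rewrite rnorm_cpt.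
Qed.

Let two_pi_neq0 : (2 * pi)%:C%C != 0 :> C.
Proof. by rewrite -rnorm_gt0 rnorm_real normr_gt0 mulf_neq0// gt_eqF// pi_gt0. Qed.

Let rnorm_two_pi : rnorm ((2 * pi)%:C%C : C) = 2 * pi.
Proof. by rewrite rnorm_real ger0_norm// mulr_ge0// pi_ge0. Qed.

Lemma mean_value_bound (f : C -> C) (b r M : R) :
  (forall z, rnorm z < b -> differentiable f z) -> 0 < r < b ->
  (forall z, rnorm z = r -> rnorm (f z) <= M) -> rnorm (f 0) <= 2 * M.
Proof.
move=> df /andP[r0 rb] fM.
have rr0 : 0 < r < b by rewrite r0.
have z0 : rnorm (0 : C) < b by rewrite rnorm0 (lt_trans r0).
have cf : continuous_circle r f.
  by apply: continuous_circle_differentiable => [|z zr]; [exact: ltW|apply: df; rewrite zr].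
have := circle_int_dquot df z0 rr0.
have -> : circle_int r (fun z => dquot f 0 z * z) = circle_int r (fun z => f z - f 0).
  apply: eq_circle_int => [|z zr]; first exact: ltW.
  have zn0 : z != 0 by rewrite -rnorm_gt0 zr.
  by rewrite /dquot (negbTE zn0) subr0 divfK.
have cc : continuous_circle r (fun=> f 0) by move=> t; exact: cst_continuous.
rewrite (circle_intB cf cc) circle_int_cst => /eqP; rewrite subr_eq0 => /eqP E.
have pi20 : 0 < 2 * pi :> R by rewrite mulr_gt0// pi_gt0.
rewrite -(ler_pM2l pi20) -{1}rnorm_two_pi -rnormM -E.
have := @circle_int_norm R r f M cf; rewrite [leRHS]mulrC; apply => t.
by apply: fM; rewrite rnorm_cpt// ltW.
Qed.

Lemma taylor_circle (f : C -> C) (b r M : R) :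
  (forall z, rnorm z < b -> differentiable f z) -> 0 < r < b ->
  (forall z, rnorm z < b -> rnorm (f z) <= M) ->
  exists a : nat -> C, (forall k, rnorm (a k) <= 2 * M * r^-1 ^+ k) /\
    forall N z, rnorm z <= r / 2 ->
      rnorm (f z - \sum_(k < N) a k * z ^+ k) <= 8 * M * (rnorm z / r) ^+ N.
Proof.
move=> df rb fM; have /andP[r0 rb'] := rb; have r0' := ltW r0.
have n0 (z : C) : rnorm z = r -> z != 0 by move=> zr; rewrite -rnorm_gt0 zr.
have zb (z : C) : rnorm z = r -> rnorm z < b by move=> ->.
have dV k (z : C) : rnorm z = r -> differentiable (fun w : C => w^-1 ^+ k) z.
  by move=> zr; apply: differentiable_exp; apply: differentiable_Rinv; exact: n0.
have cfV k : continuous_circle r (fun w => f w * w^-1 ^+ k).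
  apply: continuous_circle_differentiable => [|z zr]; first exact: ltW.
  by apply: differentiableM; [exact/df/zb|exact: dV].
have cV k : continuous_circle r (fun w : C => w^-1 ^+ k).
  by apply: continuous_circle_differentiable => [|z zr]; [exact: ltW|exact: dV].
have M0 : 0 <= M by apply: le_trans (fM 0 _); rewrite ?rnorm_ge0// rnorm0 (lt_trans r0).
have pi20 : 0 < 2 * pi :> R by rewrite mulr_gt0// pi_gt0.
pose a k := ((2 * pi)%:C%C)^-1 * circle_int r (fun w => f w * w^-1 ^+ k).
exists a; split => [k|N z zr2].
  rewrite rnormM rnormV rnorm_two_pi mulrC ler_pdivrMr//.
  have := @circle_int_norm R r _ (M * r^-1 ^+ k) (cfV k); rewrite !mulrA; apply => t.
  rewrite rnormM rnormX rnormV rnorm_cpt// ler_wpM2r ?exprn_ge0 ?invr_ge0//.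
  by apply: fM; rewrite rnorm_cpt// ltW.
have zr : rnorm z < r by rewrite (le_lt_trans zr2)// ltr_pdivrMr// ltr_pMr// ltr1n.
have zn (w : C) : rnorm w = r -> w != z by apply: contra_eqN => /eqP ->; rewrite lt_eqF.
pose u k w : C := dquot f z w * w * (z / w) ^+ k.
pose E k := circle_int r (u k).
have cu k : continuous_circle r (u k).
  apply: continuous_circle_differentiable => [|w wr]; first exact: ltW.
  apply: differentiableM.
    apply: differentiableM => //; apply: differentiable_dquot; first exact: zn.
    exact/df/zb.
  apply: differentiable_exp; apply: differentiableM; first exact: differentiable_cst.
  by apply: differentiable_Rinv; exact: n0.
have E0 : E 0%N = 0.
  have zb' : rnorm z < b by rewrite (lt_trans zr).
  rewrite -(circle_int_dquot df zb' rb) /E; apply: eq_circle_int; first exact: ltW.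
  by move=> w wr; rewrite /u expr0 mulr1.
have ES k : E k - E k.+1 = z ^+ k * ((2 * pi)%:C%C * a k) -
    f z * z ^+ k * circle_int r (fun w => w^-1 ^+ k).
  have aE : (2 * pi)%:C%C * a k = circle_int r (fun w => f w * w^-1 ^+ k).
    by rewrite /a mulrA mulfV ?two_pi_neq0// mul1r.
  rewrite aE -(circle_intZ (z ^+ k) (cfV k)) -(circle_intZ (f z * z ^+ k) (cV k)).
  rewrite /E -(circle_intB (cu k) (cu k.+1)) -circle_intB; last 2 first.
  - apply: continuous_circle_differentiable => [|w wr]; first exact: ltW.
    apply: differentiableM; first exact: differentiable_cst.
    by apply: differentiableM; [exact/df/zb|exact: dV].
  - apply: continuous_circle_differentiable => [|w wr]; first exact: ltW.
    by apply: differentiableM; [exact: differentiable_cst|exact: dV].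
  apply: eq_circle_int; first exact: ltW.
  move=> w wr; rewrite /u /dquot (negbTE (zn w wr)) exprS.
  have H (F G p q s : C) : p != 0 -> p != q -> (F - G) / (p - q) * p * s -
      (F - G) / (p - q) * p * (q / p * s) = (F - G) * s.
    by move=> p0 pq; field; rewrite p0 subr_eq0 pq.
  by rewrite H ?n0 ?zn// exprMn; ring.
have EN k : E k.+1 = (2 * pi)%:C%C * (f z - \sum_(i < k.+1) a i * z ^+ i).
  elim: k => [|k IH].
    have := ES 0%N; rewrite E0 sub0r expr0 mul1r mulr1.
    have -> : circle_int r (fun w : C => w^-1 ^+ 0) = (2 * pi)%:C%C.
      by rewrite -[RHS]mulr1 -(circle_int_cst r).
    move=> /eqP; rewrite eqr_oppLR => /eqP ->; rewrite big_ord1 expr0 mulr1 mulrBr opprB.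
    by rewrite mulrC.
  have := ES k.+1; rewrite circle_int_expV// mulr0 subr0 => H.
  have -> : E k.+2 = E k.+1 - z ^+ k.+1 * ((2 * pi)%:C%C * a k.+1).
    by rewrite -H opprB addrC subrK.
  rewrite [in RHS]big_ord_recr /= IH; set S := \sum_(i < _) _.
  by move: S (a _) (z ^+ _) => S x y; ring.
case: N => [|N].
  rewrite big_ord0 subr0 expr0 mulr1 (le_trans (fM _ (lt_trans zr rb')))//; lra.
rewrite -(ler_pM2l pi20) -{1}rnorm_two_pi -rnormM -EN.
have := @circle_int_norm R r _ (4 * M * (rnorm z / r) ^+ N.+1) (cu N.+1).
have -> : 2 * (4 * M * (rnorm z / r) ^+ N.+1) * (2 * pi) =
  2 * pi * (8 * M * (rnorm z / r) ^+ N.+1) by ring.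
apply => t; move: (cpt r t) (rnorm_cpt t r0') => w wr.
rewrite /u rnormM rnormX [rnorm (z / w)]rnormM rnormV wr.
apply: ler_wpM2r; first by rewrite exprn_ge0// divr_ge0 ?rnorm_ge0.
rewrite /dquot (negbTE (zn w wr)) !rnormM rnormV wr.
have rz : r / 2 <= rnorm (w - z).
  have : r <= rnorm (w - z) + rnorm z by rewrite -{1}wr -{1}(subrK z w) rnormD.
  lra.
have rz0 : 0 < rnorm (w - z) by apply: lt_le_trans rz; lra.
have fwz : rnorm (f w - f z) <= 2 * M.
  rewrite (le_trans (rnormB _ _))// mulr2n mulrDl !mul1r lerD// fM//; first exact: zb.
  exact: lt_trans zr rb'.
rewrite mulrAC ler_pdivrMr//.
have H1 : rnorm (f w - f z) * r <= 2 * M * r by rewrite ler_wpM2r.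
have H2 : 4 * M * (r / 2) <= 4 * M * rnorm (w - z) by rewrite ler_wpM2l// mulr_ge0.
rewrite (le_trans H1)// (le_trans _ H2)//; lra.
Qed.

End Taylor.

(** * Estimates for bounded holomorphic functions *)

Section Estimates.
Context {R : realType}.
Local Notation C := R[i].

Definition holo_bounded {V W : normedModType C} (f : V -> W) (q : V) (r M : R) :=
  forall z, rnorm (z - q) < r -> differentiable f z /\ rnorm (f z) <= M.

Lemma holo_bounded_ge0 {V W : normedModType C} (f : V -> W) q r M :
  0 < r -> holo_bounded f q r M -> 0 <= M.
Proof.
move=> r0 /(_ q); rewrite subrr rnorm0 => /(_ r0)[_]; apply: le_trans.
exact: rnorm_ge0.
Qed.

Lemma holo_bounded_sub {V W : normedModType C} (f : V -> W) q r M q' r' :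
  rnorm (q' - q) + r' <= r -> holo_bounded f q r M -> holo_bounded f q' r' M.
Proof.
move=> qr fM z zr; apply: fM; rewrite (le_lt_trans (rnorm_tri q' _ _))//.
by rewrite (lt_le_trans _ qr)// addrC ltrD2l.
Qed.

Lemma differentiable_line {V : normedModType C} (q v : V) (t : C) :
  differentiable (fun t : C => q + t *: v) t.
Proof.
apply: differentiableD; first exact: differentiable_cst.
by apply: (@differentiableZl _ _ _ (fun t : C => t)).
Qed.

Section Scalar.
Context {V : normedModType C}.
Implicit Types (f : V -> C) (q v : V) (r M : R).

Lemma line_taylor f q v r M : 0 < r -> holo_bounded f q r M -> rnorm v <= 1 ->
  exists a : nat -> C, (forall k, rnorm (a k) <= 2 * M * (2 / r) ^+ k) /\
    forall N (t : C), rnorm t <= r / 4 ->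
      rnorm (f (q + t *: v) - \sum_(k < N) a k * t ^+ k) <= 8 * M * (2 * rnorm t / r) ^+ N.
Proof.
move=> r0 fM v1.
have tv (t : C) : rnorm t < r -> rnorm (q + t *: v - q) < r.
  move=> tr; rewrite addrAC subrr add0r rnormZ (le_lt_trans _ tr)//.
  by rewrite ler_piMr// rnorm_ge0.
pose g (t : C) := f (q + t *: v).
have dg (t : C) : rnorm t < r -> differentiable g t.
  move=> /tv/fM[df _].
  by apply: (@differentiable_comp _ _ _ _ (fun t : C => q + t *: v) f) => //;
     exact: differentiable_line.
have gM (t : C) : rnorm t < r -> rnorm (g t) <= M by move=> /tv/fM[].
have r2 : 0 < r / 2 < r by lra.
have [a [aM aN]] := taylor_circle dg r2 gM; exists a; split => [k|N t tr].
  by have := aM k; rewrite invf_div.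
have -> : 2 * rnorm t / r = rnorm t / (r / 2) by rewrite invf_div; ring.
by apply: aN; have -> : r / 2 / 2 = r / 4 by field.
Qed.

Let line_repr (v : V) : v != 0 ->
  exists2 u : V, rnorm u <= 1 & v = (rnorm v)%:C%C *: u.
Proof.
rewrite -rnorm_gt0 => v0; exists ((rnorm v)^-1%:C%C *: v).
  by rewrite rnormZ rnorm_real ger0_norm ?invr_ge0 ?rnorm_ge0// mulVf// gt_eqF.
by rewrite scalerA -rmorphM mulfV ?gt_eqF// scale1r.
Qed.

Let rnorm_rnorm (v : V) : rnorm ((rnorm v)%:C%C : C) = rnorm v.
Proof. by rewrite rnorm_real ger0_norm// rnorm_ge0. Qed.

Lemma holo_lip0_scalar f q v r M : 0 < r -> holo_bounded f q r M ->
  rnorm v <= r / 4 -> rnorm (f (q + v) - f q) <= 16 * M / r * rnorm v.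
Proof.
move=> r0 fM vr; have [->|v0] := eqVneq v 0.
  by rewrite addr0 subrr !rnorm0 mulr0.
have [u u1 vu] := line_repr v0; have [a [_ aN]] := line_taylor r0 fM u1.
have := aN 1%N 0; rewrite rnorm0 big_ord1 expr0 mulr1 scale0r addr0 mulr0 mul0r expr1 mulr0.
have r4 : 0 <= r / 4 by lra.
move=> /(_ r4); rewrite le_eqVlt ltNge rnorm_ge0 orbF rnorm_eq0 subr_eq0 => /eqP fq.
have := aN 1%N (rnorm v)%:C%C; rewrite rnorm_rnorm -vu big_ord1 expr0 mulr1 -fq => /(_ vr).
by move=> /le_trans; apply; rewrite expr1 le_eqVlt; apply/orP; left; apply/eqP; ring.
Qed.

Lemma holo_quad_scalar f q v r M : 0 < r -> holo_bounded f q r M ->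
  (rnorm v <= r / 4 ->
    rnorm (f (q + v) - f q - 'd f q v) <= 32 * M / r ^+ 2 * rnorm v ^+ 2) /\
  rnorm ('d f q v) <= 4 * M / r * rnorm v.
Proof.
move=> r0 fM; have [->|v0] := eqVneq v 0.
  by rewrite linear0 addr0 !subrr !rnorm0 expr0n !mulr0.
have [u u1 vu] := line_repr v0; have [a [aM aN]] := line_taylor r0 fM u1.
have r4 : 0 <= r / 4 by lra.
have fq : f q = a 0%N.
  have := aN 1%N 0; rewrite rnorm0 big_ord1 expr0 mulr1 scale0r addr0 mulr0 mul0r expr1 mulr0.
  by move=> /(_ r4); rewrite le_eqVlt ltNge rnorm_ge0 orbF rnorm_eq0 subr_eq0 => /eqP.
have aN2 (t : C) : rnorm t <= r / 4 ->
    rnorm (f (q + t *: u) - f q - a 1%N * t) <= 32 * M / r ^+ 2 * rnorm t ^+ 2.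
  move=> /(aN 2%N); rewrite !big_ord_recl big_ord0 /= expr0 mulr1 expr1 addr0 -fq opprD addrA.
  move=> /le_trans; apply; rewrite le_eqVlt; apply/orP; left; apply/eqP.
  by field; rewrite gt_eqF.
have M0 := holo_bounded_ge0 r0 fM.
have qq : rnorm (q - q) < r by rewrite subrr rnorm0.
have [df _] := fM q qq.
have du : 'd f q u = a 1%N.
  apply/eqP; rewrite -subr_eq0 -rnorm_eq0 eq_le rnorm_ge0 andbT.
  apply/ler_addgt0Pl => e e0; rewrite addr0.
  have e2 : 0 < e / 2 by lra.
  have [d d0 dP] := differentiable_rnorm df e2.
  pose K := 32 * M / r ^+ 2 + 1.
  have K1 : 0 <= 32 * M / r ^+ 2.
    by apply: divr_ge0; [apply: mulr_ge0|exact: sqr_ge0].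
  have K0 : 0 < K by apply: (ltr_wpDl K1).
  pose t := Num.min (Num.min (r / 4) (d / 2)) (e / (2 * K)).
  have t0 : 0 < t by rewrite !lt_min !divr_gt0// mulr_gt0.
  have tr : t <= r / 4 by rewrite !ge_min lexx.
  have td : t < d by rewrite (@le_lt_trans _ _ (d / 2))// ?ltr_pdivrMr ?ltr_pMr ?ltr1n// !ge_min lexx orbT.
  have te : K * t <= e / 2.
    have : t <= e / (2 * K) by rewrite !ge_min lexx orbT.
    by rewrite ler_pdivlMr ?mulr_gt0//; lra.
  have nt : rnorm (t%:C%C : C) = t by rewrite rnorm_real ger0_norm// ltW.
  have tu : rnorm (t%:C%C *: u) <= t.
    by rewrite rnormZ nt ler_piMr// ltW.
  have H1 := dP _ (le_lt_trans tu td).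
  have := aN2 t%:C%C; rewrite nt => /(_ tr) H2.
  rewrite -(ler_pM2l t0) -{1}nt -rnormM.
  have -> : t%:C%C * ('d f q u - a 1%N) =
     (f (q + t%:C%C *: u) - f q - a 1%N * t%:C%C) - (f (q + t%:C%C *: u) - f q - 'd f q (t%:C%C *: u)).
    have -> : 'd f q (t%:C%C *: u) = t%:C%C * 'd f q u by exact: linearZ.
    by move: (f _) (f q) ('d f q u) => x y z; ring.
  apply: le_trans (rnormB _ _) _; apply: le_trans (lerD H2 H1) _.
  have : 32 * M / r ^+ 2 * t ^+ 2 <= t * (e / 2).
    apply: (@le_trans _ _ (t * (K * t))); last by rewrite ler_pM2l.
    have -> : t * (K * t) = 32 * M / r ^+ 2 * t ^+ 2 + t ^+ 2.
      by rewrite /K; move: (32 * M / r ^+ 2) => x; ring.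
    by rewrite lerDl sqr_ge0.
  have : e / 2 * rnorm (t%:C%C *: u) <= e / 2 * t by apply: ler_wpM2l => //; exact: ltW.
  lra.
have dv : 'd f q v = a 1%N * (rnorm v)%:C%C.
  by rewrite {1}vu linearZ /= du [RHS]mulrC.
split => [vr|].
  have := aN2 (rnorm v)%:C%C; rewrite rnorm_rnorm -vu dv; exact.
rewrite dv rnormM rnorm_rnorm ler_wpM2r ?rnorm_ge0//.
by have := aM 1%N; rewrite expr1; lra.
Qed.

End Scalar.

Section Vector.
Context {V : normedModType C} {m : nat}.
Implicit Types (f : V -> 'rV[C]_m) (q v : V) (r M : R).

Lemma differentiable_coordinate f q i : differentiable f q ->
  differentiable (fun z => f z ord0 i) q /\
  forall v, 'd (fun z => f z ord0 i) q v = 'd f q v ord0 i.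
Proof.
move=> df; pose c (w : 'rV[C]_m) : C := w ord0 i.
have dc w : differentiable c w by exact: differentiable_coord.
have cl : linear c by move=> a u w; rewrite /c !mxE.
pose cM := GRing.isLinear.Build _ _ _ _ _ cl.
pose cL : {linear 'rV[C]_m -> C} := HB.pack c cM.
have cc : continuous cL by move=> w; apply: differentiable_continuous; exact: dc.
split; first exact: (@differentiable_comp _ _ _ _ f c).
move=> v; have -> : (fun z => f z ord0 i) = cL \o f by [].
by rewrite diff_comp// diff_lin.
Qed.

Lemma holo_bounded_coord f q r M i : holo_bounded f q r M ->
  holo_bounded (fun z => f z ord0 i) q r M.
Proof.
move=> fM z /fM[df fz]; split; first by have [] := differentiable_coordinate i df.
exact: le_trans (rnorm_coord _ _) fz.
Qed.

Lemma holo_lip0 f q v r M : 0 < r -> holo_bounded f q r M ->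
  rnorm v <= r / 4 -> rnorm (f (q + v) - f q) <= 16 * M / r * rnorm v.
Proof.
move=> r0 fM vr; have M0 := holo_bounded_ge0 r0 fM.
apply: rnorm_rV_le => [|k].
  by apply: mulr_ge0 (rnorm_ge0 _); apply: divr_ge0 (ltW r0); exact: mulr_ge0.
by rewrite !mxE; exact: (holo_lip0_scalar r0 (holo_bounded_coord k fM) vr).
Qed.

Lemma holo_quad f q v r M : 0 < r -> holo_bounded f q r M ->
  (rnorm v <= r / 4 ->
    rnorm (f (q + v) - f q - 'd f q v) <= 32 * M / r ^+ 2 * rnorm v ^+ 2) /\
  rnorm ('d f q v) <= 4 * M / r * rnorm v.
Proof.
move=> r0 fM; have M0 := holo_bounded_ge0 r0 fM.
have qq : rnorm (q - q) < r by rewrite subrr rnorm0.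
have [df _] := fM q qq.
split => [vr|]; apply: rnorm_rV_le => [|k].
- apply: mulr_ge0; last exact: sqr_ge0.
  by apply: divr_ge0; [exact: mulr_ge0|exact: sqr_ge0].
- rewrite !mxE; have [_ <-] := differentiable_coordinate k df.
  by apply: (holo_quad_scalar v r0 (holo_bounded_coord k fM)).1.
- by apply: mulr_ge0 (rnorm_ge0 _); apply: divr_ge0 (ltW r0); exact: mulr_ge0.
- have [_ <-] := differentiable_coordinate k df.
  exact: (holo_quad_scalar v r0 (holo_bounded_coord k fM)).2.
Qed.

Lemma holo_lip f q r M x y : 0 < r -> holo_bounded f q r M ->
  rnorm (x - q) < r / 2 -> rnorm (y - q) < r / 2 ->
  rnorm (f x - f y) <= 32 * M / r * rnorm (x - y).
Proof.
move=> r0 fM xq yq; have M0 := holo_bounded_ge0 r0 fM.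
have r20 : 0 < r / 2 by lra.
have [xy|xy] := leP (rnorm (x - y)) (r / 2 / 4).
  have fM' : holo_bounded f y (r / 2) M by apply: holo_bounded_sub fM; lra.
  have := holo_lip0 r20 fM' xy; rewrite (addrC y) subrK => /le_trans; apply.
  have H (a b : R) : b != 0 -> 16 * a / (b / 2) = 32 * a / b by move=> ?; field.
  by rewrite H// gt_eqF.
have r2r : r / 2 < r by lra.
have [_ fx] := fM x (lt_trans xq r2r).
have [_ fy] := fM y (lt_trans yq r2r).
rewrite (le_trans (rnormB _ _))// (le_trans (lerD fx fy))//.
have : 32 * M / r * (r / 2 / 4) <= 32 * M / r * rnorm (x - y).
  apply: ler_wpM2l (ltW xy); apply: divr_ge0 (ltW r0); exact: mulr_ge0.
have -> : 32 * M / r * (r / 2 / 4) = 4 * M by field; rewrite gt_eqF.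
lra.
Qed.

End Vector.
End Estimates.

(** * Limits along ultrafilters *)

Section UltraLimits.
Context {R : realType}.
Local Notation C := R[i].

Lemma rnorm_lim_le {I : Type} {F : set_system I} {FF : ProperFilter F}
    {W : normedModType C} (f : I -> W) (l : W) (M : R) :
  f @ F --> l -> (\forall i \near F, rnorm (f i) <= M) -> rnorm l <= M.
Proof.
move=> /cvg_rnormP fl fM; apply/ler_addgt0Pl => e e0.
have [i [il iM]] := filter_ex (filterI (fl e e0) fM).
rewrite -[l](subrK (f i)) (le_trans (rnormD _ _))// lerD//.
by rewrite rnormC ltW.
Qed.

Definition compact_balls (W : normedModType C) :=
  forall M : R, compact [set w : W | rnorm w <= M].

Lemma compact_balls_rV n : compact_balls 'rV[C]_n.
Proof. by move=> M; exact: compact_rball. Qed.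

Lemma compact_balls_C : compact_balls C.
Proof.
move=> M; pose c (w : 'rV[C]_1) : C := w ord0 ord0.
have -> : [set w : C | rnorm w <= M] = c @` [set w | rnorm w <= M].
  apply/seteqP; split => [w /= wM|_ [w /= wM <-]]; last first.
    exact: le_trans (rnorm_coord _ _) wM.
  have M0 : 0 <= M by rewrite (le_trans _ wM)// rnorm_ge0.
  exists (const_mx w); last by rewrite /c mxE.
  by apply: rnorm_rV_le => // k; rewrite mxE.
apply: continuous_compact; last exact: compact_rball.
by apply: continuous_subspaceT => w; exact: coord_continuous.
Qed.

Lemma ultra_bounded_cvg {I : Type} (U : set_system I) (W : normedModType C)
    (f : I -> W) (M : R) : UltraFilter U -> compact_balls W ->
  (\forall i \near U, rnorm (f i) <= M) -> exists l : W, f @ U --> l.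
Proof.
move=> UU cW fM; have [l [_ lP]] := cW M (f @ U) _ fM.
exists l => A lA; have [//|UA] := in_ultra_setVsetC (f @^-1` A) UU.
by have [w [/= nA Aw]] := lP (~` A) A UA lA.
Qed.

Lemma limit_differentiable {I : Type} (U : set_system I) (V W : normedModType C)
    (f_ : I -> V -> W) (f : V -> W) (q : V) (r K : R) :
  UltraFilter U -> compact_balls W -> 0 < r ->
  (\forall i \near U, forall v,
    (rnorm v <= r -> rnorm (f_ i (q + v) - f_ i q - 'd (f_ i) q v) <= K * rnorm v ^+ 2) /\
    rnorm ('d (f_ i) q v) <= K * rnorm v) ->
  (forall v, rnorm v <= r -> (f_ i (q + v)) @[i --> U] --> f (q + v)) ->
  differentiable f q /\ forall v, 'd (f_ i) q v @[i --> U] --> 'd f q v.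
Proof.
move=> UU cW r0 fK fl.
have HL v : exists l : W, 'd (f_ i) q v @[i --> U] --> l.
  by apply: (@ultra_bounded_cvg _ U W _ (K * rnorm v)) => //; apply: filterS fK => i /(_ v)[].
have [L LP] := choice HL.
have uniq (u : I -> W) (x y : W) : u @ U --> x -> u @ U --> y -> x = y.
  by apply: cvg_unique; exact: norm_hausdorff.
have Llin : linear L.
  move=> a u v; have c1 : a *: 'd (f_ i) q u @[i --> U] --> a *: L u.
    by apply: cvgZ; [exact: cvg_cst|exact: LP].
  have c2 : (a *: 'd (f_ i) q u + 'd (f_ i) q v) @[i --> U] --> a *: L u + L v.
    exact: cvgD c1 (LP v).
  apply: uniq c2; have -> : (fun i => a *: 'd (f_ i) q u + 'd (f_ i) q v) =
      (fun i => 'd (f_ i) q (a *: u + v)) by apply/funext => i; rewrite linearP.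
  exact: LP.
pose LM := GRing.isLinear.Build _ _ _ _ _ Llin.
pose LL : {linear V -> W} := HB.pack L LM.
have LK v : rnorm (L v) <= K * rnorm v.
  by apply: rnorm_lim_le (LP v) _; apply: filterS fK => i /(_ v)[].
have Lc : continuous LL.
  move=> v; apply/continuous_rnormP => e e0.
  have k0 : 0 < `|K| + 1 by rewrite ltr_wpDl.
  exists (e / (`|K| + 1)) => [|w wv]; first exact: divr_gt0.
  have -> : LL w - LL v = L (w - v) by rewrite -(linearB LL).
  apply: (le_lt_trans (LK _)); apply: (@le_lt_trans _ _ ((`|K| + 1) * rnorm (w - v))).
    by rewrite ler_wpM2r ?rnorm_ge0// (le_trans (ler_norm K))// lerDl.
  by rewrite mulrC -ltr_pdivlMr.
have fq : f_ i q @[i --> U] --> f q.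
  have := fl 0; rewrite rnorm0 => /(_ (ltW r0)).
  have -> : (fun i => f_ i (q + 0)) = (fun i => f_ i q) by apply/funext => i; rewrite addr0.
  by rewrite addr0.
have quad v : rnorm v <= r -> rnorm (f (q + v) - f q - L v) <= K * rnorm v ^+ 2.
  move=> vr; apply: (@rnorm_lim_le _ U _ _ (fun i => f_ i (q + v) - f_ i q - 'd (f_ i) q v)).
    by apply: cvgB => //; apply: cvgB => //; exact: fl.
  by apply: filterS fK => i /(_ v)[/(_ vr)].
have [//|e e0|df dL] := @rnorm_differentiable R V W f q LL.
  have k0 : 0 < `|K| + 1 by rewrite ltr_wpDl.
  exists (Num.min r (e / (`|K| + 1))) => [|v]; first by rewrite lt_min r0 divr_gt0.
  rewrite lt_min => /andP[vr ve]; apply: (le_trans (quad _ (ltW vr))).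
  rewrite expr2 mulrA ler_wpM2r ?rnorm_ge0//.
  rewrite (@le_trans _ _ ((`|K| + 1) * rnorm v))//.
    by rewrite ler_wpM2r ?rnorm_ge0// (le_trans (ler_norm K))// lerDl.
  by rewrite mulrC -ler_pdivlMr// ltW.
split=> [|v]; first exact: df.
have dv : 'd f q v = L v := congr1 (fun h : V -> W => h v) dL.
by move: (LP v); rewrite -dv.
Qed.

End UltraLimits.

(** * Propagation of smallness *)

Section Propagation.
Context {R : realType}.
Local Notation C := R[i].

Lemma expansion_unique (a b : nat -> C) (s : R) (K : nat -> R) : 0 < s ->
  (forall N (t : C), rnorm t <= s ->
    rnorm (\sum_(k < N) a k * t ^+ k - \sum_(k < N) b k * t ^+ k) <= K N * rnorm t ^+ N) ->
  a =1 b.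
Proof.
move=> s0 H m; elim/ltn_ind: m => m IH; apply/eqP; rewrite -subr_eq0 -rnorm_eq0.
rewrite eq_le rnorm_ge0 andbT; apply/ler_addgt0Pl => e e0; rewrite addr0.
have k0 : 0 < `|K m.+1| + 1 by rewrite ltr_wpDl.
pose t := Num.min s (e / (`|K m.+1| + 1)).
have t0 : 0 < t by rewrite lt_min s0 divr_gt0.
have ts : t <= s by rewrite ge_min lexx.
have te : (`|K m.+1| + 1) * t <= e by rewrite mulrC -ler_pdivlMr// ge_min lexx orbT.
have nt : rnorm (t%:C%C : C) = t by rewrite rnorm_real ger0_norm// ltW.
have := H m.+1 t%:C%C; rewrite nt => /(_ ts).
rewrite !big_ord_recr /= (eq_bigr (fun i : 'I_m => b i * t%:C%C ^+ i)); last first.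
  by move=> i _; rewrite IH.
have E (x y z w : C) : x + y * w - (x + z * w) = (y - z) * w by ring.
rewrite E rnormM rnormX nt exprS mulrA ler_pM2r ?exprn_gt0// => /le_trans; apply.
apply: le_trans te; rewrite ler_wpM2r ?(ltW t0)//.
by rewrite (le_trans (ler_norm _))// lerDl.
Qed.

Lemma holo_small_scalar (r M rho e : R) : 0 < r -> 0 < rho -> 0 < e ->
  exists2 d : R, 0 < d & forall (V : normedModType C) (f : V -> C) (q : V),
    holo_bounded f q r M -> (forall z, rnorm (z - q) < rho -> rnorm (f z) <= d) ->
    forall z, rnorm (z - q) <= r / 4 -> rnorm (f z) <= e.
Proof.
move=> r0 rho0 e0.
have [N NP] : exists N, 8 * `|M| * 2^-1 ^+ N <= e / 2.
  have h1 : `|2^-1 : R| < 1 by rewrite ger0_norm ?invr_ge0// invf_lt1// ltr1n.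
  have e2 : 0 < e / 2 by lra.
  have /cvgrPdist_lt/(_ _ e2)[k _ kP] := cvg_geometric (8 * `|M|) h1; exists k.
  have /= := kP k (leqnn _); rewrite sub0r normrN => /ltW; apply: le_trans.
  exact: ler_norm.
pose rh := Num.min r rho.
have rh0 : 0 < rh by rewrite lt_min r0.
pose S := \sum_(k < N) 2 * (2 / rh) ^+ k * (r / 4) ^+ k.
have S0 : 0 <= S.
  apply: sumr_ge0 => k _; apply: mulr_ge0; last by apply: exprn_ge0; lra.
  by apply: mulr_ge0 => //; apply: exprn_ge0; apply: divr_ge0 => //; exact: ltW.
have S1 : 0 < 2 * (S + 1) by lra.
exists (e / (2 * (S + 1))); first exact: divr_gt0.
move=> V f q fM; have [d dE] : exists d, d = e / (2 * (S + 1)) by eexists.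
rewrite -dE => fd z zr; have d0 : 0 < d by rewrite dE divr_gt0.
have [->|zq] := eqVneq z q.
  rewrite (le_trans (fd q _)) ?subrr ?rnorm0//.
  by rewrite dE ler_pdivrMr// ler_peMr ?(ltW e0)//; lra.
have {}zq : 0 < rnorm (z - q) by rewrite rnorm_gt0 subr_eq0.
pose u := (rnorm (z - q))^-1%:C%C *: (z - q).
have u1 : rnorm u <= 1.
  by rewrite rnormZ rnorm_real ger0_norm ?invr_ge0 ?rnorm_ge0// mulVf// gt_eqF.
have [a [aM aN]] := line_taylor r0 fM u1.
have fM' : holo_bounded f q rh d.
  move=> w wr; split; first by apply: (fM w _).1; rewrite (lt_le_trans wr)// ge_min lexx.
  by apply: fd; rewrite (lt_le_trans wr)// ge_min lexx orbT.
have [b [bM bN]] := line_taylor rh0 fM' u1.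
have rh4 : rh / 4 <= r / 4 by rewrite ler_pM2r// ge_min lexx.
have s0 : 0 < rh / 4 by lra.
pose K n := 8 * d * (2 / rh) ^+ n + 8 * M * (2 / r) ^+ n.
have ab : a =1 b.
  apply: (@expansion_unique a b (rh / 4) K) => // n t tr.
  have /(_ (le_trans tr rh4)) H1 := aN n t; have H2 := bN n t tr.
  have -> : \sum_(k < n) a k * t ^+ k - \sum_(k < n) b k * t ^+ k =
    (f (q + t *: u) - \sum_(k < n) b k * t ^+ k) - (f (q + t *: u) - \sum_(k < n) a k * t ^+ k).
    by move: (f _) (\sum_(k < n) a k * _) (\sum_(k < n) b k * _) => x y w; ring.
  rewrite (le_trans (rnormB _ _))// (le_trans (lerD H2 H1))//.
  have E (x : R) : 2 * rnorm t / x = 2 / x * rnorm t by ring.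
  by rewrite !E [(2 / rh * _) ^+ n]exprMn [(2 / r * _) ^+ n]exprMn /K [leRHS]mulrDl !mulrA lexx.
have nt : rnorm ((rnorm (z - q))%:C%C : C) = rnorm (z - q).
  by rewrite rnorm_real ger0_norm// rnorm_ge0.
have zE : q + (rnorm (z - q))%:C%C *: u = z.
  by rewrite scalerA -rmorphM mulfV ?gt_eqF// scale1r addrC subrK.
have := aN N (rnorm (z - q))%:C%C; rewrite nt zE => /(_ zr) H.
have -> : f z = (f z - \sum_(k < N) a k * (rnorm (z - q))%:C%C ^+ k) +
  \sum_(k < N) a k * (rnorm (z - q))%:C%C ^+ k by rewrite subrK.
rewrite (le_trans (rnormD _ _))// (splitr e) lerD//.
  rewrite (le_trans H)// (le_trans _ NP)//.
  apply: (@le_trans _ _ (8 * `|M| * (2 * rnorm (z - q) / r) ^+ N)).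
    rewrite ler_wpM2r ?exprn_ge0 ?divr_ge0 ?mulr_ge0 ?rnorm_ge0 ?(ltW r0)//.
    by rewrite ler_pM2l// ler_norm.
  apply: ler_wpM2l; first by rewrite mulr_ge0.
  apply: lerXn2r; rewrite ?nnegrE ?invr_ge0 ?divr_ge0 ?mulr_ge0 ?rnorm_ge0 ?(ltW r0)//.
  by rewrite ler_pdivrMr//; lra.
rewrite (le_trans (rnorm_sum _ _ _))//.
apply: (@le_trans _ _ (\sum_(k < N) d * (2 * (2 / rh) ^+ k * (r / 4) ^+ k))).
  apply: ler_sum => k _; rewrite rnormM rnormX nt mulrA; apply: ler_pM.
  - exact: rnorm_ge0.
  - by rewrite exprn_ge0// rnorm_ge0.
  - by rewrite ab (le_trans (bM k))// (mulrC 2 d) mulrA.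
  - by apply: lerXn2r; rewrite ?nnegrE ?rnorm_ge0// divr_ge0// ltW.
rewrite -mulr_sumr -/S dE mulrAC ler_pdivrMr//.
have -> : e / 2 * (2 * (S + 1)) = e * (S + 1) by field.
by rewrite ler_pM2l// lerDl.
Qed.

Lemma holo_small (r M rho e : R) : 0 < r -> 0 < rho -> 0 < e ->
  exists2 d : R, 0 < d & forall (V : normedModType C) m (f : V -> 'rV[C]_m) (q : V),
    holo_bounded f q r M -> (forall z, rnorm (z - q) < rho -> rnorm (f z) <= d) ->
    forall z, rnorm (z - q) <= r / 4 -> rnorm (f z) <= e.
Proof.
move=> r0 rho0 e0; have [d d0 dP] := holo_small_scalar M r0 rho0 e0.
exists d => // V m f q fM fd z zr; apply: rnorm_rV_le => [|k]; first exact: ltW.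
apply: (dP V (fun z => f z ord0 k) q) => //; first exact: holo_bounded_coord.
by move=> w /fd; apply: le_trans; exact: rnorm_coord.
Qed.

Lemma connected_good (T : topologicalType) (D : set T) (good : T -> Prop) (p : T) :
  connected D -> D p -> good p -> (forall z, D z -> good z -> nbhs z good) ->
  (forall z, D z -> closure [set w | D w /\ good w] z -> good z) ->
  forall z, D z -> good z.
Proof.
move=> Dc Dp gp go gc; pose B := [set w | D w /\ good w].
suff -> : D = B by move=> z [].
apply/esym/Dc; first by exists p.
- exists (good^°); first exact: open_interior.
  apply/seteqP; split => [z [Dz gz]|z [Dz /interior_subset]]; last by [].
  by split => //; exact: go.
- exists (closure B); first exact: closed_closure.
  apply/seteqP; split => [z [Dz gz]|z [Dz /gc]]; last by move=> /(_ Dz).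
  by split => //; apply: subset_closure.
Qed.

Definition uniformly_small {I : Type} (F : set_system I) {V W : normedModType C}
    (f : I -> V -> W) (z : V) :=
  exists2 rho : R, 0 < rho & forall e : R, 0 < e ->
    \forall i \near F, forall w, rnorm (w - z) < rho -> rnorm (f i w) <= e.

Lemma propagation {I : Type} (F : set_system I) {FF : Filter F} n m
    (f : I -> 'rV[C]_n -> 'rV[C]_m) (D : set 'rV[C]_n) (p : 'rV[C]_n) :
  connected D -> D p ->
  (forall z, D z -> exists r M : R, 0 < r /\ \forall i \near F, holo_bounded (f i) z r M) ->
  uniformly_small F f p -> forall z, D z -> uniformly_small F f z.
Proof.
move=> Dc Dp fM fp; apply: (connected_good Dc Dp fp) => z Dz.
  move=> [rho rho0 H]; apply/nbhs_rnormP; exists (rho / 2) => [|y yz]; first lra.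
  exists (rho / 2) => [|e /H]; first lra.
  apply: filterS => i Hi w wy; apply: Hi.
  by rewrite (le_lt_trans (rnorm_tri y _ _))// (splitr rho) ltrD.
move=> zB; have [r [M [r0 fz]]] := fM z Dz.
have [y [[Dy [rho rho0 H]] /= yz]] := zB _ (near_rnorm z (divr_gt0 r0 (ltr0n _ 16))).
exists (r / 16) => [|e e0]; first lra.
have r2 : 0 < r / 2 by lra.
have [d d0 dP] := holo_small M r2 rho0 e0.
apply: filterS2 fz (H d d0) => i fzi fyi w wz.
apply: (dP _ _ (f i) y) => //.
  by apply: holo_bounded_sub fzi; lra.
by rewrite (le_trans (rnorm_tri z _ _))// (rnormC z y); lra.
Qed.

End Propagation.

(** * The Jacobian determinant and Hurwitz' theorem *)

Section Jacobian.
Context {R : realType}.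
Local Notation C := R[i].

Lemma ultrafilter_infty : exists U : set_system nat, UltraFilter U /\ \oo `<=` U.
Proof. exact: ultraFilterLemma. Qed.

Lemma derivative_holo {V : normedModType C} (f : V -> C) (q e : V) (r M : R) :
  0 < r -> rnorm e <= 1 -> holo_bounded f q r M ->
  holo_bounded (fun z => 'd f z e) q (r / 2) (8 * M / r).
Proof.
move=> r0 e1 fM z zq; have r2 : 0 < r / 2 by lra.
have fz : holo_bounded f z (r / 2) M by apply: holo_bounded_sub fM; lra.
have M0 := holo_bounded_ge0 r0 fM.
have Kr : 4 * M / (r / 2) = 8 * M / r by field; rewrite gt_eqF.
split; last first.
  have [_] := holo_quad_scalar e r2 fz; move=> /le_trans; apply; rewrite Kr ler_piMr//.
  by apply: divr_ge0 (ltW r0); exact: mulr_ge0.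
have [U [UU oU]] := ultrafilter_infty.
pose h (k : nat) : R := k.+1%:R^-1.
have h0 k : 0 < h k by rewrite invr_gt0.
pose G k (w : V) : C := (h k)^-1%:C%C * (f (w + (h k)%:C%C *: e) - f w).
have he k : rnorm ((h k)%:C%C *: e) <= h k.
  by rewrite rnormZ rnorm_real ger0_norm ?(ltW (h0 k))// ler_piMr ?(ltW (h0 k)).
have hsmall d : 0 < d -> \forall k \near U, h k <= d.
  move=> d0; apply: oU; have /cvgrPdist_lt/(_ _ d0) := @cvg_harmonic R.
  apply: filterS => k /=; rewrite sub0r normrN ger0_norm ?invr_ge0//; exact: ltW.
have r32 : 0 < r / 32 by lra.
have r8 : 0 < r / 8 by lra.
have Gb : \forall k \near U, holo_bounded (G k) z (r / 8) (64 * M / r).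
  apply: filterS (hsmall _ r32) => k hk w wz.
  have fw : holo_bounded f w (r / 4) M by apply: holo_bounded_sub fz; lra.
  have r4 : 0 < r / 4 by lra.
  have wh : rnorm ((h k)%:C%C *: e) <= r / 4 / 4 by rewrite (le_trans (he k))// (le_trans hk)//; lra.
  split.
    apply: differentiableM; first exact: differentiable_cst.
    apply: differentiableB; last by apply: (fw _ _).1; rewrite subrr rnorm0.
    apply: (@differentiable_comp _ _ _ _ (fun w : V => w + (h k)%:C%C *: e) f).
      by apply: differentiableD => //; exact: differentiable_cst.
    by apply: (fw _ _).1; rewrite addrAC subrr add0r (le_lt_trans wh)//; lra.
  rewrite rnormM rnorm_real ger0_norm ?invr_ge0 ?(ltW (h0 k))//.
  rewrite mulrC ler_pdivrMr//.
  have := holo_lip0_scalar r4 fw wh; move=> /le_trans; apply.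
  have -> : 16 * M / (r / 4) = 64 * M / r by field; rewrite gt_eqF.
  by apply: ler_wpM2l (he k); apply: divr_ge0 (ltW r0); exact: mulr_ge0.
pose K := Num.max (32 * (64 * M / r) / (r / 8) ^+ 2) (4 * (64 * M / r) / (r / 8)).
have r84 : 0 < r / 8 / 4 by lra.
have [//||//] := @limit_differentiable _ _ U V C G (fun z => 'd f z e) z (r / 8 / 4) K UU
  compact_balls_C r84.
  apply: filterS Gb => k Gk v; have [q1 q2] := holo_quad_scalar v r8 Gk; split => [vr|].
    by apply: (le_trans (q1 vr)); rewrite ler_wpM2r ?sqr_ge0// le_max lexx.
  by apply: (le_trans q2); rewrite ler_wpM2r ?rnorm_ge0// le_max lexx orbT.
move=> v vr; apply/cvg_rnormP => d d0.
have r4 : 0 < r / 4 by lra.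
have fv : holo_bounded f (z + v) (r / 4) M.
  by apply: holo_bounded_sub fz; rewrite addrAC subrr add0r; lra.
pose L := 32 * M / (r / 4) ^+ 2 + 1.
have L0 : 0 < L.
  by rewrite /L ltr_wpDl//; apply: divr_ge0; [exact: mulr_ge0|exact: sqr_ge0].
have dL : 0 < d / (2 * L) by rewrite divr_gt0// mulr_gt0.
have r44 : 0 < r / 4 / 4 by lra.
apply: filterS2 (hsmall _ r44) (hsmall _ dL) => k hk hkL.
have [q1 _] := holo_quad_scalar ((h k)%:C%C *: e) r4 fv.
have {}q1 := q1 (le_trans (he k) hk).
have -> : G k (z + v) - 'd f (z + v) e =
    (h k)^-1%:C%C * (f (z + v + (h k)%:C%C *: e) - f (z + v) - 'd f (z + v) ((h k)%:C%C *: e)).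
  have -> : 'd f (z + v) ((h k)%:C%C *: e) = (h k)%:C%C * 'd f (z + v) e by exact: linearZ.
  rewrite /G; move: (f _) (f _) ('d f _ e) => x y w; rewrite [in RHS]mulrBr mulrA -rmorphM.
  by rewrite mulVf ?gt_eqF// mul1r.
rewrite rnormM rnorm_real ger0_norm ?invr_ge0 ?(ltW (h0 k))// mulrC ltr_pdivrMr//.
apply: (le_lt_trans q1).
have H : rnorm ((h k)%:C%C *: e) ^+ 2 <= h k ^+ 2.
  by apply: lerXn2r; rewrite ?nnegrE ?rnorm_ge0 ?(ltW (h0 k)).
have L1 : 0 <= 32 * M / (r / 4) ^+ 2 by apply: divr_ge0; [exact: mulr_ge0|exact: sqr_ge0].
apply: (le_lt_trans (ler_wpM2l L1 H)).
rewrite [h k ^+ 2]expr2 mulrA ltr_pM2r//.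
apply: (@le_lt_trans _ _ (L * h k)).
  by apply: ler_wpM2r (ltW (h0 k)) _ _ _; rewrite lerDl.
by move: hkL; rewrite ler_pdivlMr ?mulr_gt0//; lra.
Qed.

Lemma det_closed {T : Type} n (P : (T -> C) -> Prop) (A : T -> 'M[C]_n) :
  (forall c, P (fun=> c)) -> (forall u v, P u -> P v -> P (fun t => u t + v t)) ->
  (forall u v, P u -> P v -> P (fun t => u t * v t)) ->
  (forall i j, P (fun t => A t i j)) -> P (fun t => \det (A t)).
Proof.
move=> Pc PD PM PA; rewrite /determinant.
elim: (index_enum _) => [|s l IH].
  by under eq_fun do rewrite big_nil; exact: Pc.
under eq_fun do rewrite big_cons.
apply: (PD _ _ _ IH); apply: (PM _ _ (Pc _)).
elim: (index_enum _) => [|i k IHk]; first by under eq_fun do rewrite big_nil; exact: Pc.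
by under eq_fun do rewrite big_cons; exact: (PM _ _ _ IHk).
Qed.

Lemma hurwitz {I : Type} (U : set_system I) (f_ : I -> C -> C) (f : C -> C) (s M : R) (t : C) :
  UltraFilter U -> 0 < s ->
  (\forall i \near U, holo_bounded (f_ i) 0 s M /\ forall z, rnorm z < s -> f_ i z != 0) ->
  (forall z, rnorm z < s -> f_ i z @[i --> U] --> f z) ->
  rnorm t <= s / 16 -> f t != 0 -> f 0 != 0.
Proof.
move=> UU s0 fi fl ts ft.
have sub0 (z : C) : rnorm (z - 0) < s -> rnorm z < s by rewrite subr0.
have fM : holo_bounded f 0 (s / 2) M.
  move=> z; rewrite subr0 => zs; have zs' : rnorm z < s by lra.
  split; last first.
    by apply: (rnorm_lim_le (fl z zs')); apply: filterS fi => i [+ _] => /(_ z); rewrite subr0 => /(_ zs')[].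
  have s2 : 0 < s / 2 by lra.
  pose K := Num.max (32 * M / (s / 2) ^+ 2) (4 * M / (s / 2)).
  have s24 : 0 < s / 2 / 4 by lra.
  have [||//] := @limit_differentiable _ _ U C C f_ f z (s / 2 / 4) K UU
    compact_balls_C s24.
    apply: filterS fi => k [fk _] v.
    have fk' : holo_bounded (f_ k) z (s / 2) M.
      by apply: holo_bounded_sub fk; rewrite subr0; lra.
    have [q1 q2] := holo_quad_scalar v s2 fk'; split => [vr|].
      by apply: (le_trans (q1 vr)); rewrite ler_wpM2r ?sqr_ge0// le_max lexx.
    by apply: (le_trans q2); rewrite ler_wpM2r ?rnorm_ge0// le_max lexx orbT.
  by move=> v vs; apply: fl; apply: (le_lt_trans (rnormD _ _)); lra.
have s2 : 0 < s / 2 by lra.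
have M0 := holo_bounded_ge0 s2 fM.
have n1 : rnorm (1 : C) <= 1 by rewrite rnorm1.
have [a [aM aN]] := line_taylor s2 fM n1.
have {}aN N (w : C) : rnorm w <= s / 8 ->
    rnorm (f w - \sum_(k < N) a k * w ^+ k) <= 8 * M * (4 * rnorm w / s) ^+ N.
  move=> ws; have := aN N w; rewrite add0r -[w *: _]/(w * 1) mulr1.
  have -> : 2 * rnorm w / (s / 2) = 4 * rnorm w / s by field; rewrite gt_eqF.
  by apply; lra.
have [m am] : exists m, a m != 0.
  apply: contrapT => /forallNP a0.
  move: ft; rewrite -rnorm_gt0 ltNge => /negP; apply; apply/ler_addgt0Pl => e e0; rewrite addr0.
  have h1 : `|2^-1 : R| < 1 by rewrite ger0_norm ?invr_ge0// invf_lt1// ltr1n.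
  have /cvgrPdist_lt/(_ _ e0)[N _ NP] := cvg_geometric (8 * M) h1.
  have ts8 : rnorm t <= s / 8 by lra.
  have := aN N t ts8; rewrite big1 ?subr0 => [|k _]; last first.
    by have /negP/negbNE/eqP -> := a0 k; rewrite mul0r.
  move=> /le_trans; apply; have := NP N (leqnn _); rewrite sub0r normrN => /ltW/le_trans-/(_ _ (lexx _)) H.
  apply: (le_trans _ H); apply: le_trans (ler_norm _); apply: ler_wpM2l; first exact: mulr_ge0.
  apply: lerXn2r; rewrite ?nnegrE ?invr_ge0 ?divr_ge0 ?mulr_ge0 ?rnorm_ge0 ?(ltW s0)//.
  by rewrite ler_pdivrMr//; lra.
have {m am} [m am mmin] := ex_minnP (ex_intro (fun m => a m != 0) m am).
have alt k : (k < m)%N -> a k = 0.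
  by move=> km; apply/eqP; apply: contraTT km => /mmin; rewrite -leqNgt.
have am0 : 0 < rnorm (a m) by rewrite rnorm_gt0.
pose B := 8 * M * (4 / s) ^+ m.+1.
have B0 : 0 <= B by rewrite mulr_ge0 ?mulr_ge0 ?exprn_ge0 ?divr_ge0 ?(ltW s0).
have B1 : 0 < 2 * (B + 1) by lra.
pose rh := Num.min (s / 8) (rnorm (a m) / (2 * (B + 1))).
have rh0 : 0 < rh by rewrite lt_min !divr_gt0.
have rhs : rh <= s / 8 by rewrite ge_min lexx.
have rhB : B * rh <= rnorm (a m) / 2.
  have : rh <= rnorm (a m) / (2 * (B + 1)) by rewrite ge_min lexx orbT.
  by rewrite ler_pdivlMr//; lra.
pose c := rnorm (a m) * rh ^+ m / 2.
have c0 : 0 < c by rewrite divr_gt0// mulr_gt0// exprn_gt0.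
have fc (w : C) : rnorm w = rh -> c <= rnorm (f w).
  move=> wr; have := aN m.+1 w; rewrite wr => /(_ rhs).
  rewrite big_ord_recr big1 => [|k _]; last by rewrite /= alt ?mul0r.
  rewrite /= add0r => H.
  have : rnorm (a m * w ^+ m) <= rnorm (f w - a m * w ^+ m) + rnorm (f w).
    rewrite -rnormN -[X in rnorm X <= _](addKr (f w)) addrC (le_trans (rnormD _ _))//.
    by rewrite rnormN lerD2l lexx.
  rewrite rnormM rnormX wr.
  have E : 8 * M * (4 * rh / s) ^+ m.+1 = B * rh * rh ^+ m.
    have -> : 4 * rh / s = 4 / s * rh by ring.
    by rewrite [(4 / s * rh) ^+ _]exprMn [rh ^+ m.+1]exprS /B !mulrA.
  have : B * rh * rh ^+ m <= rnorm (a m) / 2 * rh ^+ m.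
    by rewrite ler_wpM2r// exprn_ge0// ltW.
  rewrite E in H; rewrite /c; lra.
have cK : compact [set w : C | rnorm w = rh].
  apply: (@subclosed_compact _ _ [set w : C | rnorm w <= rh]).
  - apply: (@preimage_closed _ _ (@rnorm R C) [set x | x = rh]) => [? _|].
      exact: continuous_rnorm.
    exact: closed_eq.
  - exact: compact_balls_C.
  - by move=> w /= ->.
have low : \forall i \near U, forall w : C, rnorm w = rh -> c / 2 <= rnorm (f_ i w).
  have := cK; rewrite compact_near_coveringP => /(_ _ U (fun i w => c / 2 <= rnorm (f_ i w)) _).
  apply => w /= wr.
  have ws : rnorm w < s by rewrite wr; lra.
  have c4 : 0 < c / 4 by lra.
  have s4 : 0 < s / 4 by lra.
  pose L := 16 * M / (s / 4) + 1.
  have L0 : 0 < L by rewrite /L ltr_wpDl//; apply: divr_ge0 (ltW s4); exact: mulr_ge0.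
  pose e := Num.min (s / 4 / 4) (c / (4 * L)).
  have e0 : 0 < e.
    by rewrite lt_min; apply/andP; split; [lra|apply: divr_gt0 => //; exact: mulr_gt0].
  have /cvg_rnormP/(_ _ c4) H := fl w ws.
  exists ([set w' | rnorm (w' - w) < e], [set i | rnorm (f_ i w - f w) < c / 4 /\
      holo_bounded (f_ i) w (s / 4) M]) => /=.
    split; first exact: near_rnorm.
    apply: filterS2 H fi => i Hi [fib _]; split => //.
    by apply: holo_bounded_sub fib; rewrite subr0 wr; lra.
  move=> [w' i] [/= w'w [Hi fib]].
  have w's : rnorm (w' - w) <= s / 4 / 4 by rewrite (le_trans (ltW w'w))// ge_min lexx.
  have := holo_lip0_scalar s4 fib w's; rewrite (addrC w) subrK => H1.
  have H2 : 16 * M / (s / 4) * rnorm (w' - w) <= c / 4.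
    apply: (@le_trans _ _ (L * rnorm (w' - w))).
      by rewrite ler_wpM2r ?rnorm_ge0// lerDl.
    have : rnorm (w' - w) <= c / (4 * L) by rewrite (le_trans (ltW w'w))// ge_min lexx orbT.
    by rewrite ler_pdivlMr ?mulr_gt0//; lra.
  have H3 := fc w wr.
  have : rnorm (f w) <= rnorm (f_ i w - f w) + (rnorm (f_ i w' - f_ i w) + rnorm (f_ i w')).
    have T (x y : C) : rnorm x <= rnorm (y - x) + rnorm y.
      by rewrite rnormC -{1}(subrK y x) rnormD.
    by rewrite (le_trans (T (f w) (f_ i w)))// lerD2l T.
  lra.
suff : c / 4 <= rnorm (f 0) by rewrite -rnorm_gt0; apply: lt_le_trans; lra.
have z0s : rnorm (0 : C) < s by rewrite rnorm0.
apply/ler_addgt0Pl => e e0.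
have /cvg_rnormP/(_ _ e0) H := fl 0 z0s.
have [i [[Hi lowi] [fib fin0]]] := filter_ex (filterI (filterI H low) fi).
have := @mean_value_bound R (fun w => (f_ i w)^-1) s rh (2 / c).
have dV (z : C) : rnorm z < s -> differentiable (fun w => (f_ i w)^-1) z.
  move=> zs; apply: differentiableV; last exact: fin0.
  by apply: (fib _ _).1; rewrite subr0.
have rhs' : 0 < rh < s by rewrite rh0; lra.
have lo (z : C) : rnorm z = rh -> rnorm (f_ i z)^-1 <= 2 / c.
  move=> /lowi; rewrite rnormV => cz.
  have cz0 : 0 < rnorm (f_ i z) by apply: lt_le_trans cz; lra.
  by rewrite -[2 / c]invf_div lef_pV2 ?posrE//; lra.
move=> /(_ dV rhs' lo); rewrite rnormV => H1.
have fi0 : 0 < rnorm (f_ i 0) by rewrite rnorm_gt0 fin0.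
have : c / 4 <= rnorm (f_ i 0).
  move: H1; have -> : 2 * (2 / c) = (c / 4)^-1 by field; rewrite gt_eqF.
  by rewrite lef_pV2 ?posrE//; lra.
have : rnorm (f_ i 0) <= rnorm (f_ i 0 - f 0) + rnorm (f 0).
  by rewrite -{1}[f_ i 0](subrK (f 0)) rnormD.
lra.
Qed.

Lemma rnorm_delta_mx n (k : 'I_n) : rnorm (delta_mx ord0 k : 'rV[C]_n) <= 1.
Proof.
apply: rnorm_rV_le => // l; rewrite mxE eqxx /=.
by case: (l == k); rewrite ?rnorm1 ?rnorm0.
Qed.

Lemma jacobianE n (f : 'rV[C]_n -> 'rV[C]_n) z k l :
  jacobian f z k l = 'd f z (delta_mx ord0 k) ord0 l.
Proof. by rewrite /jacobian mxE. Qed.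

Lemma jacobian_dist n (f g : 'rV[C]_n -> 'rV[C]_n) z k l :
  rnorm (jacobian f z k l - jacobian g z k l) <=
  rnorm ('d f z (delta_mx ord0 k) - 'd g z (delta_mx ord0 k)).
Proof.
have E (x y : 'rV[C]_n) : rnorm (x ord0 l - y ord0 l) <= rnorm (x - y).
  by have := rnorm_coord (x - y) l; rewrite !mxE.
apply: le_trans (E _ _); rewrite le_eqVlt; apply/orP; left; apply/eqP.
by congr (rnorm (_ - _)); exact: jacobianE.
Qed.

Lemma hurwitz_jacobian {I : Type} (U : set_system I) n
    (f_ : I -> 'rV[C]_n -> 'rV[C]_n) (f : 'rV[C]_n -> 'rV[C]_n)
    (z0 z1 : 'rV[C]_n) (r M : R) :
  UltraFilter U -> 0 < r ->
  (\forall i \near U, holo_bounded (f_ i) z0 r M /\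
    forall z, rnorm (z - z0) < r -> \det (jacobian (f_ i) z) != 0) ->
  (forall z, rnorm (z - z0) < r -> f_ i z @[i --> U] --> f z) ->
  rnorm (z1 - z0) <= r / 32 -> \det (jacobian f z1) != 0 -> \det (jacobian f z0) != 0.
Proof.
move=> UU r0 fi fl z1r; have [->//|z10] := eqVneq z1 z0.
have {}z10 : 0 < rnorm (z1 - z0) by rewrite rnorm_gt0 subr_eq0.
pose u := (rnorm (z1 - z0))^-1%:C%C *: (z1 - z0).
have u1 : rnorm u <= 1.
  by rewrite rnormZ rnorm_real ger0_norm ?invr_ge0 ?rnorm_ge0// mulVf// gt_eqF.
pose z (t : C) := z0 + t *: u.
have z1E : z (rnorm (z1 - z0))%:C%C = z1.
  by rewrite /z scalerA -rmorphM mulfV ?gt_eqF// scale1r addrC subrK.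
have z0E : z 0 = z0 by rewrite /z scale0r addr0.
have zt (t : C) : rnorm (z t - z0) <= rnorm t.
  by rewrite /z addrAC subrr add0r rnormZ ler_piMr// rnorm_ge0.
have r2 : 0 < r / 2 by lra.
have [K HK] : exists K : R, forall i (t : C), holo_bounded (f_ i) z0 r M -> rnorm t < r / 2 ->
    rnorm (\det (jacobian (f_ i) (z t))) <= K.
  suff [K _ HK] : exists2 K : R, 0 <= K & forall it : I * C, holo_bounded (f_ it.1) z0 r M ->
      rnorm it.2 < r / 2 -> rnorm (\det (jacobian (f_ it.1) (z it.2))) <= K.
    by exists K => i t; exact: (HK (i, t)).
  apply: (@det_closed _ _ (fun g : I * C -> C => exists2 K : R, 0 <= K &
      forall it : I * C, holo_bounded (f_ it.1) z0 r M -> rnorm it.2 < r / 2 -> rnorm (g it) <= K)).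
  - by move=> c; exists (rnorm c) => //; exact: rnorm_ge0.
  - move=> g h [K K0 HK] [L L0 HL]; exists (K + L) => [|it fb tr]; first exact: addr_ge0.
    by rewrite (le_trans (rnormD _ _))// lerD// ?HK// HL.
  - move=> g h [K K0 HK] [L L0 HL]; exists (K * L) => [|it fb tr]; first exact: mulr_ge0.
    by rewrite rnormM; apply: ler_pM; rewrite ?rnorm_ge0// ?HK// HL.
  - move=> k l; exists (`|8 * M / r|) => // -[i t] /= fb tr; rewrite jacobianE.
    rewrite (le_trans (rnorm_coord _ _))//.
    have fb' : holo_bounded (f_ i) (z t) (r / 2) M.
      by apply: holo_bounded_sub fb; have := zt t; lra.
    have [_] := holo_quad (delta_mx ord0 k) r2 fb'; move=> /le_trans; apply.
    have -> : 4 * M / (r / 2) = 8 * M / r by field; rewrite gt_eqF.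
    apply: (@le_trans _ _ (`|8 * M / r| * rnorm (delta_mx ord0 k : 'rV[C]_n))).
      by rewrite ler_wpM2r ?rnorm_ge0// ler_norm.
    by rewrite ler_piMr// rnorm_delta_mx.
pose phi_ i t := \det (jacobian (f_ i) (z t)).
pose phi t := \det (jacobian f (z t)).
have Hd : \forall i \near U, holo_bounded (phi_ i) 0 (r / 2) K /\
    forall t, rnorm t < r / 2 -> phi_ i t != 0.
  apply: filterS fi => i [fb fn0]; split => t; last first.
    by move=> tr; apply: fn0; have := zt t; lra.
  rewrite subr0 => tr; split; last exact: HK.
  apply: (@det_closed _ _ (fun g : C -> C => differentiable g t)).
  - by move=> c; exact: differentiable_cst.
  - by move=> g h dg dh; exact: differentiableD.
  - by move=> g h dg dh; exact: differentiableM.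
  move=> k l; pose g w := 'd (fun w => f_ i w ord0 l) w (delta_mx ord0 k).
  have dg : differentiable (g \o z) t.
    apply: differentiable_comp; first exact: differentiable_line.
    have := derivative_holo r0 (rnorm_delta_mx k) (holo_bounded_coord l fb).
    by move=> /(_ (z t))[|//]; have := zt t; lra.
  apply: differentiable_near_eq dg; apply/nbhs_rnormP.
  exists (r / 2 - rnorm t) => [|w wt]; first by rewrite subr_gt0.
  have wr : rnorm (z w - z0) < r.
    have := zt w; have : rnorm w <= rnorm (w - t) + rnorm t by rewrite -{1}(subrK t w) rnormD.
    lra.
  rewrite jacobianE /g /=.
  by have [_ ->] := differentiable_coordinate l (fb _ wr).1.
have Hl t : rnorm t < r / 2 -> phi_ i t @[i --> U] --> phi t.
  move=> tr; have ztr := zt t.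
  pose K' := Num.max (32 * M / (r / 2) ^+ 2) (4 * M / (r / 2)).
  have r24 : 0 < r / 2 / 4 by lra.
  have H1 : \forall i \near U, forall v,
      (rnorm v <= r / 2 / 4 -> rnorm (f_ i (z t + v) - f_ i (z t) - 'd (f_ i) (z t) v) <= K' * rnorm v ^+ 2) /\
      rnorm ('d (f_ i) (z t) v) <= K' * rnorm v.
    apply: filterS fi => i [fb _] v.
    have fb' : holo_bounded (f_ i) (z t) (r / 2) M.
      by apply: holo_bounded_sub fb; lra.
    have [q1 q2] := holo_quad v r2 fb'; split => [vr|].
      by apply: (le_trans (q1 vr)); rewrite ler_wpM2r ?sqr_ge0// le_max lexx.
    by apply: (le_trans q2); rewrite ler_wpM2r ?rnorm_ge0// le_max lexx orbT.
  have H2 v : rnorm v <= r / 2 / 4 -> f_ i (z t + v) @[i --> U] --> f (z t + v).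
    move=> vr; apply: fl; rewrite addrAC (le_lt_trans (rnormD _ _))//; lra.
  have [_ dl] := limit_differentiable UU (@compact_balls_rV R n) r24 H1 H2.
  pose A (o : option I) := if o is Some i then jacobian (f_ i) (z t) else jacobian f (z t).
  apply: (@det_closed _ _ (fun g : option I -> C => g (Some i) @[i --> U] --> g None) A).
  - by move=> c; exact: cvg_cst.
  - by move=> g h; exact: cvgD.
  - by move=> g h; exact: cvgM.
  move=> k l; apply/cvg_rnormP => e e0.
  have /cvg_rnormP/(_ _ e0) := dl (delta_mx ord0 k); apply: filterS => i.
  by apply: le_lt_trans; exact: jacobian_dist.
have t1 : rnorm ((rnorm (z1 - z0))%:C%C : C) <= r / 2 / 16.
  by rewrite rnorm_real ger0_norm ?rnorm_ge0//; lra.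
have := @hurwitz _ U phi_ phi (r / 2) K _ UU r2 Hd Hl t1.
by rewrite /phi z1E z0E.
Qed.

End Jacobian.

(** * Curves with bounded velocity *)

Section Curves.
Context {R : realType} {n : nat}.
Local Notation C := R[i].
Implicit Types (g : R -> 'rV[C]_n).

Definition has_velocity g (t : R) (v : 'rV[C]_n) :=
  (fun h : R => (h^-1)%:C%C *: (g (t + h) - g t)) @ 0^' --> v.

Lemma velocity_part (part : C -> R) g t v k :
  (forall z w, part (z - w) = part z - part w) ->
  (forall (x : R) z, part (x%:C%C * z) = x * part z) ->
  (forall z, `|part z| <= rnorm z) ->
  has_velocity g t v -> is_derive t 1 (fun s => part (g s ord0 k)) (part (v ord0 k)).
Proof.
move=> pB pZ pn /cvg_rnormP gv.
have H : (fun h : R => h^-1 *: (((fun s => part (g s ord0 k)) \o shift t) (h *: 1) - part (g t ord0 k)))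
    @ 0^' --> part (v ord0 k).
  apply/cvgrPdist_lt => e /gv; apply: filterS => h; apply: le_lt_trans.
  apply: le_trans (rnorm_coord _ k); apply: le_trans (pn _).
  rewrite !mxE /= [h *: 1]mulr1 (addrC h) -[_ *: _]/(h^-1 * _) -pB -pZ -pB.
  by rewrite -normrN -[- part _]sub0r -[in X in X <= _](subrr (part 0)) -!pB subrr sub0r opprB.
apply: DeriveDef; first by apply/cvg_ex; exists (part (v ord0 k)).
exact: cvg_lim H.
Qed.

Lemma velocity_continuous g t v : has_velocity g t v -> {for t, continuous g}.
Proof.
move=> /cvg_rnormP/(_ 1 ltr01)/nbhs_ballP[d /= d0 dP].
apply/cvg_rnormP => e e0.
have K0 : 0 < rnorm v + 1 by rewrite ltr_wpDl// rnorm_ge0.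
apply/nbhs_ballP; exists (Num.min d (e / (rnorm v + 1))) => /=.
  by rewrite lt_min d0 divr_gt0.
move=> s; rewrite /ball /= lt_min => /andP[sd se].
have [->|st] := eqVneq s t; first by rewrite subrr rnorm0.
have st0 : s - t != 0 by rewrite subr_eq0.
have := dP (s - t); rewrite /ball /= sub0r opprB => /(_ sd st0) /ltW H.
have {}H : rnorm ((s - t)^-1%:C%C *: (g (t + (s - t)) - g t)) <= rnorm v + 1.
  by rewrite -[X in rnorm X](subrK v) (le_trans (rnormD _ _))// addrC lerD2l.
move: H; rewrite rnormZ rnorm_real normfV (addrC t) subrK mulrC ler_pdivrMr ?normr_gt0//.
move=> /le_lt_trans; apply; rewrite mulrC -ltr_pdivlMr//.
by rewrite distrC.
Qed.

Lemma velocity_bound g (v : R -> 'rV[C]_n) (a b K : R) : a < b -> 0 <= K ->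
  (forall t, a <= t <= b -> has_velocity g t (v t)) ->
  (forall t, a < t < b -> rnorm (v t) <= K) ->
  rnorm (g b - g a) <= 2 * K * (b - a).
Proof.
move=> ab K0 gv vK.
have H (part : C -> R) k : (forall z w, part (z - w) = part z - part w) ->
    (forall (x : R) z, part (x%:C%C * z) = x * part z) ->
    (forall z, `|part z| <= rnorm z) ->
    `|part ((g b - g a) ord0 k)| <= K * (b - a).
  move=> pB pZ pn.
  have df x : x \in `]a, b[%R -> is_derive x 1 (fun s => part (g s ord0 k)) (part (v x ord0 k)).
    rewrite in_itv /= => /andP[ax xb]; apply: velocity_part => //; apply: gv.
    by rewrite !ltW.
  have fc : {within `[a, b], continuous (fun s => part (g s ord0 k))}.
    apply: continuous_in_subspaceT => x; rewrite inE /= in_itv /= => xab.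
    have [D _] := velocity_part k pB pZ pn (gv x xab).
    by apply: differentiable_continuous; apply/derivable1_diffP.
  have [c cab] := MVT ab df fc; rewrite !mxE pB => ->.
  rewrite normrM [`|b - a|]ger0_norm ?subr_ge0 ?(ltW ab)// ler_wpM2r ?subr_ge0 ?(ltW ab)//.
  rewrite (le_trans (pn _))// (le_trans (rnorm_coord _ _))// vK//.
apply: rnorm_rV_le => [|k]; first by rewrite !mulr_ge0// subr_ge0 ltW.
rewrite (le_trans (rnorm_le_ReIm _))// mulr2n mulrDl mul1r mulrDl lerD// H//.
- by move=> z w; rewrite ReB.
- by move=> x [p q] /=; rewrite mul0r subr0.
- exact: rnorm_Re.
- by move=> z w; rewrite ImB.
- by move=> x [p q] /=; rewrite mul0r addr0.
- exact: rnorm_Im.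
Qed.

(* First-exit argument: the speed bound is only needed while the curve stays
   in the ball of radius [e] about its starting point. *)
Lemma velocity_exit g (v : R -> 'rV[C]_n) (T K e : R) : 0 < T -> 0 <= K -> 0 < e ->
  4 * K * T <= e ->
  (forall t, 0 <= t <= T -> has_velocity g t (v t)) ->
  (forall t, 0 <= t <= T -> rnorm (g t - g 0) < e -> rnorm (v t) <= K) ->
  rnorm (g T - g 0) <= 2 * K * T.
Proof.
move=> T0 K0 e0 KT gv vK.
pose S := [set s : R | 0 <= s <= T /\ forall u, 0 <= u <= s -> rnorm (g u - g 0) < e].
have S0 : S 0.
  split=> [|u]; first by rewrite lexx ltW.
  by rewrite -eq_le => /eqP <-; rewrite subrr rnorm0.
have hS : has_sup S by split; [exists 0|exists T => s [/andP[]]].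
pose s := sup S.
have s0 : 0 <= s by apply: ub_le_sup S0; case: hS.
have sT : s <= T by apply: ge_sup; [exists 0|move=> x [/andP[]]].
have ins u : 0 <= u < s -> rnorm (g u - g 0) < e.
  move=> /andP[u0 us]; have [x [_ xS] ux] := sup_gt hS.1 us.
  by apply: xS; rewrite u0 ltW.
have bnd x : 0 < x -> x <= T -> (forall u, 0 <= u < x -> rnorm (g u - g 0) < e) ->
    rnorm (g x - g 0) <= 2 * K * x.
  move=> x0 xT H; rewrite -[X in _ * X]subr0; apply: (velocity_bound x0 K0).
    by move=> t /andP[t0 tx]; apply: gv; rewrite t0 (le_trans tx).
  move=> t /andP[t0 tx]; apply: vK; first by rewrite !ltW// (lt_le_trans tx).
  by apply: H; rewrite tx ltW.
have se : rnorm (g s - g 0) < e.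
  move: s0; rewrite le_eqVlt => /predU1P[<-|s0]; first by rewrite subrr rnorm0.
  rewrite (le_lt_trans (bnd s s0 sT ins))// (@le_lt_trans _ _ (e / 2))//; last lra.
  have : 4 * K * s <= e by rewrite (le_trans _ KT)// ler_wpM2l// mulr_ge0.
  lra.
have sTE : s = T.
  apply/eqP; rewrite eq_le sT /= leNgt; apply/negP => sT'.
  have d0 : 0 < e - rnorm (g s - g 0) by rewrite subr_gt0.
  have sin : 0 <= s <= T by rewrite s0.
  have /cvg_rnormP/(_ _ d0)/nbhs_ballP[d /= dd0 dP] := velocity_continuous (gv s sin).
  pose s' := Num.min T (s + d / 2).
  have ss' : s < s' by rewrite lt_min sT' /=; lra.
  have : S s'.
    split; first by rewrite ge_min lexx andbT (le_trans s0)// ltW.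
    move=> u /andP[u0 us']; have [us|us] := ltP u s; first by apply: ins; rewrite u0.
    have : rnorm (g u - g s) < e - rnorm (g s - g 0).
      apply: dP; rewrite /ball /= distrC ger0_norm ?subr_ge0//.
      have : s' <= s + d / 2 by rewrite ge_min lexx orbT.
      lra.
    by have := rnorm_tri (g s) (g u) (g 0); lra.
  move=> Ss'; have : s' <= s by apply: ub_le_sup Ss'; case: hS.
  by rewrite leNgt ss'.
by apply: bnd => // u uT; apply: ins; rewrite sTE.
Qed.

End Curves.

(** * Domains and boundaries *)

Lemma continuous_bigsum {R : realType} {V : normedModType R[i]} (I : Type) (l : seq I)
    (c : I -> V -> R) (z : V) : (forall k, {for z, continuous (c k)}) ->
  {for z, continuous (fun w => \sum_(k <- l) c k w)}.
Proof.
move=> cc; rewrite /continuous_at /prop_for; elim: l => [|k l IH].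
  by apply/cvgrPdist_lt => e e0; apply: nearW => w; rewrite !big_nil subrr normr0.
have -> : (fun w => \sum_(j <- k :: l) c j w) = (fun w => c k w + \sum_(j <- l) c j w).
  by apply/funext => w; rewrite big_cons.
by rewrite big_cons; apply: cvgD => //; exact: cc.
Qed.

Section Domains.
Context {R : realType} {n : nat}.
Local Notation C := R[i].
Local Notation V := 'rV[C]_n.
Implicit Types (A D E : set V) (p q z w : V).

Lemma enorm_ge_rnorm z : rnorm z <= enorm z.
Proof.
apply: rnorm_rV_le => [|k]; first exact: sqrtr_ge0.
rewrite /rnorm normc_def /=; apply: ler_wsqrtr.
by rewrite (bigD1 k)//= lerDl sumr_ge0// => i _; rewrite addr_ge0// sqr_ge0.
Qed.

Lemma enorm_le_rnorm z : enorm z <= n.+1%:R * rnorm z.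
Proof.
have r0 := rnorm_ge0 z.
rewrite -[leRHS]ger0_norm ?mulr_ge0// -sqrtr_sqr; apply: ler_wsqrtr.
apply: (@le_trans _ _ (\sum_(k < n) rnorm z ^+ 2)).
  apply: ler_sum => k _; apply: (@le_trans _ _ (rnorm (z ord0 k) ^+ 2)).
    by rewrite /rnorm normc_def /= sqr_sqrtr// addr_ge0// sqr_ge0.
  by apply: lerXn2r; rewrite ?nnegrE ?rnorm_ge0// rnorm_coord.
rewrite sumr_const card_ord -[leLHS]mulr_natl exprMn ler_wpM2r ?sqr_ge0//.
by rewrite -natrX ler_nat expnS expn1 mulSn (leq_trans (leqnSn n))// leq_addr.
Qed.

Lemma enorm_scale (s : R) z : enorm (s%:C%C *: z) = `|s| * enorm z.
Proof.
rewrite /enorm -sqrtr_sqr -sqrtrM ?sqr_ge0//; congr Num.sqrt.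
rewrite mulr_sumr; apply: eq_bigr => k _; rewrite mxE.
by case: (z _ _) => x y /=; rewrite !mul0r subr0 addr0 !exprMn mulrDr.
Qed.

Lemma enorm0 : enorm (0 : V) = 0.
Proof.
by rewrite /enorm big1 ?sqrtr0// => k _; rewrite mxE /= expr0n addr0.
Qed.

Lemma continuous_enorm (z : V) : {for z, continuous (@enorm R n)}.
Proof.
pose c k (w : V) := complex.Re (w ord0 k) ^+ 2 + complex.Im (w ord0 k) ^+ 2.
have cc k : {for z, continuous (c k)}.
  have cRe : {for z, continuous (fun w : V => complex.Re (w ord0 k))}.
    apply: continuous_rnorm_le => w; rewrite -ReB (le_trans (rnorm_Re _))//.
    by have := rnorm_coord (w - z) k; rewrite !mxE.
  have cIm : {for z, continuous (fun w : V => complex.Im (w ord0 k))}.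
    apply: continuous_rnorm_le => w; rewrite -ImB (le_trans (rnorm_Im _))//.
    by have := rnorm_coord (w - z) k; rewrite !mxE.
  exact: (cvgD (cvgM cRe cRe) (cvgM cIm cIm)).
apply: (@continuous_comp _ _ _ (fun w => \sum_(k < n) c k w) Num.sqrt).
  exact: continuous_bigsum.
exact: sqrt_continuous.
Qed.

Lemma continuous_enormB (p w : V) : {for w, continuous (fun z => enorm (z - p))}.
Proof.
apply: (@continuous_comp _ _ _ (fun z => z - p) enorm); last exact: continuous_enorm.
by apply/continuous_rnormP => e e0; exists e => // u uw; rewrite opprB addrA subrK.
Qed.

Lemma open_eball (p w : V) (r : R) : eball p r w -> nbhs w (eball p r).
Proof. by move=> wr; exact: (continuous_enormB (lt_nbhsl wr)). Qed.

Lemma starshaped_connected A q : A q ->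
  (forall z (s : R), A z -> 0 <= s <= 1 -> A (q + s%:C%C *: (z - q))) -> connected A.
Proof.
move=> Aq Astar; pose S z := (fun s : R => q + s%:C%C *: (z - q)) @` `[0, 1].
have -> : A = \bigcup_(z in A) S z.
  apply/seteqP; split => [z Az|w [z Az [s]]].
    exists z => //; exists 1; first by rewrite /= in_itv /= lexx ler01.
    by rewrite rmorph1 scale1r addrC subrK.
  by rewrite /= in_itv /= => s01 <-; exact: Astar.
apply: bigcup_connected.
  exists q => z Az; exists 0; first by rewrite /= in_itv /= lexx ler01.
  by rewrite rmorph0 scale0r addr0.
move=> z Az; apply: connected_continuous_connected; first exact: segment_connected.
apply: continuous_subspaceT => t.
apply/cvg_rnormP => e e0.
have k0 : 0 < rnorm (z - q) + 1 by rewrite ltr_wpDl// rnorm_ge0.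
apply/nbhs_ballP; exists (e / (rnorm (z - q) + 1)) => [|s /=]; first exact: divr_gt0.
rewrite /ball /= distrC ltr_pdivlMr// => st.
rewrite opprD addrACA subrr add0r -scalerBl -rmorphB rnormZ rnorm_real.
by rewrite (le_lt_trans _ st)// ler_wpM2l// lerDl.
Qed.

Lemma connected_rball q (r : R) : connected [set w | rnorm (w - q) < r].
Proof.
have [r0|r0] := leP r 0.
  have -> : [set w | rnorm (w - q) < r] = set0.
    by apply/seteqP; split => // w /=; rewrite ltNge (le_trans r0)// rnorm_ge0.
  exact: connected0.
apply: (@starshaped_connected _ q) => [|z s /= zr /andP[s0 s1]].
  by rewrite /= subrr rnorm0.
rewrite addrAC subrr add0r rnormZ rnorm_real ger0_norm// (le_lt_trans _ zr)//.
by rewrite ler_piMl// rnorm_ge0.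
Qed.

Lemma boundary_open D z : open D -> D z -> ~ boundary D z.
Proof. by move=> oD Dz [_]; apply; exact: open_nbhs_nbhs. Qed.

Lemma connected_subset A D q : connected A -> open D -> A q -> D q ->
  (forall w, A w -> ~ boundary D w) -> A `<=` D.
Proof.
move=> cA oD Aq Dq Ab; suff <- : A `&` D = A by move=> w [].
apply: cA; first by exists q.
- by exists D.
- exists (closure D); first exact: closed_closure.
  apply/seteqP; split => w [Aw Dw]; split => //; first exact: subset_closure.
  apply: contrapT => nDw; apply: (Ab w Aw); split => //.
  by move: nDw; apply: contra_not; exact: interior_subset.
Qed.

Lemma bounded_domain_rnorm D : bounded_set D -> exists M : R, forall z, D z -> rnorm z <= M.
Proof.
move=> [m [mr mD]]; exists (complex.Re m + 1) => z Dz.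
have : m < (complex.Re m + 1)%:C%C.
  by rewrite -{1}(RRe_real mr) ltcR ltrDl.
by move=> /mD/(_ z Dz); rewrite /= rnormE lecR.
Qed.

Lemma hausdorff_close D E (e : R) : (hausdorff_dist D E < e%:E)%E ->
  (forall x, D x -> exists2 y, E y & rnorm (x - y) < e) /\
  (forall y, E y -> exists2 x, D x & rnorm (y - x) < e).
Proof.
have H A B : (ereal_sup [set edist_to_set x B | x in A] < e%:E)%E ->
    forall x, A x -> exists2 y, B y & rnorm (x - y) < e.
  move=> He x Ax; have : (edist_to_set x B < e%:E)%E.
    by apply: le_lt_trans He; apply: ereal_sup_ubound; exists x.
  move=> /ereal_inf_lt[_ [y By <-]]; rewrite lte_fin => xy; exists y => //.
  exact: le_lt_trans (enorm_ge_rnorm _) xy.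
by rewrite /hausdorff_dist gt_max => /andP[H1 H2]; split; exact: H.
Qed.

Lemma domain_contains_ball_boundary D E w (e : R) : open E ->
  (hausdorff_dist (boundary E) (boundary D) < e%:E)%E ->
  (forall z, rnorm (z - w) < e -> E z) -> ~ boundary D w.
Proof.
move=> oE /hausdorff_close[_ H] wE /H[z Ez wz].
by apply: (boundary_open oE) Ez; apply: wE; rewrite rnormC.
Qed.

(* A ray leaving a point of large norm stays away from the boundary. *)
Lemma domain_norm_le D (M : R) : open D -> bounded_set D -> 0 <= M ->
  (forall z, boundary D z -> rnorm z <= M) -> forall z, D z -> rnorm z <= M.
Proof.
move=> oD /bounded_domain_rnorm[L DL] M0 bM z Dz; rewrite leNgt; apply/negP => zM.
have z0 : 0 < rnorm z by apply: le_lt_trans zM.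
pose s := (`|L| + 1) / rnorm z + 1.
have s1 : 1 <= s by rewrite lerDr divr_ge0 ?rnorm_ge0// addr_ge0.
pose A := (fun t : R => t%:C%C *: z) @` `[1, s].
have cA : connected A.
  apply: connected_continuous_connected; first exact: segment_connected.
  apply: continuous_subspaceT => t; apply/cvg_rnormP => e e0.
  apply/nbhs_ballP; exists (e / rnorm z) => [|u /=]; first exact: divr_gt0.
  by rewrite /ball /= distrC ltr_pdivlMr// -scalerBl -rmorphB rnormZ rnorm_real.
have AD : A `<=` D.
  apply: (@connected_subset _ _ z) => //.
    by exists 1; [rewrite /= in_itv /= lexx s1|rewrite rmorph1 scale1r].
  move=> w [t]; rewrite /= in_itv /= => /andP[t1 ts] <- /bM.
  rewrite leNgt rnormZ rnorm_real ger0_norm ?(le_trans _ t1)// => /negP; apply.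
  by rewrite (lt_le_trans zM)// ler_peMl// rnorm_ge0.
have : A (s%:C%C *: z) by exists s => //; rewrite /= in_itv /= s1 lexx.
move=> /AD/DL; rewrite rnormZ rnorm_real ger0_norm ?(le_trans _ s1)//.
rewrite leNgt => /negP; apply; rewrite mulrDl mul1r divfK ?gt_eqF//.
have := ler_norm L; lra.
Qed.

End Domains.

Section DomainConvergence.
Context {R : realType} {n : nat}.
Local Notation C := R[i].
Local Notation V := 'rV[C]_n.
Context (Dj : nat -> set V) (D : set V) (p : V) (r : R).
Context (Djd : forall j, bounded_domain (Dj j)) (Dd : bounded_domain D).
Context (cvgD : (fun j => domain_dist (Dj j) D) @ \oo --> 0%E).
Context (r0 : 0 < r) (Djr : forall j, eball p r `<=` Dj j) (Dp : D p).

Let oD : open D. Proof. by case: Dd => -[]. Qed.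
Let cD : connected D. Proof. by case: Dd => -[]. Qed.
Let oDj j : open (Dj j). Proof. by case: (Djd j) => -[]. Qed.

Lemma domain_dist_lt (e : R) : 0 < e ->
  \forall j \near \oo, (hausdorff_dist (boundary (Dj j)) (boundary D) < e%:E)%E.
Proof.
move=> e0; have e0E : (0%E < e%:E)%E by rewrite lte_fin.
have := open_ereal_lt' e0E; exact: cvgD.
Qed.

Lemma not_boundary_limit w (e : R) (F : set_system nat) : ProperFilter F ->
  \oo `<=` F -> 0 < e ->
  (\forall j \near F, forall z, rnorm (z - w) < e -> Dj j z) -> ~ boundary D w.
Proof.
move=> FF oF e0 wD; have [j [Hj Hd]] := filter_ex (filterI wD (oF _ (domain_dist_lt e0))).
exact: (domain_contains_ball_boundary (@oDj j) Hd Hj).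
Qed.

Lemma eball_subset_limit : eball p r `<=` D.
Proof.
have pr : eball p r p by rewrite /eball /= subrr enorm0.
apply: (@connected_subset _ _ _ _ p) => //.
  apply: (@starshaped_connected _ _ _ p) => // z s.
  rewrite /eball /= => zr /andP[s0 s1]; rewrite addrAC subrr add0r enorm_scale ger0_norm//.
  by rewrite (le_lt_trans _ zr)// ler_piMl// sqrtr_ge0.
move=> w /(open_eball (r := r) (p := p))/nbhs_rnormP[e e0 eP].
apply: (not_boundary_limit (F := \oo)) e0 _ => //.
by apply: nearW => j z /eP; exact: Djr.
Qed.

Lemma domain_exhaustion z : D z -> exists2 e : R, 0 < e &
  \forall j \near \oo, forall w, rnorm (w - z) < e -> Dj j w.
Proof.
apply: (connected_good cD Dp (good := fun z => exists2 e : R, 0 < e &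
  \forall j \near \oo, forall w, rnorm (w - z) < e -> Dj j w)).
- have /open_eball/nbhs_rnormP[e e0 eP] : eball p r p by rewrite /eball /= subrr enorm0.
  by exists e => //; apply: nearW => j w /eP; exact: Djr.
- move=> {}z Dz [e e0 He]; apply/nbhs_rnormP; exists (e / 2) => [|y yz]; first lra.
  exists (e / 2); first lra.
  apply: filterS He => j Hj w wy; apply: Hj.
  by rewrite (le_lt_trans (rnorm_tri y _ _))// (splitr e) ltrD.
move=> {}z Dz zB; have /nbhs_rnormP[e e0 eD] : nbhs z D by exact: open_nbhs_nbhs.
have e2 : 0 < e / 2 by lra.
have [y [[Dy [d d0 Hy]] /= yz]] := zB _ (near_rnorm z e2).
exists (e / 2) => //; apply: filterS2 (domain_dist_lt e2) Hy => j Hj Hyj.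
apply: (@connected_subset _ _ _ _ y) => //; first exact: connected_rball.
  by apply: Hyj; rewrite subrr rnorm0.
move=> w /= wz /(hausdorff_close Hj).1[x xD wx].
apply: (boundary_open oD) xD; apply: eD.
by rewrite (le_lt_trans (rnorm_tri w _ _))// (rnormC x) (splitr e) ltrD.
Qed.

Lemma domains_bounded : exists M : R, 0 <= M /\
  \forall j \near \oo, forall z, Dj j z -> rnorm z <= M.
Proof.
have [L DL] := bounded_domain_rnorm Dd.2.
exists (`|L| + 2); split; first by rewrite addr_ge0.
apply: filterS (domain_dist_lt ltr01) => j Hj; apply: domain_norm_le => //.
  by case: (Djd j).
move=> z /(hausdorff_close Hj).1[x [cx _] zx].
have [y [Dy /= yx]] := cx _ (near_rnorm x (@ltr01 R)).
have -> : z = (z - x) + ((x - y) + y) by rewrite !subrK.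
rewrite (le_trans (rnormD _ _))// (le_trans (lerD (lexx _) (rnormD _ _)))//.
have := ler_norm L; have := DL y Dy; rewrite rnormC in yx; lra.
Qed.

End DomainConvergence.

(** * One-parameter actions *)

Section TwoSidedVelocity.
Context {R : realType} {n : nat}.
Local Notation C := R[i].
Implicit Types (g : R -> 'rV[C]_n).

Lemma has_velocity_rnormP g t v : has_velocity g t v <->
  forall e : R, 0 < e -> exists2 d : R, 0 < d & forall h, `|h| < d -> h != 0 ->
    rnorm ((h^-1)%:C%C *: (g (t + h) - g t) - v) < e.
Proof.
split=> [/cvg_rnormP gv e /gv/nbhs_ballP[d /= d0 dP]|H].
  by exists d => // h hd h0; apply: dP => //; rewrite /ball /= sub0r normrN.
apply/cvg_rnormP => e /H[d d0 dP]; apply/nbhs_ballP; exists d => //= h.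
by rewrite /ball /= sub0r normrN => hd h0; exact: dP.
Qed.

Lemma has_velocity_opp g t v : has_velocity g (- t) v ->
  has_velocity (fun s => g (- s)) t (- v).
Proof.
move=> /has_velocity_rnormP H; apply/has_velocity_rnormP => e /H[d d0 dP].
exists d => // h hd h0; have := dP (- h); rewrite normrN oppr_eq0 => /(_ hd h0).
by rewrite invrN raddfN /= scaleNr -opprD rnormN opprK opprD.
Qed.

Lemma has_velocity_sub_line g t v c : has_velocity g t v ->
  has_velocity (fun s => g s - s%:C%C *: c) t (v - c).
Proof.
move=> /has_velocity_rnormP H; apply/has_velocity_rnormP => e /H[d d0 dP].
exists d => // h hd h0; have := dP h hd h0; congr (rnorm _ < _).
have E (x y z w : 'rV[C]_n) : x - (z + w) - (y - z) = x - y - w.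
  by rewrite opprB [z + w]addrC opprD !addrA subrK addrAC.
rewrite rmorphD scalerDl E [in RHS]scalerBr scalerA -rmorphM mulVf// scale1r opprB.
by rewrite addrA subrK.
Qed.

Lemma velocity_exit2 g (v : R -> 'rV[C]_n) (T K e : R) : 0 <= K -> 0 < e ->
  4 * K * T <= e -> (forall t, has_velocity g t (v t)) ->
  (forall t, `|t| <= T -> rnorm (g t - g 0) < e -> rnorm (v t) <= K) ->
  forall t, `|t| <= T -> rnorm (g t - g 0) <= 2 * K * `|t|.
Proof.
move=> K0 e0 KT gv vK t tT.
have Kt : 4 * K * `|t| <= e by rewrite (le_trans _ KT)// ler_wpM2l// mulr_ge0.
have [t0|t0|->] := ltgtP t 0; last by rewrite subrr rnorm0 normr0 mulr0.
- rewrite ltr0_norm// in tT Kt *.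
  have t0' : 0 < - t by rewrite oppr_gt0.
  have := @velocity_exit _ _ (fun s => g (- s)) (fun s => - v (- s)) (- t) K e t0' K0 e0 Kt.
  rewrite opprK oppr0; apply => s /andP[s0 st].
    by apply: has_velocity_opp; exact: gv.
  by rewrite rnormN; apply: vK; rewrite normrN ger0_norm// (le_trans st).
- rewrite gtr0_norm// in tT Kt *.
  apply: (@velocity_exit _ _ g v t K e) => // s /andP[s0 st].
  by apply: vK; rewrite ger0_norm// (le_trans st).
Qed.

Lemma velocity_bound2 g (v : R -> 'rV[C]_n) (T K : R) : 0 <= K ->
  (forall t, has_velocity g t (v t)) -> (forall t, `|t| <= T -> rnorm (v t) <= K) ->
  forall t, `|t| <= T -> rnorm (g t - g 0) <= 2 * K * `|t|.
Proof.
move=> K0 gv vK t tT; pose e := `|4 * K * T| + 1.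
apply: (@velocity_exit2 g v T K e) => //.
- by rewrite ltr_wpDl.
- by rewrite (le_trans (ler_norm _))// lerDl.
- by move=> s sT _; exact: vK.
Qed.

End TwoSidedVelocity.

Section LocalSurjectivity.
Context {R : realType} {n : nat}.
Local Notation C := R[i].
Local Notation V := 'rV[C]_n.

Lemma compact_closed_rball (z : V) (r : R) : compact [set w | rnorm (w - z) <= r].
Proof.
apply: (@subclosed_compact _ _ [set w : V | rnorm w <= r + rnorm z]).
- apply: (@preimage_closed _ _ (fun w : V => rnorm (w - z)) [set x | x <= r]) => [w _|].
    apply: continuous_rnorm_le => u.
    have T (x y : V) : rnorm x - rnorm y <= rnorm (x - y).
      by rewrite lerBlDr -{1}(subrK y x) rnormD.
    have := T (u - z) (w - z); have := T (w - z) (u - z).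
    rewrite !opprB !addrA !subrK (rnormC w u) ler_norml => H1 H2; apply/andP; split; lra.
  exact: closed_le.
- exact: compact_rball.
- move=> w /= wr; have := rnormD (w - z) z; rewrite subrK; lra.
Qed.

Lemma inverse_ball (E : set V) (f h : V -> V) (z0 : V) (eta c : R) :
  open E -> 0 < eta -> 0 < c -> (forall z, rnorm (z - z0) <= eta -> E z) ->
  (forall z, E z -> E (f z)) ->
  (forall z, E z -> {for z, continuous f}) -> (forall z, E z -> {for z, continuous h}) ->
  (forall z, E z -> h (f z) = z) -> (forall z, E z -> f (h z) = z) ->
  (forall x y, rnorm (x - z0) <= eta -> rnorm (y - z0) <= eta ->
    c * rnorm (x - y) <= rnorm (f x - f y)) ->
  forall w, rnorm (w - f z0) < c * eta / 2 -> E w.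
Proof.
move=> oE eta0 c0 zE Ef cf ch hf fh fc.
pose K := [set z : V | rnorm (z - z0) <= eta].
pose A := [set w : V | rnorm (w - f z0) < c * eta / 2].
have Kz0 : K z0 by rewrite /K /= subrr rnorm0 ltW.
have ce : 0 < c * eta / 2 by rewrite divr_gt0// mulr_gt0.
have cA : connected A by exact: connected_rball.
have AE : A `&` (f @` K) = A.
  apply: cA.
  - by exists (f z0); split; [rewrite /A /= subrr rnorm0|exists z0].
  - exists ((f @` K)^°); first exact: open_interior.
    apply/seteqP; split => w [Aw fw]; split => //; last exact: interior_subset.
    have [x Kx xw] := fw.
    have xz : rnorm (x - z0) < eta / 2.
      have := fc x z0 Kx Kz0; rewrite xw => /le_lt_trans/(_ Aw).
      by rewrite -mulrA ltr_pM2l.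
    have Ew : E w by rewrite -xw; apply/Ef/zE.
    have e2 : 0 < eta / 2 by lra.
    have hw : h w = x by rewrite -xw hf//; exact: zE.
    have /continuous_rnormP/(_ _ e2)[d d0 dP] := ch w Ew.
    have /nbhs_rnormP[d' d'0 d'P] : nbhs w E by exact: open_nbhs_nbhs.
    apply/nbhs_rnormP; exists (Num.min d d') => [|w']; first by rewrite lt_min d0.
    rewrite lt_min => /andP[/dP + /d'P Ew']; rewrite hw => hx.
    exists (h w'); last exact: fh.
    by rewrite /K /= (le_trans (rnorm_tri x _ _))//; lra.
  - exists (f @` K) => //; apply: compact_closed; first exact: norm_hausdorff.
    apply: continuous_compact; last exact: compact_closed_rball.
    by apply: continuous_in_subspaceT => z; rewrite inE => /zE; exact: cf.
move=> w Aw; have : (A `&` (f @` K)) w by rewrite AE.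
by move=> [_ [x /zE Ex <-]]; exact: Ef.
Qed.

Lemma rnorm_mulmx (w : V) (B : 'M[C]_n) :
  rnorm (w *m B) <= (\sum_i \sum_k rnorm (B i k)) * rnorm w.
Proof.
have S0 : 0 <= \sum_i \sum_k rnorm (B i k).
  by apply: sumr_ge0 => i _; apply: sumr_ge0 => k _; exact: rnorm_ge0.
apply: rnorm_rV_le => [|k]; first by rewrite mulr_ge0 ?rnorm_ge0.
rewrite mxE (le_trans (rnorm_sum _ _ _))// mulr_suml; apply: ler_sum => i _.
rewrite rnormM mulrC ler_pM ?rnorm_ge0// ?rnorm_coord//.
by rewrite (bigD1 k)//= lerDl sumr_ge0// => j _; exact: rnorm_ge0.
Qed.

Lemma diff_jacobian (f : V -> V) z v : 'd f z v = v *m jacobian f z.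
Proof. by rewrite mul_rV_lin1. Qed.

Lemma det_jacobian_lower (f : V -> V) z : \det (jacobian f z) != 0 ->
  exists2 c : R, 0 < c & forall v, c * rnorm v <= rnorm ('d f z v).
Proof.
move=> J0; pose B := invmx (jacobian f z).
pose S := \sum_i \sum_k rnorm (B i k).
have S0 : 0 <= S by apply: sumr_ge0 => i _; apply: sumr_ge0 => k _; exact: rnorm_ge0.
have S1 : 0 < S + 1 by lra.
exists (S + 1)^-1; first by rewrite invr_gt0.
move=> v; rewrite mulrC ler_pdivrMr// mulrC.
have {1}-> : v = 'd f z v *m B by rewrite diff_jacobian mulmxK// unitmxE unitfE.
by rewrite (le_trans (rnorm_mulmx _ _))// ler_wpM2r ?rnorm_ge0// lerDl.
Qed.

Lemma det_jacobian_neq0 (f : V -> V) z : (forall v, 'd f z v = 0 -> v = 0) ->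
  \det (jacobian f z) != 0.
Proof.
move=> H; apply/negP => /det0P[v v0 vJ]; move: v0; rewrite (H v) ?eqxx//.
by rewrite diff_jacobian.
Qed.

Lemma det_jacobian_left_inverse (f h : V -> V) z : differentiable f z ->
  differentiable h (f z) -> (\forall w \near z, h (f w) = w) ->
  \det (jacobian f z) != 0.
Proof.
move=> df dh hf; apply: det_jacobian_neq0 => v fv0.
have hfz : h (f z) = z by exact: nbhs_singleton hf.
have [|e e0|_ E] := @rnorm_differentiable R V V (h \o f) z idfun.
- by move=> x.
- have /nbhs_rnormP[d d0 dP] := hf; exists d => // k kd.
  rewrite /= dP; last by rewrite addrAC subrr add0r.
  by rewrite hfz addrAC addrK subrr rnorm0 mulr_ge0 ?rnorm_ge0// ltW.
- have -> : v = 'd (h \o f) z v by rewrite E.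
  rewrite (diff_comp df dh) [LHS](_ : _ = 'd h (f z) ('d f z v))//.
  apply: (etrans (congr1 _ fv0)).
  exact: linear0.
Qed.

End LocalSurjectivity.

Section SingleAction.
Context {R : realType} {n : nat}.
Local Notation C := R[i].
Local Notation V := 'rV[C]_n.
Context (E : set V) (g : V -> R -> V) (X : V -> V).
Context (oE : open E) (gA : one_parameter_action E g) (gX : generates E g X).

Lemma action_mem z t : E z -> E (g z t).
Proof. by case: gA => /(_ t)[h [_ _ H _ _]] _ _ _; exact: H. Qed.

Lemma action_differentiable z t : E z -> differentiable (g^~ t) z.
Proof. by case: gA => /(_ t)[h [H _ _ _ _]] _ _ _; exact: H. Qed.

Lemma action0 z : E z -> g z 0 = z.
Proof. by case: gA => _ _ H _; exact: H. Qed.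

Lemma actionD z t s : E z -> g z (t + s) = g (g z t) s.
Proof. by case: gA => _ _ _ H; exact: H. Qed.

Lemma actionK z t : E z -> g (g z t) (- t) = z.
Proof. by move=> Ez; rewrite -actionD// subrr action0. Qed.

Lemma actionNK z t : E z -> g (g z (- t)) t = z.
Proof. by move=> Ez; rewrite -actionD// addNr action0. Qed.

Lemma action_velocity z t : E z -> has_velocity (g z) t (X (g z t)).
Proof.
move=> Ez; have [_ /(_ _ (action_mem t Ez))] := gX.
rewrite /has_velocity (action0 (action_mem t Ez)).
by have -> : g (g z t) = (fun h => g z (t + h)) by apply/funext => h; rewrite actionD.
Qed.

Lemma action_det z t : E z -> \det (jacobian (g^~ t) z) != 0.
Proof.
move=> Ez; apply: (@det_jacobian_left_inverse _ _ _ (g^~ (- t))).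
- exact: action_differentiable.
- by apply: action_differentiable; exact: action_mem.
- have : nbhs z E by exact: open_nbhs_nbhs.
  by apply: filterS => w Ew; exact: actionK.
Qed.

End SingleAction.

(** * Uniform estimates for families of actions *)

Section ActionEstimates.
Context {R : realType} {n : nat}.
Local Notation C := R[i].
Local Notation V := 'rV[C]_n.
Context (E : set V) (g : V -> R -> V) (X : V -> V).
Context (oE : open E) (gA : one_parameter_action E g) (gX : generates E g X).

(* For [S w = \sum_(i < m) g w (i * h)] with [m * h = tau], the difference
   [S (g w h) - S w] telescopes to [g w tau - w], whereas [S] is close to [m]
   times the identity; hence [g w h - w] is of order [1 / m]. *)
Lemma action_field_bound z (e tau : R) : 0 < e -> 0 < tau ->
  (forall w, rnorm (w - z) < e -> E w) ->
  (forall w t, rnorm (w - z) < e -> 0 <= t <= tau -> rnorm (g w t - w) <= e / 128) ->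
  forall w, rnorm (w - z) < e / 4 -> rnorm (X w) <= e / tau.
Proof.
move=> e0 tau0 zE gw w wz; have e20 : 0 < e / 128 by lra.
have wze : rnorm (w - z) < e by lra.
have Ew := zE w wze.
have phi_lip t x y : 0 <= t <= tau -> rnorm (x - z) < e / 2 -> rnorm (y - z) < e / 2 ->
    rnorm ((g x t - x) - (g y t - y)) <= 1 / 4 * rnorm (x - y).
  move=> t0 xz yz.
  have H : holo_bounded (fun u => g u t - u) z e (e / 128).
    move=> u uz; split; last exact: gw.
    by apply: differentiableB => //; apply: (action_differentiable gA); exact: zE.
  have := holo_lip e0 H xz yz.
  by have -> : 32 * (e / 128) / e = 1 / 4 by field; rewrite gt_eqF.
have step m : (0 < m)%N -> rnorm (g w (tau / m%:R) - w) <= e / 64 / m%:R.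
  move=> m0; set h := tau / m%:R; have m0' : 0 < m%:R :> R by rewrite ltr0n.
  have h0 : 0 < h by exact: divr_gt0.
  have mh : m%:R * h = tau by rewrite /h mulrC divfK// gt_eqF.
  have ih i : (i <= m)%N -> 0 <= i%:R * h <= tau.
    move=> im; apply/andP; split; first by rewrite mulr_ge0// ltW.
    by rewrite -mh ler_pM2r// ler_nat.
  pose S u := \sum_(0 <= i < m) g u (i%:R * h).
  have ht : 0 <= h <= tau by have := ih 1%N m0; rewrite mul1r.
  have gwh := gw w h wze ht.
  set x := g w h in gwh *.
  have xz : rnorm (x - z) < e / 2 by rewrite (le_lt_trans (rnorm_tri w _ _))//; lra.
  have wz2 : rnorm (w - z) < e / 2 by lra.
  have SD : rnorm (S x - S w - m%:R%:C%C *: (x - w)) <= m%:R * (1 / 4 * rnorm (x - w)).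
    have -> : S x - S w - m%:R%:C%C *: (x - w) =
        \sum_(0 <= i < m) ((g x (i%:R * h) - x) - (g w (i%:R * h) - w)).
      rewrite (eq_bigr (fun i => g x (i%:R * h) - g w (i%:R * h) - (x - w))); last first.
        by move=> i _; rewrite subrBB.
      have mE : (m%:R : R)%:C%C = m%:R :> C by exact: rmorph_nat.
      rewrite [RHS]sumrB [X in _ = X - _]sumrB sumr_const_nat subn0 mE scaler_nat.
      by [].
    rewrite (le_trans (rnorm_sum _ _ _))//.
    apply: (@le_trans _ _ (\sum_(0 <= i < m) (1 / 4 * rnorm (x - w)))).
      by rewrite !big_mkord; apply: ler_sum => i _; apply: phi_lip => //; apply: ih; exact: ltnW.
    by rewrite sumr_const_nat subn0 [leRHS]mulr_natl.
  have ST : S x - S w = g w tau - w.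
    have -> : S x = \sum_(0 <= i < m) g w (i.+1%:R * h).
      apply: eq_bigr => i _; rewrite -(actionD gA)//; congr (g w _).
      by rewrite -natr1 mulrDl mul1r addrC.
    rewrite -sumrB telescope_sumr// mh mul0r.
    by rewrite (action0 gA).
  rewrite ST in SD.
  have T0 : 0 <= tau <= tau by rewrite lexx ltW.
  have GT := gw w tau wze T0.
  have : rnorm (m%:R%:C%C *: (x - w)) <=
      rnorm (g w tau - w) + rnorm (g w tau - w - m%:R%:C%C *: (x - w)).
    by rewrite -[X in rnorm X <= _](subKr (g w tau - w)); exact: rnormB.
  rewrite rnormZ rnorm_real ger0_norm ?ler0n// ler_pdivlMr// => H.
  have : m%:R * (1 / 4 * rnorm (x - w)) = 1 / 4 * (rnorm (x - w) * m%:R) by ring.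
  lra.
have [_ /(_ w Ew)] := gX; rewrite (action0 gA)// => /cvg_rnormP XP.
apply/ler_addgt0Pl => d d0; have /nbhs_ballP[s /= s0 sP] := XP d d0.
pose m := (Num.truncn (tau / s)).+1.
have m0 : 0 < m%:R :> R by rewrite ltr0n.
have mh0 : 0 < tau / m%:R by exact: divr_gt0.
have ms : tau / m%:R < s.
  rewrite ltr_pdivrMr// mulrC -ltr_pdivrMr//.
  exact: truncnS_gt.
have := sP (tau / m%:R).
rewrite /ball /= sub0r normrN gtr0_norm// => /(_ ms (lt0r_neq0 mh0)) H.
rewrite -[X w](subKr ((tau / m%:R)^-1%:C%C *: (g w (tau / m%:R) - w))).
rewrite (le_trans (rnormB _ _))// addrC lerD//; first exact: ltW.
rewrite rnormZ rnorm_real ger0_norm ?invr_ge0 ?(ltW mh0)//.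
have := step _ (ltn0Sn (Num.truncn (tau / s))); rewrite -/m => step1.
have mh1 : 0 <= (tau / m%:R)^-1 by rewrite invr_ge0 ltW.
apply: le_trans (ler_wpM2l mh1 step1) _.
have -> : (tau / m%:R)^-1 * (e / 64 / m%:R) = e / tau / 64.
  by field; rewrite !gt_eqF.
have : 0 <= e / tau by rewrite divr_ge0// ltW.
lra.
Qed.

Lemma action_displacement z (e K T : R) : 0 < e -> 0 <= K -> 4 * K * T <= e / 2 ->
  (forall w, rnorm (w - z) < e -> E w /\ rnorm (X w) <= K) ->
  forall w t, rnorm (w - z) < e / 2 -> `|t| <= T -> rnorm (g w t - w) <= 2 * K * `|t|.
Proof.
move=> e0 K0 KT zE w t wz tT; have [|Ew _] := zE w; first lra.
have e20 : 0 < e / 2 by lra.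
have := @velocity_exit2 _ _ (g w) (fun s => X (g w s)) T K (e / 2) K0 e20 KT.
rewrite (action0 gA Ew); apply => // [s|s sT gs].
  by apply: (action_velocity gA gX).
by apply: (zE _ _).2; rewrite (le_lt_trans (rnorm_tri w _ _))//; lra.
Qed.

Lemma action_quadratic z (e K T : R) : 0 < e -> 0 <= K -> 4 * K * T <= e / 2 ->
  (forall w, rnorm (w - z) < e -> E w) -> holo_bounded X z e K ->
  forall w t, rnorm (w - z) < e / 4 -> `|t| <= T ->
    rnorm (g w t - w - t%:C%C *: X w) <= 128 * K ^+ 2 / e * `|t| ^+ 2.
Proof.
move=> e0 K0 KT zE XK w t wz tT.
have zEX u : rnorm (u - z) < e -> E u /\ rnorm (X u) <= K.
  by move=> uz; split; [exact: zE|exact: (XK u uz).2].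
have Ew : E w by apply: zE; lra.
have wz2 : rnorm (w - z) < e / 2 by lra.
have K2 : 0 <= 64 * K ^+ 2 / e * `|t|.
  by apply: mulr_ge0 => //; apply: divr_ge0 (ltW e0); rewrite mulr_ge0// sqr_ge0.
have := @velocity_bound2 _ _ (fun s => g w s - s%:C%C *: X w)
  (fun s => X (g w s) - X w) `|t| (64 * K ^+ 2 / e * `|t|) K2.
rewrite (action0 gA Ew) rmorph0 scale0r subr0 => H.
rewrite addrAC (le_trans (H _ _ t _))//.
- by move=> s; apply: has_velocity_sub_line; exact: (action_velocity gA gX).
- move=> s st; have sT := le_trans st tT.
  have gs := action_displacement e0 K0 KT zEX wz2 sT.
  have Kt : 4 * K * `|s| <= e / 2 by rewrite (le_trans _ KT)// ler_wpM2l// mulr_ge0.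
  have gz : rnorm (g w s - z) < e / 2 by rewrite (le_lt_trans (rnorm_tri w _ _))//; lra.
  rewrite (le_trans (holo_lip e0 XK gz wz2))//.
  have K32 : 0 <= 32 * K / e by rewrite divr_ge0 ?(ltW e0)// mulr_ge0.
  apply: le_trans (ler_wpM2l K32 gs) _.
  have -> : 64 * K ^+ 2 / e * `|t| = 32 * K / e * (2 * K * `|t|) by ring.
  by rewrite ler_wpM2l// ler_wpM2l// mulr_ge0.
- by rewrite -subr_ge0 le_eqVlt; apply/orP; left; apply/eqP; ring.
Qed.

End ActionEstimates.

Definition tame {R : realType} {n : nat} (E : set 'rV[R[i]]_n)
    (g : 'rV[R[i]]_n -> R -> 'rV[R[i]]_n) (X : 'rV[R[i]]_n -> 'rV[R[i]]_n)
    (z : 'rV[R[i]]_n) (e T K M : R) :=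
  [/\ (forall w, rnorm (w - z) < e -> E w),
      holo_bounded X z e K,
      (forall t, holo_bounded (g^~ t) z e M) &
      forall w t, rnorm (w - z) < e -> `|t| <= T ->
        rnorm (g w t - w) <= K * `|t| /\
        rnorm (g w t - w - t%:C%C *: X w) <= K * `|t| ^+ 2].

Section ActionFamily.
Context {R : realType} {n : nat}.
Local Notation C := R[i].
Local Notation V := 'rV[C]_n.
Context (Dj : nat -> set V) (D : set V) (p : V) (M rr : R)
  (g : nat -> V -> R -> V) (X : nat -> V -> V).
Context (oDj : forall j, open (Dj j)) (cD : connected D) (Dp : D p).
Context (exhD : forall z, D z -> exists2 e : R, 0 < e &
  \forall j \near \oo, forall w, rnorm (w - z) < e -> Dj j w).
Context (bddD : \forall j \near \oo, forall z, Dj j z -> rnorm z <= M).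
Context (gA : forall j, one_parameter_action (Dj j) (g j))
  (gX : forall j, generates (Dj j) (g j) (X j)).
Context (rr0 : 0 < rr)
  (X1 : forall j w, rnorm (w - p) < rr -> Dj j w /\ rnorm (X j w) <= 1).

Lemma family_holo z : D z -> exists2 e : R, 0 < e &
  \forall j \near \oo, (forall w, rnorm (w - z) < e -> Dj j w) /\
    forall t, holo_bounded ((g j)^~ t) z e M.
Proof.
move=> /exhD[e e0 He]; exists e => //; apply: filterS2 He bddD => j Hj Bj.
split=> // t w /Hj Dw; split; first exact: action_differentiable (gA j) _ _ _.
by apply: Bj; exact: action_mem (gA j) _ _ _.
Qed.

Lemma family_small z : D z -> exists2 rho : R, 0 < rho & forall eps : R, 0 < eps ->
  exists2 d : R, 0 < d & \forall j \near \oo, forall w t, rnorm (w - z) < rho ->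
    `|t| <= d -> rnorm (g j w t - w) <= eps.
Proof.
move=> Dz; pose F := filter_prod \oo (nbhs (0 : R)).
pose f (jt : nat * R) (w : V) := g jt.1 w jt.2 - w.
have fM y : D y -> exists r L : R, 0 < r /\ \forall i \near F, holo_bounded (f i) y r L.
  move=> /family_holo[e e0 He]; exists e, (M + (e + rnorm y)); split => //.
  apply: (@filterS _ F _ (fst @^-1` [set j | (forall w, rnorm (w - y) < e -> Dj j w) /\
    forall t, holo_bounded ((g j)^~ t) y e M])); last first.
    by apply: (@cvg_fst _ _ \oo (nbhs (0 : R))); exact: He.
  move=> [j t] /= [_ H] w wy; have [dw bw] := H t w wy; split.
    by apply: differentiableB => //.
  rewrite /f (le_trans (rnormB _ _))// lerD// -[w in leLHS](subrK y).
  by rewrite (le_trans (rnormD _ _))// lerD2r ltW.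
have fp : uniformly_small F f p.
  exists (rr / 2); first by rewrite divr_gt0.
  have r0 := rr0; move=> eps eps0; pose d := Num.min (rr / 8) (eps / 2).
  have d0 : 0 < d by rewrite lt_min; apply/andP; split; lra.
  have d8 : d <= rr / 8 by rewrite ge_min lexx.
  have deps : d <= eps / 2 by rewrite ge_min lexx orbT.
  apply: (@filterS _ F _ (snd @^-1` [set t : R | `|t| < d])); last first.
    apply: (@cvg_snd _ _ \oo (nbhs (0 : R))).
    by apply/nbhs_ballP; exists d => // t; rewrite /ball /= sub0r normrN.
  move=> [j t] /= td w wp.
  have KT : 4 * 1 * d <= rr / 2 by lra.
  have := action_displacement (gA j) (gX j) rr0 ler01 KT (X1 j) wp (ltW td).
  rewrite /f /=; move: td; lra.
have [rho rho0 H] := propagation cD Dp fM fp Dz; exists rho => // eps /H.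
move=> [[A B] /= [oA nB] AB]; have /nbhs_ballP[d /= d0 dB] := nB.
exists (d / 2); first lra.
apply: filterS oA => j Aj w t wz td; apply: (AB (j, t)) => //; split => //=.
by apply: dB; rewrite /ball /= sub0r normrN; lra.
Qed.

Lemma family_tame z : D z -> exists e T K : R, [/\ 0 < e, 0 < T, 0 <= K &
  \forall j \near \oo, tame (Dj j) (g j) (X j) z e T K M].
Proof.
move=> Dz; have [e1 e10 H1] := family_holo Dz; have [e2 e20 H2] := family_small Dz.
pose e := Num.min e1 e2.
have e0 : 0 < e by rewrite lt_min e10.
have ee1 : e <= e1 by rewrite ge_min lexx.
have ee2 : e <= e2 by rewrite ge_min lexx orbT.
have e128 : 0 < e / 128 by lra.
have [d d0 H3] := H2 _ e128.
pose K1 := e / d; have K10 : 0 < K1 by exact: divr_gt0.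
pose T := e / 4 / (8 * K1).
have e40 : 0 < e / 4 by lra.
have T0 : 0 < T by rewrite divr_gt0// mulr_gt0.
have KT : 4 * K1 * T <= e / 4 / 2.
  by rewrite -subr_ge0 le_eqVlt; apply/orP; left; apply/eqP; rewrite /T; field; rewrite gt_eqF.
have C0 : 0 <= 128 * K1 ^+ 2 / (e / 4).
  by apply: divr_ge0 (ltW e40); rewrite mulr_ge0// sqr_ge0.
exists (e / 4 / 4), T, (2 * K1 + 128 * K1 ^+ 2 / (e / 4)); split => //; first lra.
  by rewrite addr_ge0// mulr_ge0// ltW.
apply: filterS2 H1 H3 => j [Ej Hj] Gj.
have Eje w : rnorm (w - z) < e -> Dj j w by move=> wz; apply: Ej; lra.
have XK : holo_bounded (X j) z (e / 4) K1.
  move=> w wz; split; first by apply: (gX j).1; apply: Eje; lra.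
  apply: (action_field_bound (gA j) (gX j) e0 d0 Eje _ wz) => u t uz /andP[t0 td].
  by apply: Gj; [lra|rewrite ger0_norm].
have Eje4 w : rnorm (w - z) < e / 4 -> Dj j w by move=> wz; apply: Eje; lra.
split => [w wz|w wz|t|w t wz tT].
- by apply: Eje; lra.
- have [|dw bw] := XK w; first lra.
  split => //; rewrite (le_trans bw)//; lra.
- by apply: holo_bounded_sub (Hj t); rewrite subrr rnorm0; lra.
- have Xb u : rnorm (u - z) < e / 4 -> Dj j u /\ rnorm (X j u) <= K1.
    by move=> uz; split; [exact: Eje4|exact: (XK u uz).2].
  have wz2 : rnorm (w - z) < e / 4 / 2 by lra.
  split.
    rewrite (le_trans (action_displacement (gA j) (gX j) e40 (ltW K10) KT Xb wz2 tT))//.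
    by rewrite ler_wpM2r// lerDl.
  rewrite (le_trans (action_quadratic (gA j) (gX j) e40 (ltW K10) KT Eje4 XK wz tT))//.
  by rewrite ler_wpM2r ?sqr_ge0// lerDr mulr_ge0// ltW.
Qed.

End ActionFamily.

(** * The limit action *)

Section LimitTools.
Context {R : realType}.
Local Notation C := R[i].

Lemma cvg_rnorm_unique {I : Type} {F : set_system I} {FF : ProperFilter F}
    {W : normedModType C} (f : I -> W) (l l' : W) :
  f @ F --> l -> f @ F --> l' -> l = l'.
Proof. by apply: cvg_unique; exact: norm_hausdorff. Qed.

Lemma rnorm_lim_dist_le {I : Type} {F : set_system I} {FF : ProperFilter F}
    {W : normedModType C} (f : I -> W) (l w : W) (c : R) :
  f @ F --> l -> (\forall i \near F, rnorm (f i - w) <= c) -> rnorm (l - w) <= c.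
Proof.
move=> fl; apply: rnorm_lim_le; apply/cvg_rnormP => e e0.
by move/cvg_rnormP : fl => /(_ e e0); apply: filterS => i; rewrite opprB addrA subrK.
Qed.

Lemma limit_holo {I : Type} (U : set_system I) n (f_ : I -> 'rV[C]_n -> 'rV[C]_n)
    (f : 'rV[C]_n -> 'rV[C]_n) (z : 'rV[C]_n) (e L : R) :
  UltraFilter U -> 0 < e -> (\forall i \near U, holo_bounded (f_ i) z e L) ->
  (forall w, rnorm (w - z) < e -> f_ i w @[i --> U] --> f w) ->
  differentiable f z.
Proof.
move=> UU e0 fL fl; pose K := `|32 * L / e ^+ 2| + `|4 * L / e|.
have e40 : 0 < e / 4 by lra.
apply: (@limit_differentiable _ _ U _ _ f_ f z (e / 4) K UU _ e40 _ _).1.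
- exact: compact_balls_rV.
- apply: filterS fL => i fi v; have [H1 H2] := holo_quad v e0 fi; split => [/H1|].
    move=> /le_trans; apply; rewrite ler_wpM2r ?sqr_ge0// (le_trans (ler_norm _))//.
    by rewrite lerDl.
  apply: (le_trans H2); rewrite ler_wpM2r ?rnorm_ge0// (le_trans (ler_norm _))//.
  by rewrite lerDr.
- by move=> v vr; apply: fl; rewrite addrAC subrr add0r; lra.
Qed.

Lemma diff_inj n (f : 'rV[C]_n -> 'rV[C]_n) (z : 'rV[C]_n) (c d : R) :
  differentiable f z -> 0 < c -> 0 < d ->
  (forall v, rnorm v < d -> c * rnorm v <= rnorm (f (z + v) - f z)) ->
  forall v, 'd f z v = 0 -> v = 0.
Proof.
move=> df c0 d0 fc v fv; apply/eqP; rewrite -rnorm_eq0; apply/negP => /negP v0.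
have {}v0 : 0 < rnorm v by rewrite lt0r v0 rnorm_ge0.
have c2 : 0 < c / 2 by lra.
have [s s0 sP] := differentiable_rnorm df c2.
pose a := Num.min d s / 2 / rnorm v.
have ds : 0 < Num.min d s by rewrite lt_min d0.
have a0 : 0 < a by rewrite !divr_gt0.
have av : rnorm (a%:C%C *: v) = Num.min d s / 2.
  by rewrite rnormZ rnorm_real gtr0_norm// /a divfK// gt_eqF.
have H1 : Num.min d s <= d by rewrite ge_min lexx.
have H2 : Num.min d s <= s by rewrite ge_min lexx orbT.
have avd : rnorm (a%:C%C *: v) < d by rewrite av; lra.
have avs : rnorm (a%:C%C *: v) < s by rewrite av; lra.
have := sP _ avs; have -> : 'd f z (a%:C%C *: v) = a%:C%C *: 'd f z v by exact: linearZ.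
rewrite fv scaler0 subr0; have := fc _ avd; rewrite av => H3 H4.
have := le_trans H3 H4; rewrite ler_pM2r; last by lra.
lra.
Qed.

Lemma holo_lower n (f : 'rV[C]_n -> 'rV[C]_n) (z : 'rV[C]_n) (e L c : R) :
  0 < e -> holo_bounded f z e L -> 0 < c ->
  (forall v, c * rnorm v <= rnorm ('d f z v)) ->
  exists2 d : R, 0 < d & forall x y, rnorm (x - z) < d -> rnorm (y - z) < d ->
    c / 2 * rnorm (x - y) <= rnorm (f x - f y).
Proof.
move=> e0 fL c0 fc; have L0 := holo_bounded_ge0 e0 fL.
pose Q := 32 * L / e ^+ 2.
have Q0 : 0 <= Q by apply: divr_ge0; [exact: mulr_ge0|exact: sqr_ge0].
pose s := Num.min (e / 4) (c / (64 * (Q + 1))).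
have Q1 : 0 < 64 * (Q + 1) by lra.
have e40 : 0 < e / 4 by lra.
have s0 : 0 < s by rewrite lt_min e40 divr_gt0.
have se : s <= e / 4 by rewrite ge_min lexx.
have sc : s * (64 * (Q + 1)) <= c by rewrite -ler_pdivlMr// ge_min lexx orbT.
have zz : rnorm (z - z) < e by rewrite subrr rnorm0.
have [df _] := fL z zz.
pose psi x := f x - f z - 'd f z (x - z).
have psiB : holo_bounded psi z s (Q * s ^+ 2).
  move=> x xz; split.
    have [|dfx _] := fL x; first lra.
    have d1 : differentiable (fun x => f x - f z) x.
      apply: differentiableB; [exact: dfx|exact: differentiable_cst].
    have d2 : differentiable (fun x => x - z) x.
      by apply: (@differentiableB _ _ _ id (fun=> z)); [exact: ex_diff|exact: differentiable_cst].
    have d3 : differentiable ('d f z) (x - z).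
      apply: linear_differentiable; exact: (diff_continuous df).
    exact: (differentiableB d1 (differentiable_comp d2 d3)).
  have xe : rnorm (x - z) <= e / 4 by lra.
  have := (holo_quad (x - z) e0 fL).1 xe; rewrite (addrC z) subrK => /le_trans; apply.
  by rewrite ler_wpM2l// lerXn2r ?nnegrE ?rnorm_ge0 ?(ltW s0) ?(ltW xz).
exists (s / 2); first by rewrite divr_gt0.
move=> x y xz yz; have := holo_lip s0 psiB xz yz.
have -> : 32 * (Q * s ^+ 2) / s = 32 * Q * s by field; rewrite gt_eqF.
have -> : psi x - psi y = (f x - f y) - 'd f z (x - y).
  have E (a b d u v : 'rV[C]_n) : a - b - u - (d - b - v) = a - d - (u - v).
    by rewrite subrBB; congr (_ - _); rewrite opprB addrA subrK.
  rewrite /psi E; congr (_ - _).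
  have Ed : 'd f z ((x - z) - (y - z)) = 'd f z (x - z) - 'd f z (y - z) by exact: linearB.
  by rewrite -Ed opprB addrA subrK.
move=> H; have := fc (x - y).
have := rnormB (f x - f y) ((f x - f y) - 'd f z (x - y)); rewrite subKr => H1 H2.
have : 32 * Q * s * rnorm (x - y) <= c / 2 * rnorm (x - y).
  rewrite ler_wpM2r ?rnorm_ge0//; move: sc; rewrite mulrDr mulr1 mulrDr; lra.
have : c * rnorm (x - y) = c / 2 * rnorm (x - y) + c / 2 * rnorm (x - y) by field.
lra.
Qed.

Lemma equicontinuous_cvg {T : topologicalType} {I : Type} (U : set_system I)
    (W : normedModType C) (f_ : I -> T -> W) (f : T -> W) (K : set T) (e : R) :
  ProperFilter U -> compact K -> 0 < e ->
  (forall x, K x -> \forall y \near x & i \near U, rnorm (f_ i y - f_ i x) <= e / 4) ->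
  (forall x, K x -> \forall y \near x, f_ i y @[i --> U] --> f y) ->
  \forall i \near U, forall x, K x -> rnorm (f_ i x - f x) < e.
Proof.
move=> UU /compact_near_coveringP cK e0 ec fl.
apply: (cK _ U (fun i x => rnorm (f_ i x - f x) < e)) => x Kx.
have [[A B] /= [nA UB] AB] := ec x Kx.
have flx : f_ i x @[i --> U] --> f x := nbhs_singleton (fl x Kx).
have e4 : 0 < e / 4 by lra.
have Ux : U [set i | rnorm (f_ i x - f x) < e / 4] by move/cvg_rnormP : flx => /(_ _ e4).
exists (A `&` [set y | f_ i y @[i --> U] --> f y],
        B `&` [set i | rnorm (f_ i x - f x) < e / 4]) => /=.
  by split; apply: filterI => //; exact: fl.
move=> [y i] /= [[Ay fy] [Bi /= fi]].
have H1 := AB (y, i) (conj Ay Bi); rewrite /= in H1.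
have H2 : rnorm (f y - f x) <= e / 2.
  apply: (rnorm_lim_dist_le fy).
  apply: filterS2 UB Ux => k Bk /= fk.
  have H := AB (y, k) (conj Ay Bk); rewrite /= in H.
  rewrite (le_trans (rnorm_tri (f_ k x) _ _))//; lra.
rewrite (le_lt_trans (rnorm_tri (f_ i x) _ _))//.
have := rnorm_tri (f x) (f_ i x) (f y); rewrite (rnormC (f x) (f y)); lra.
Qed.

End LimitTools.

Section LimitAction.
Context {R : realType} {n : nat}.
Local Notation C := R[i].
Local Notation V := 'rV[C]_n.
Context (Dj : nat -> set V) (D : set V) (p : V) (M : R)
  (g : nat -> V -> R -> V) (X : nat -> V -> V) (U : set_system nat).
Context (UU : UltraFilter U) (oD : open D) (cD : connected D) (Dp : D p)
  (oDj : forall j, open (Dj j)) (gA : forall j, one_parameter_action (Dj j) (g j)).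
Context (tameD : forall z, D z -> exists e T K : R, [/\ 0 < e, 0 < T, 0 <= K &
  \forall j \near U, tame (Dj j) (g j) (X j) z e T K M]).
Context (nbD : forall w (e : R), 0 < e ->
  (\forall j \near U, forall z, rnorm (z - w) < e -> Dj j z) -> ~ boundary D w).
Context (g0 : V -> R -> V) (X0 : V -> V)
  (g0P : forall z t, D z -> g j z t @[j --> U] --> g0 z t)
  (X0P : forall z, D z -> X j z @[j --> U] --> X0 z).

Let PU : ProperFilter U. Proof. exact: ultra_proper. Qed.

Lemma tame_near z : D z -> exists e T K : R, [/\ 0 < e, 0 < T, 0 <= K,
  (forall w, rnorm (w - z) < e -> D w) &
  \forall j \near U, tame (Dj j) (g j) (X j) z e T K M].
Proof.
move=> Dz; have [e [T [K [e0 T0 K0 H]]]] := tameD Dz.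
have /nbhs_rnormP[d d0 dD] : nbhs z D by exact: open_nbhs_nbhs.
have me : Num.min e d <= e by rewrite ge_min lexx.
have md : Num.min e d <= d by rewrite ge_min lexx orbT.
exists (Num.min e d), T, K; split => //; first by rewrite lt_min e0.
  by move=> w wz; apply: dD; exact: lt_le_trans md.
apply: filterS H => j [H1 H2 H3 H4].
have zz : rnorm (z - z) + Num.min e d <= e by rewrite subrr rnorm0 add0r.
split => [w wz|||w t wz].
- by apply: H1; exact: lt_le_trans me.
- exact: holo_bounded_sub zz H2.
- by move=> t; exact: holo_bounded_sub zz (H3 t).
- by apply: H4; exact: lt_le_trans me.
Qed.

Lemma limit_action_holo z t : D z -> differentiable (g0^~ t) z.
Proof.
move=> /tame_near[e [T [K [e0 T0 K0 eD H]]]].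
apply: (@limit_holo _ _ U _ (fun j => (g j)^~ t) _ z e M) => //.
  by apply: filterS H => j [_ _ H3 _]; exact: H3.
by move=> w /eD; exact: g0P.
Qed.

Lemma limit_field_holo z : D z -> differentiable X0 z.
Proof.
move=> /tame_near[e [T [K [e0 T0 K0 eD H]]]].
apply: (@limit_holo _ _ U _ X _ z e K) => //.
  by apply: filterS H => j [].
by move=> w /eD; exact: X0P.
Qed.

Lemma limit_displacement z : D z -> exists e T K : R, [/\ 0 < e, 0 < T, 0 <= K,
  (forall w, rnorm (w - z) < e -> D w) &
  forall w t, rnorm (w - z) < e -> `|t| <= T ->
    rnorm (g0 w t - w) <= K * `|t| /\
    rnorm (g0 w t - w - t%:C%C *: X0 w) <= K * `|t| ^+ 2].
Proof.
move=> /tame_near[e [T [K [e0 T0 K0 eD H]]]]; exists e, T, K; split => // w t wz tT.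
have Dw := eD _ wz; split.
  apply: (rnorm_lim_dist_le (@g0P w t Dw)).
  by apply: filterS H => j [_ _ _ /(_ w t wz tT)[]].
have L : (g j w t - w - t%:C%C *: X j w) @[j --> U] --> g0 w t - w - t%:C%C *: X0 w.
  apply: cvgB; last by apply: cvgZr; exact: X0P.
  by apply: cvgB; [exact: g0P|exact: cvg_cst].
apply: rnorm_lim_le L _.
by apply: filterS H => j [_ _ _ /(_ w t wz tT)[]].
Qed.

Lemma limit_action_det : exists2 T : R, 0 < T & forall z t, D z -> `|t| <= T ->
  \det (jacobian (g0^~ t) z) != 0.
Proof.
have [e [T [K [e0 T0 K0 eD H]]]] := limit_displacement Dp.
have K1 : 0 < 64 * (K + 1) by lra.
exists (Num.min T (e / (64 * (K + 1)))); first by rewrite lt_min T0 divr_gt0.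
move=> z t Dz; rewrite le_min => /andP[tT te].
have {}te : `|t| * (64 * (K + 1)) <= e by rewrite -ler_pdivlMr.
have Kt0 : 0 <= K * `|t| by exact: mulr_ge0.
have good_near y : D y -> exists2 r : R, 0 < r & (forall w, rnorm (w - y) < r -> D w) /\
    forall z0 z1, rnorm (z0 - y) < r -> rnorm (z1 - y) < r ->
      \det (jacobian (g0^~ t) z1) != 0 -> \det (jacobian (g0^~ t) z0) != 0.
  move=> /tame_near[d [T' [K' [d0 _ _ dD Hd]]]]; exists (d / 256); first lra.
  split=> [w wy|z0 z1 z0y z1y]; first by apply: dD; lra.
  have d2 : 0 < d / 2 by lra.
  apply: (@hurwitz_jacobian _ _ U _ (fun j => (g j)^~ t) _ z0 z1 (d / 2) M) => //.
  - apply: filterS Hd => j [H1 _ H3 _]; split; first by apply: holo_bounded_sub (H3 t); lra.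
    move=> w wz; apply: (action_det (@oDj j) (gA j)); apply: H1.
    by rewrite (le_lt_trans (rnorm_tri z0 _ _))//; lra.
  - move=> w wz; apply: g0P; apply: dD.
    by rewrite (le_lt_trans (rnorm_tri z0 _ _))//; lra.
  - by rewrite (le_trans (rnorm_tri y _ _))// (rnormC y); lra.
apply: (connected_good cD Dp (good := fun z => \det (jacobian (g0^~ t) z) != 0)) => //.
- apply: det_jacobian_neq0; apply: (@diff_inj _ _ _ _ (1 / 2) (e / 2)).
  + exact: limit_action_holo.
  + lra.
  + lra.
  move=> v ve; have B : holo_bounded (fun w => g0 w t - w) p e (K * `|t|).
    move=> w wp; split; last exact: (H w t wp tT).1.
    by apply: differentiableB => //; apply: limit_action_holo; exact: eD.
  have vp : rnorm (p + v - p) < e / 2 by rewrite addrAC subrr add0r.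
  have pp : rnorm (p - p) < e / 2 by rewrite subrr rnorm0; lra.
  have := holo_lip e0 B vp pp; rewrite (addrC p v) addrK.
  have -> : g0 (v + p) t - (v + p) - (g0 p t - p) = (g0 (v + p) t - g0 p t) - v.
    by rewrite subrBB addrK.
  have : 32 * (K * `|t|) / e <= 1 / 2.
    rewrite ler_pdivrMr//; move: te; rewrite mulrCA mulrDr mulr1.
    have := normr_ge0 t; rewrite (mulrC `|t| K); lra.
  move=> H1 H2; have := rnormB (g0 (v + p) t - g0 p t) (g0 (v + p) t - g0 p t - v).
  rewrite subKr; have := ler_wpM2r (rnorm_ge0 v) H1; lra.
- move=> y Dy gy; have [r r0 [rD rP]] := good_near y Dy.
  apply/nbhs_rnormP; exists r; first exact: r0.
  by move=> w wy; apply: (rP w y wy _ gy); rewrite subrr rnorm0.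
- move=> y Dy yB; have [r r0 [rD rP]] := good_near y Dy.
  have [w [[Dw gw] /= wy]] := yB _ (near_rnorm y r0).
  by apply: (rP y w _ wy gw); rewrite subrr rnorm0.
Qed.

Lemma action_equicontinuous z : D z -> exists e L : R, [/\ 0 < e, 0 <= L,
  (forall w, rnorm (w - z) < e -> D w) &
  \forall j \near U, forall w t s, rnorm (w - z) < e -> `|s| < e ->
    rnorm (g j w (t + s) - g j z t) <= L * (`|s| + rnorm (w - z))].
Proof.
move=> /tame_near[e [T [K [e0 T0 K0 eD H]]]].
have M0 : 0 <= M.
  by have [j [_ _ /(_ 0) Hj _]] := filter_ex H; exact: holo_bounded_ge0 e0 Hj.
have K1 : 0 < 4 * (K + 1) by lra.
pose d := Num.min (e / 4) (Num.min T (e / (4 * (K + 1)))).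
have d0 : 0 < d by rewrite !lt_min T0 divr_gt0//= divr_gt0.
have de : d <= e / 4 by rewrite ge_min lexx.
have dT : d <= T by rewrite !ge_min lexx /= orbT.
have dK : d * (4 * (K + 1)) <= e by rewrite -ler_pdivlMr// !ge_min lexx !orbT.
have L0 : 0 <= 32 * M / e by apply: divr_ge0 (ltW e0); exact: mulr_ge0.
exists d, (32 * M / e * (K + 1)); split => //.
- by rewrite mulr_ge0// addr_ge0.
- by move=> w wz; apply: eD; lra.
apply: filterS H => j [H1 _ H3 H4] w t s wz sd.
have we : rnorm (w - z) < e by lra.
have sT : `|s| <= T by lra.
have [gw _] := H4 w s we sT.
have Ks : K * `|s| <= K * d by rewrite ler_wpM2l// ltW.
have gz : rnorm (g j w s - z) <= K * `|s| + rnorm (w - z).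
  by rewrite (le_trans (rnorm_tri w _ _))// lerD2r.
have gze : rnorm (g j w s - z) < e / 2.
  by move: dK; rewrite mulrDr mulr1 mulrDr (mulrC K) in Ks *; lra.
have zz : rnorm (z - z) < e / 2 by rewrite subrr rnorm0; lra.
rewrite (addrC t s) (actionD (gA j))//; last exact: H1.
rewrite (le_trans (holo_lip e0 (H3 t) gze zz))// -[leRHS]mulrA ler_wpM2l//.
rewrite (le_trans gz)//.
have := mulr_ge0 K0 (rnorm_ge0 (w - z)); have := normr_ge0 s.
rewrite mulrDl mul1r mulrDr; lra.
Qed.

Lemma limit_equicontinuous z : D z -> exists e L : R, [/\ 0 < e, 0 <= L,
  (forall w, rnorm (w - z) < e -> D w) &
  forall w t s, rnorm (w - z) < e -> `|s| < e ->
    rnorm (g0 w (t + s) - g0 z t) <= L * (`|s| + rnorm (w - z))].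
Proof.
move=> Dz; have [e [L [e0 L0 eD H]]] := action_equicontinuous Dz.
exists e, L; split => // w t s wz se.
have C1 : g j w (t + s) - g j z t @[j --> U] --> g0 w (t + s) - g0 z t.
  by apply: cvgB; apply: g0P => //; exact: eD.
apply: (rnorm_lim_le C1).
by apply: filterS H => j; apply.
Qed.

Lemma action_uniform (K : set (V * R)) (e : R) : compact K -> K `<=` D `*` [set: R] ->
  0 < e -> \forall j \near U, forall zt, K zt -> rnorm (g j zt.1 zt.2 - g0 zt.1 zt.2) < e.
Proof.
move=> cK KD e0; apply: (@equicontinuous_cvg _ _ _ U _ (fun j zt => g j zt.1 zt.2)) => //.
- move=> [z t] /KD[/= Dz _]; have [d [L [d0 L0 dD H]]] := action_equicontinuous Dz.
  have L1 : 0 < 8 * (L + 1) by lra.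
  pose r := Num.min d (e / (8 * (L + 1))).
  have r0 : 0 < r by rewrite lt_min d0 divr_gt0.
  have rd : r <= d by rewrite ge_min lexx.
  have rL : r * (8 * (L + 1)) <= e by rewrite -ler_pdivlMr// ge_min lexx orbT.
  exists ([set ws : V * R | rnorm (ws.1 - z) < r /\ `|ws.2 - t| < r],
    [set j | forall w u s, rnorm (w - z) < d -> `|s| < d ->
      rnorm (g j w (u + s) - g j z u) <= L * (`|s| + rnorm (w - z))]) => /=.
    split => //; exists ([set w | rnorm (w - z) < r], [set s : R | `|s - t| < r]) => //=.
    split; first exact: (near_rnorm z r0).
    by apply/nbhs_ballP; exists r => // s; rewrite /ball /= distrC.
  move=> [[w s] j] /= [[wz st] Hj].
  have := Hj w t (s - t); rewrite (addrC t) subrK => Q.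
  rewrite (le_trans (Q _ _))//; [lra|lra|].
  have : L * (`|s - t| + rnorm (w - z)) <= L * (r + r).
    by rewrite ler_wpM2l// lerD// ltW.
  by move: rL; rewrite mulrDr mulr1 mulrDr (mulrC r (8 * L)) -(mulrA 8) mulrDr; lra.
- move=> [z t] /KD[/= Dz _]; exists (D, setT) => /=.
    by split; [exact: open_nbhs_nbhs|exact: filterT].
  by move=> [w s] /= [Dw _]; exact: g0P.
Qed.

Lemma field_uniform (K : set V) (e : R) : compact K -> K `<=` D ->
  0 < e -> \forall j \near U, forall z, K z -> rnorm (X j z - X0 z) < e.
Proof.
move=> cK KD e0; apply: (@equicontinuous_cvg _ _ _ U) => //.
- move=> z /KD Dz; have [d [T [L [d0 T0 L0 dD H]]]] := tame_near Dz.
  have Q0 : 0 <= 32 * L / d by apply: divr_ge0 (ltW d0); exact: mulr_ge0.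
  have Q1 : 0 < 4 * (32 * L / d + 1) by rewrite mulr_gt0// ltr_wpDl.
  pose r := Num.min (d / 2) (e / (4 * (32 * L / d + 1))).
  have r0 : 0 < r by rewrite lt_min !divr_gt0.
  have rd : r <= d / 2 by rewrite ge_min lexx.
  have rL : r * (4 * (32 * L / d + 1)) <= e by rewrite -ler_pdivlMr// ge_min lexx orbT.
  exists ([set w | rnorm (w - z) < r],
    [set j | tame (Dj j) (g j) (X j) z d T L M]) => /=.
    by split => //; exact: (near_rnorm z r0).
  move=> [w j] /= [wz [_ H2 _ _]].
  have zz : rnorm (z - z) < d / 2 by rewrite subrr rnorm0; lra.
  have wd : rnorm (w - z) < d / 2 by lra.
  rewrite (le_trans (holo_lip d0 H2 wd zz))//.
  have : 32 * L / d * rnorm (w - z) <= 32 * L / d * r by rewrite ler_wpM2l// ltW.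
  by move: rL; rewrite mulrCA mulrDr mulr1 (mulrC r); lra.
- move=> z /KD Dz; have : nbhs z D by exact: open_nbhs_nbhs.
  by apply: filterS => w; exact: X0P.
Qed.

Lemma domains_uniform (K : set V) : compact K -> K `<=` D ->
  \forall j \near U, K `<=` Dj j.
Proof.
move=> /compact_near_coveringP cK KD; apply: (cK _ U (fun j z => Dj j z)) => z /KD Dz.
have [d [T [L [d0 T0 L0 dD H]]]] := tame_near Dz.
exists ([set w | rnorm (w - z) < d], [set j | tame (Dj j) (g j) (X j) z d T L M]) => /=.
  by split => //; exact: (near_rnorm z d0).
by move=> [w j] /= [wz [H1 _ _ _]]; exact: H1.
Qed.

Lemma limit_action0 z : D z -> g0 z 0 = z.
Proof.
move=> /limit_displacement[d [T [L [d0 T0 L0 _ H]]]].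
have zz : rnorm (z - z) < d by rewrite subrr rnorm0.
have := (H z 0 zz _).1; rewrite normr0 mulr0 => /(_ (ltW T0)) H0.
by apply/eqP; rewrite -subr_eq0 -rnorm_eq0 eq_le H0 rnorm_ge0.
Qed.

Lemma limit_actionD z t s : D z -> D (g0 z t) -> g0 z (t + s) = g0 (g0 z t) s.
Proof.
move=> Dz Dq; have [d [L [d0 L0 dD H]]] := action_equicontinuous Dq.
have [d' [T' [L' [d'0 _ _ _ H']]]] := tame_near Dz.
have zz : rnorm (z - z) < d' by rewrite subrr rnorm0.
suff : g j z (t + s) @[j --> U] --> g0 (g0 z t) s.
  by move=> Q; apply: (cvg_rnorm_unique (@g0P z (t + s) Dz) Q).
apply/cvg_rnormP => e e0; have e2 : 0 < e / 2 by lra.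
have L1 : 0 < 2 * (L + 1) by lra.
pose r := Num.min d (e / (2 * (L + 1))).
have r0 : 0 < r by rewrite lt_min d0 divr_gt0.
have rd : r <= d by rewrite ge_min lexx.
have rL : r * (2 * (L + 1)) <= e by rewrite -ler_pdivlMr// ge_min lexx orbT.
have /cvg_rnormP/(_ r r0) A1 := @g0P z t Dz.
have /cvg_rnormP/(_ _ e2) A2 := @g0P (g0 z t) s Dq.
near=> j.
have [H1 _ _ _] : tame (Dj j) (g j) (X j) z d' T' L' M by near: j.
rewrite (actionD (gA j)); last exact: H1.
have Q1 : rnorm (g j z t - g0 z t) < r by near: j.
have Q2 : rnorm (g j (g0 z t) s - g0 (g0 z t) s) < e / 2 by near: j.
have Q3 : rnorm (g j (g j z t) (s + 0) - g j (g0 z t) s) <=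
    L * (`|0 : R| + rnorm (g j z t - g0 z t)).
  have Hj : forall w t' s', rnorm (w - g0 z t) < d -> `|s'| < d ->
    rnorm (g j w (t' + s') - g j (g0 z t) t') <= L * (`|s'| + rnorm (w - g0 z t)).
    by near: j.
  by apply: Hj; [lra|rewrite normr0].
rewrite addr0 normr0 add0r in Q3.
rewrite (le_lt_trans (rnorm_tri (g j (g0 z t) s) _ _))//.
have : L * rnorm (g j z t - g0 z t) <= L * r by rewrite ler_wpM2l// ltW.
move: rL; rewrite mulrCA mulrDr mulr1 (mulrC r); lra.
Unshelve. all: by end_near. Qed.

Lemma limit_bounded z t : D z -> rnorm (g0 z t) <= M.
Proof.
move=> Dz; have [d [T [L [d0 _ _ _ H]]]] := tame_near Dz.
have zz : rnorm (z - z) < d by rewrite subrr rnorm0.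
apply: (rnorm_lim_le (@g0P z t Dz)); apply: filterS H => j [_ _ H3 _].
exact: (H3 t z zz).2.
Qed.

(* Where the limit map is locally invertible, the maps [g j ^~ t] satisfy a
   uniform lower Lipschitz bound, so their images contain a ball of fixed
   radius around [g0 z t]. *)
Lemma limit_avoids_boundary z t : D z -> \det (jacobian (g0^~ t) z) != 0 ->
  ~ boundary D (g0 z t).
Proof.
move=> Dz J0; have [c c0 cP] := det_jacobian_lower J0.
have [e [T [K [e0 _ _ eD H]]]] := tame_near Dz.
have B0 : holo_bounded (g0^~ t) z e M.
  by move=> w /eD Dw; split; [exact: limit_action_holo|exact: limit_bounded].
have [d d0 dP] := holo_lower e0 B0 c0 cP.
have med : 0 < Num.min d e by rewrite lt_min d0.
have [s sE] : exists s, s = Num.min d e / 2 by eexists.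
have s0 : 0 < s by rewrite sE; lra.
have sd : s < d by have : Num.min d e <= d by [rewrite ge_min lexx]; rewrite sE; lra.
have se : s < e by have : Num.min d e <= e by [rewrite ge_min lexx orbT]; rewrite sE; lra.
have del0 : 0 < c * s / 128 by rewrite divr_gt0// mulr_gt0.
have cK : compact ([set w | rnorm (w - z) <= s] `*` [set t]).
  by apply: compact_setX; [exact: compact_closed_rball|exact: compact_set1].
have KD : [set w | rnorm (w - z) <= s] `*` [set t] `<=` D `*` [set: R].
  by move=> [w u] /= [ws _]; split => //; apply: eD; lra.
have c4 : 0 < c / 4 by lra.
have s4 : 0 < s / 4 by lra.
have kap0 : 0 < c / 4 * (s / 4) / 2 / 2 by rewrite !divr_gt0// mulr_gt0.
apply: (nbD kap0).
have /cvg_rnormP/(_ _ kap0) A1 := @g0P z t Dz.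
apply: filterS3 H A1 (action_uniform cK KD del0) => j [H1 _ H3 _] Aj Uj w wz.
apply: (@inverse_ball _ _ (Dj j) ((g j)^~ t) ((g j)^~ (- t)) z (s / 4) (c / 4)) => //.
- by move=> v vz; apply: H1; lra.
- by move=> v; exact: (action_mem (gA j)).
- by move=> v /(action_differentiable (gA j) t)/differentiable_continuous.
- by move=> v /(action_differentiable (gA j) (- t))/differentiable_continuous.
- by move=> v; exact: (actionK (gA j)).
- by move=> v; exact: (actionNK (gA j)).
- move=> x y xz yz; have phiB : holo_bounded (fun v => g j v t - g0 v t) z s (c * s / 128).
    move=> v vz; split; last by apply/ltW/(Uj (v, t)); split => //=; exact: ltW.
    have ve : rnorm (v - z) < e by lra.
    apply: differentiableB; first exact: (H3 t v ve).1.
    exact: (B0 v ve).1.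
  have xs : rnorm (x - z) < s / 2 by lra.
  have ys : rnorm (y - z) < s / 2 by lra.
  have := holo_lip s0 phiB xs ys.
  have -> : 32 * (c * s / 128) / s = c / 4 by field; rewrite gt_eqF.
  rewrite subrBB; have xd : rnorm (x - z) < d by lra.
  have yd : rnorm (y - z) < d by lra.
  have := dP x y xd yd.
  have := rnormB (g j x t - g j y t) (g j x t - g j y t - (g0 x t - g0 y t)).
  rewrite subKr; set r := rnorm (x - y) => Q1 Q3 Q2.
  have E : c / 2 * r = c / 4 * r + c / 4 * r by field.
  by rewrite -(lerD2r (c / 4 * r)) -E (le_trans Q3)// (le_trans Q1)// lerD2l.
- rewrite (le_lt_trans (rnorm_tri (g0 z t) _ _))// (rnormC (g0 z t)); lra.
Qed.

Lemma limit_mem z t : D z -> D (g0 z t).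
Proof.
have [T T0 HT] := limit_action_det.
have [e [T' [K [e0 T'0 K0 eD H]]]] := limit_displacement Dp.
have K1 : 0 < K + 1 by lra.
pose tau := Num.min T (Num.min T' (e / 2 / (K + 1))).
have tau0 : 0 < tau by rewrite !lt_min T0 T'0 !divr_gt0.
have tT : tau <= T by rewrite ge_min lexx.
have tT' : tau <= T' by rewrite !ge_min lexx orbT.
have tK : tau * (K + 1) <= e / 2 by rewrite -ler_pdivlMr// !ge_min lexx !orbT.
have small z' s : D z' -> `|s| <= tau -> D (g0 z' s).
  move=> Dz' st; pose A := (fun w => g0 w s) @` D.
  have cA : connected A.
    apply: connected_continuous_connected => //; apply: continuous_in_subspaceT => w.
    by rewrite inE => /limit_action_holo -/(_ s)/differentiable_continuous.
  apply: (@connected_subset _ _ A D (g0 p s)) => //; last by exists z'.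
  - by exists p.
  - apply: eD; have pp : rnorm (p - p) < e by rewrite subrr rnorm0.
    rewrite (le_lt_trans (H p s pp (le_trans st tT')).1)//.
    have : K * `|s| <= K * tau by rewrite ler_wpM2l.
    by move: tK; rewrite mulrDr mulr1 (mulrC tau); lra.
  - move=> _ [w Dw <-]; apply: limit_avoids_boundary => //; apply: HT => //.
    exact: le_trans tT.
have scaled m : forall z' s, D z' -> `|s| <= 2 ^+ m * tau -> D (g0 z' s).
  elim: m => [|m IH] z' s Dz' st; first by apply: small => //; rewrite expr0 mul1r in st.
  have sE : s = s / 2 + s / 2 by lra.
  have s2 : `|s / 2| <= 2 ^+ m * tau.
    rewrite normrM [`|2^-1|]ger0_norm ?invr_ge0// ler_pdivrMr//.
    by rewrite mulrAC -exprSr.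
  have D1 : D (g0 z' (s / 2)) by exact: IH.
  by rewrite sE limit_actionD//; exact: IH.
move=> Dz; apply: (scaled (Num.truncn (`|t| / tau)).+1) => //.
rewrite -ler_pdivrMr// (le_trans (ltW (truncnS_gt _)))//.
by rewrite -natrX ler_nat ltnW// ltn_expl.
Qed.

Lemma limit_one_parameter_action : one_parameter_action D g0.
Proof.
split.
- move=> t; exists (g0^~ (- t)); split.
  + by move=> z Dz; exact: limit_action_holo.
  + by move=> z Dz; exact: limit_action_holo.
  + by move=> z; exact: limit_mem.
  + by move=> z; exact: limit_mem.
  + split => z Dz; rewrite -limit_actionD//; do ?exact: limit_mem.
      by rewrite subrr limit_action0.
    by rewrite addNr limit_action0.
- move=> t0 K A /compact_near_coveringP cK KD oA KA.
  apply: (cK _ (nbhs t0) (fun t z => A (g0 z t))) => z Kz.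
  have Dz := KD z Kz; have [d [L [d0 L0 dD H]]] := limit_equicontinuous Dz.
  have /nbhs_rnormP[e e0 eA] : nbhs (g0 z t0) A by apply: open_nbhs_nbhs; split => //; exact: KA.
  have L1 : 0 < 2 * (L + 1) by lra.
  pose r := Num.min d (e / (2 * (L + 1))).
  have r0 : 0 < r by rewrite lt_min d0 divr_gt0.
  have rd : r <= d by rewrite ge_min lexx.
  have rL : r * (2 * (L + 1)) <= e by rewrite -ler_pdivlMr// ge_min lexx orbT.
  exists ([set w | rnorm (w - z) < r], [set s : R | `|s - t0| < r]) => /=.
    split; first exact: (near_rnorm z r0).
    by apply/nbhs_ballP; exists r => // s; rewrite /ball /= distrC.
  move=> [w s] /= [wz st]; apply: eA.
  have := H w t0 (s - t0); rewrite (addrC t0) subrK => Q.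
  rewrite (le_lt_trans (Q _ _))//; [lra|lra|].
  have : L * (`|s - t0| + rnorm (w - z)) <= L * (r + r).
    by rewrite ler_wpM2l// lerD// ltW.
  by move: rL; rewrite mulrDr mulr1 mulrDr (mulrC r (2 * L)) -(mulrA 2) mulrDr; lra.
- exact: limit_action0.
- by move=> z t s Dz; apply: limit_actionD => //; exact: limit_mem.
Qed.

Lemma limit_generates : generates D g0 X0.
Proof.
split=> [|z Dz]; first exact: limit_field_holo.
have [e [T [K [e0 T0 K0 eD H]]]] := limit_displacement Dz.
have zz : rnorm (z - z) < e by rewrite subrr rnorm0.
apply/cvg_rnormP => d d0; rewrite limit_action0//.
have K1 : 0 < K + 1 by lra.
apply/nbhs_ballP; exists (Num.min T (d / (K + 1))); first by rewrite /= lt_min T0 divr_gt0.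
move=> t; rewrite /ball /= sub0r normrN lt_min => /andP[tT td] t0.
have {}td : `|t| * (K + 1) < d by rewrite -ltr_pdivlMr.
have -> : (t^-1)%:C%C *: (g0 z t - z) - X0 z =
    (t^-1)%:C%C *: (g0 z t - z - t%:C%C *: X0 z).
  by rewrite [in RHS]scalerBr scalerA -rmorphM mulVf// scale1r.
rewrite rnormZ rnorm_real normfV ltr_pdivrMl ?normr_gt0//.
rewrite (le_lt_trans (H z t zz (ltW tT)).2)//.
have t1 : 0 < `|t| by rewrite normr_gt0.
rewrite expr2 mulrA [ltRHS]mulrC ltr_pM2r//.
by move: td; rewrite mulrDr mulr1 (mulrC K); lra.
Qed.

Lemma limit_nontrivial (r : R) : 0 < r -> (forall z, enorm (z - p) <= r -> D z) ->
  (forall j, sup_norm (eball p r) (X j) = 1%E) -> nontrivial_action D g0.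
Proof.
move=> r0 rD X1; apply: contrapT => triv.
have fixed z t : D z -> g0 z t = z.
  by move=> Dz; apply: contrapT => zt; apply: triv; exists z, t.
have X00 z : D z -> X0 z = 0.
  move=> Dz; have [_ /(_ z Dz) gz] := limit_generates.
  apply: (cvg_rnorm_unique gz); apply/cvg_rnormP => e e0.
  by apply: nearW => t; rewrite !fixed// !subrr scaler0 subrr rnorm0.
have cK : compact [set z | enorm (z - p) <= r].
  have ec (w : V) : {for w, continuous (fun z : V => enorm (z - p))}.
    exact: continuous_enormB.
  apply: (@subclosed_compact _ _ [set w : V | rnorm (w - p) <= r]).
  - apply: (@preimage_closed _ _ (fun w : V => enorm (w - p)) [set x | x <= r]) => [w _|].
      exact: ec.
    exact: closed_le.
  - exact: compact_closed_rball.
  - by move=> w /=; apply: le_trans; exact: enorm_ge_rnorm.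
have e0 : 0 < (2 * n.+1%:R)^-1 :> R by rewrite invr_gt0.
have [j Hj] := filter_ex (field_uniform cK rD e0).
have : (sup_norm (eball p r) (X j) <= (2^-1)%:E)%E.
  apply: ge_ereal_sup => _ [z zr <-]; rewrite lee_fin.
  have zr' : enorm (z - p) <= r by exact: ltW.
  have := Hj z zr'; rewrite X00 ?subr0; last exact: rD.
  move=> /ltW; rewrite invfM ler_pdivlMr ?ltr0n// mulrC => H.
  exact: le_trans (enorm_le_rnorm _) H.
rewrite X1 lee_fin; lra.
Qed.

End LimitAction.

(** * Extraction of the subsequence *)

Lemma increasing_selection (U : set_system nat) (G : nat -> set nat) : ProperFilter U ->
  \oo `<=` U -> (forall m, U (G m)) ->
  exists phi : nat -> nat, {homo phi : i j / (i < j)%N} /\ forall m, G m (phi m).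
Proof.
move=> UU oU UG.
have next mk : exists j, (mk.2 < j)%N /\ G mk.1 j.
  have UI : U [set j | (mk.2 < j)%N] by apply: oU; exists mk.2.+1.
  by have [j [kj Gj]] := filter_ex (filterI UI (UG mk.1)); exists j.
have [f fP] := choice next.
pose phi := fix phi m := if m is m'.+1 then f (m, phi m') else f (0%N, 0%N).
exists phi; split.
  by apply: homo_ltn => [y x z|m]; [exact: ltn_trans|exact: (fP (m.+1, phi m)).1].
by case=> [|m]; [exact: (fP (0%N, 0%N)).2|exact: (fP (m.+1, phi m)).2].
Qed.

Section Exhaustion.
Context {R : realType} {n : nat}.
Local Notation C := R[i].
Local Notation V := 'rV[C]_n.
Context (D : set V).

Definition exhaustion (m : nat) : set (V * R) :=
  [set z | rnorm z <= m%:R /\ forall w, rnorm (w - z) < m.+1%:R^-1 -> D w]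
    `*` `[- m%:R, m%:R].

Lemma exhaustion_subset m : exhaustion m `<=` D `*` [set: R].
Proof.
by move=> [z t] [[_ zD] _]; split => //=; apply: zD; rewrite subrr rnorm0 invr_gt0.
Qed.

Lemma compact_exhaustion m : compact (exhaustion m).
Proof.
apply: compact_setX; last exact: segment_compact.
apply: (@compact_closedI _ [set z : V | rnorm z <= m%:R]); first exact: compact_rball.
move=> z zB w wz; have e0 : 0 < m.+1%:R^-1 - rnorm (w - z) by rewrite subr_gt0.
have [z' [z'S /= z'z]] := zB _ (near_rnorm z e0).
by apply: z'S; rewrite (le_lt_trans (rnorm_tri z _ _))// (rnormC z) addrC -ltrBrDr.
Qed.

Lemma exhaustion_covers (K : set (V * R)) : open D -> compact K -> K `<=` D `*` [set: R] ->
  \forall m \near \oo, K `<=` exhaustion m.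
Proof.
move=> oD /compact_near_coveringP cK KD.
apply: (cK _ \oo (fun m zt => exhaustion m zt)) => -[z t] /KD[/= Dz _].
have /nbhs_rnormP[e e0 eD] : nbhs z D by exact: open_nbhs_nbhs.
have e2 : 0 < e / 2 by lra.
exists ([set ws : V * R | rnorm (ws.1 - z) < e / 2 /\ `|ws.2 - t| < 1],
  [set m | [/\ m.+1%:R^-1 < e / 2, rnorm z + e / 2 <= m%:R & `|t| + 1 <= m%:R]]) => /=.
  split.
    exists ([set w | rnorm (w - z) < e / 2], [set s : R | `|s - t| < 1]) => //=.
    split; first exact: (near_rnorm z e2).
    by apply/nbhs_ballP; exists 1 => //= s; rewrite /ball /= distrC.
  near=> m; split; near: m.
  - exact: near_infty_natSinv_lt (PosNum e2).
  - exact: nbhs_infty_ger.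
  - exact: nbhs_infty_ger.
move=> [[w s] m] /= [[wz st] [m1 m2 m3]]; split => /=; first split.
- rewrite -[w](subrK z) (le_trans (rnormD _ _))//; lra.
- move=> u uw; apply: eD; rewrite (le_lt_trans (rnorm_tri w _ _))// (splitr e) ltrD//.
  exact: lt_trans m1.
- rewrite in_itv /= -ler_norml (le_trans _ m3)// -[s](subrK t).
  by rewrite (le_trans (ler_normD _ _))// addrC lerD2l ltW.
Unshelve. all: by end_near. Qed.

End Exhaustion.

Theorem theorem2p5 (R : realType) (n : nat)
  (Dj : nat -> set (Cn R n)) (D : set (Cn R n))
  (p : Cn R n) (r a : R)
  (g : nat -> Cn R n -> R -> Cn R n) (X : nat -> Cn R n -> Cn R n)
  (hDj : forall j, bounded_domain (Dj j))
  (hD : bounded_domain D)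
  (hcvg : (fun j => domain_dist (Dj j) D) @ \oo --> 0%E)
  (hr : 0 < r) (ha : 0 < a)
  (hball : forall j, eball p (r + a) `<=` Dj j)
  (hp : D p)
  (hg : forall j, one_parameter_action (Dj j) (g j))
  (hnt : forall j, nontrivial_action (Dj j) (g j))
  (hX : forall j, generates (Dj j) (g j) (X j))
  (hnorm : forall j, sup_norm (eball p r) (X j) = 1%E) :
  exists phi : nat -> nat, {homo phi : i j / (i < j)%N} /\
    exists (g0 : Cn R n -> R -> Cn R n) (X0 : Cn R n -> Cn R n),
      [/\ one_parameter_action D g0,
          nontrivial_action D g0,
          generates D g0 X0,
          cvg_on_compacta
            (fun k => Dj (phi k) `*` [set: R])
            (fun k (zt : Cn R n * R) => g (phi k) zt.1 zt.2)
            (D `*` [set: R])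
            (fun zt : Cn R n * R => g0 zt.1 zt.2) &
          cvg_on_compacta
            (fun k => Dj (phi k)) (fun k => X (phi k)) D X0].
Proof.
have oD : open D by case: hD => -[].
have cD : connected D by case: hD => -[].
have oDj j : open (Dj j) by case: (hDj j) => -[].
have ra : 0 < r + a by rewrite addr_gt0.
have [U [UU oU]] := ultrafilter_infty.
have PU : ProperFilter U by exact: ultra_proper.
have [rr rr0 rrP] : exists2 e : R, 0 < e & forall w, rnorm (w - p) < e -> eball p r w.
  by apply/nbhs_rnormP/open_eball; rewrite /eball /= subrr enorm0.
have X1 j w : rnorm (w - p) < rr -> Dj j w /\ rnorm (X j w) <= 1.
  move=> /rrP wr; split.
    by apply: hball; rewrite /eball /= (lt_trans wr)// ltrDl.
  rewrite (le_trans (enorm_ge_rnorm _))// -lee_fin -(hnorm j).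
  by apply: ereal_sup_ubound; exists w.
have [M [M0 bddD]] := domains_bounded hDj hD hcvg.
have exhD := domain_exhaustion hDj hD hcvg ra hball hp.
have tameD z : D z -> exists e T K : R, [/\ 0 < e, 0 < T, 0 <= K &
    \forall j \near U, tame (Dj j) (g j) (X j) z e T K M].
  move=> Dz; have [e [T [K [e0 T0 K0 H]]]] := family_tame cD hp exhD bddD hg hX rr0 X1 Dz.
  by exists e, T, K; split => //; exact: oU.
have nbD w (e : R) : 0 < e -> (\forall j \near U, forall z, rnorm (z - w) < e -> Dj j z) ->
    ~ boundary D w.
  by move=> e0 H; exact: (not_boundary_limit hDj hcvg PU oU e0 H).
have cv (f : nat -> Cn R n) (L : R) : (\forall j \near U, rnorm (f j) <= L) ->
    exists l : Cn R n, f @ U --> l.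
  by apply: ultra_bounded_cvg; exact: compact_balls_rV.
have limg (zt : Cn R n * R) : exists l : Cn R n, D zt.1 -> g j zt.1 zt.2 @[j --> U] --> l.
  case: zt => z t /=; have [Dz|nDz] := pselect (D z); last by exists 0.
  have [e [T [K [e0 T0 K0 H]]]] := tameD z Dz.
  have [|l lP] := cv (fun j => g j z t) M; last by exists l.
  apply: filterS H => j [_ _ /(_ t z) H3 _].
  by apply: (H3 _).2; rewrite subrr rnorm0.
have limX z : exists l : Cn R n, D z -> X j z @[j --> U] --> l.
  have [Dz|nDz] := pselect (D z); last by exists 0.
  have [e [T [K [e0 T0 K0 H]]]] := tameD z Dz.
  have [|l lP] := cv (fun j => X j z) K; last by exists l.
  apply: filterS H => j [_ /(_ z) H2 _ _].
  by apply: (H2 _).2; rewrite subrr rnorm0.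
have [[G0 G0P] [X0 X0P]] := (choice limg, choice limX).
pose g0 z t := G0 (z, t).
have g0P z t : D z -> g j z t @[j --> U] --> g0 z t by exact: (G0P (z, t)).
pose good m := [set j | forall zt, exhaustion D m zt -> Dj j zt.1 /\
  (rnorm (g j zt.1 zt.2 - g0 zt.1 zt.2) < m.+1%:R^-1 /\
   rnorm (X j zt.1 - X0 zt.1) < m.+1%:R^-1)].
have Ugood m : U (good m).
  have cE := @compact_exhaustion R n D m; have sE := @exhaustion_subset R n D m.
  have m0 : 0 < m.+1%:R^-1 :> R by rewrite invr_gt0.
  have cE1 : compact (fst @` exhaustion D m).
    apply: continuous_compact => //; apply: continuous_subspaceT => x; exact: cvg_fst.
  have sE1 : fst @` exhaustion D m `<=` D by move=> _ [zt /sE[Dz _] <-].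
  have A1 := action_uniform UU oD hg tameD g0P cE sE m0.
  have A2 := field_uniform UU oD tameD X0P cE1 sE1 m0.
  have A3 := domains_uniform UU oD tameD cE1 sE1.
  apply: filterS3 A1 A2 A3 => j H1 H2 H3 zt Ezt.
  have Ez : (fst @` exhaustion D m) zt.1 by exists zt.
  by split; [exact: H3|split; [exact: H1|exact: H2]].
have [phi [phi_homo phiP]] := increasing_selection PU oU Ugood.
have near_small (e : R) : 0 < e -> \forall m \near \oo, n.+1%:R * m.+1%:R^-1 < e.
  move=> e0; have e1 : 0 < e / n.+1%:R by rewrite divr_gt0.
  by apply: filterS (near_infty_natSinv_lt (PosNum e1)) => m /=; rewrite ltr_pdivlMr// mulrC.
have small (v : Cn R n) (e : R) m : rnorm v < m.+1%:R^-1 -> n.+1%:R * m.+1%:R^-1 < e ->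
    enorm v < e.
  move=> vm; apply: le_lt_trans; rewrite (le_trans (enorm_le_rnorm _))//.
  by rewrite ler_wpM2l// ltW.
exists phi; split => //; exists g0, X0; split.
- exact: (limit_one_parameter_action UU oD cD hp oDj hg tameD nbD g0P X0P).
- have rD z : enorm (z - p) <= r -> D z.
    move=> zr; apply: (eball_subset_limit hDj hD hcvg ra hball hp).
    by rewrite /eball /= (le_lt_trans zr)// ltrDl.
  exact: (limit_nontrivial UU oD tameD g0P X0P hr rD hnorm).
- exact: (limit_generates UU oD tameD g0P X0P).
- move=> K cK KD e e0; apply: filterS2 (exhaustion_covers oD cK KD) (near_small e e0).
  move=> m Km me; split=> [zt /Km/(phiP m)[Dz _]|zt /Km/(phiP m)[_ [H _]]].
    by split.
  exact: small H me.
- move=> K cK KD e e0.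
  have cK0 : compact (K `*` [set 0 : R]) by apply: compact_setX => //; exact: compact_set1.
  have KD0 : K `*` [set 0 : R] `<=` D `*` [set: R] by move=> zt [/KD].
  apply: filterS2 (exhaustion_covers oD cK0 KD0) (near_small e e0).
  move=> m Km me; split=> z Kz; have [Dz [_ H]] := phiP m (z, 0) (Km (z, 0) (conj Kz erefl)).
    exact: Dz.
  exact: small H me.
Qed.
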